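(* Let $2<p<\infty$ and $t=2p/(p-2)$. For integers $M,N\ge2$, $K\ge1$, $L\ge0$, a real number $d>0$, and $$X(z)=\frac{d}{\sqrt M}\,z^LD_M(z^N),\qquad D_M(z)=1+z+\cdots+z^{M-1},$$ one has $$\sup_{h\in\mathcal A_K}\|Xh\|_2\asymp_p d\left[1+M^{1/t}\min\{1,(K/N)^{1/p}\}\right].$$ Also, the multiplication operator $M_X:H^t\to H^2$, $M_Xh=Xh$, satisfies $\|M_X:H^t\to H^2\|=\|X\|_p\asymp_p d\,M^{1/t}$.
   Context: $\mathbb T$ is the unit circle with normalized Haar measure $m$, $\mathbb D$ the open unit disc, $H^u$ the Hardy space identified with boundary functions, $\|\cdot\|_u$ the norm of $L^u(\mathbb T,m)$. For $a\in\mathbb D$, $P_a(\zeta)=\frac{1-|a|^2}{|1-\overline a\zeta|^2}$, $\zeta\in\mathbb T$. $\mathcal A_K$ is the set of outer functions $h\in H^t$ such that on $\mathbb T$ (a.e.) $|h|^t=\sum_{\nu=1}^Kc_\nu P_{a_\nu}$ for some $a_\nu\in\mathbb D$, $c_\nu\ge0$, $\sum_{\nu=1}^Kc_\nu=1$. $\asymp_p$ means comparability with positive constants depending only on $p$ (not on $M,N,K,L,d$). *)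

(* Defs.v *)
From HB Require Import structures.
From mathcomp Require Import all_boot all_order all_algebra.
From mathcomp Require Import complex.
From mathcomp Require Import all_classical all_reals all_analysis.

Set Implicit Arguments.
Unset Strict Implicit.
Unset Printing Implicit Defensive.

Import Order.TTheory GRing.Theory Num.Theory.
Import numFieldNormedType.Exports.

Local Open Scope classical_set_scope.
Local Open Scope ring_scope.
Local Open Scope complex_scope.

(* The complex plane is R[i]; its topology and derivatives are those that
   MathComp-Analysis puts on every numFieldType.  [cabs] is the real-valued
   modulus ([`|z|] lives in R[i]). *)
Definition cabs (R : realType) (z : R[i]) : R := ComplexField.Normc.normc z.

Definition expi (R : realType) (x : R) : R[i] := cos x +i* sin x.

Definition cexp (R : realType) (z : R[i]) : R[i] :=
  (expR (complex.Re z))%:C * expi (complex.Im z).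

Lemma two_pi_gt0 (R : realType) : 0 < 2 * pi :> R.
Proof. by rewrite mulr_gt0 // pi_gt0. Qed.

(* Normalized Haar measure on the unit circle, in the angular coordinate:
   a function [f] on the circle is integrated as [fun x => f (expi x)]. *)
Notation haar R := (uniform_prob (@two_pi_gt0 R)).

Definition cintegral (R : realType) (f : R -> R[i]) : R[i] :=
  (\int[haar R]_x complex.Re (f x)) +i* (\int[haar R]_x complex.Im (f x)).

(* The norm of L^u of the unit circle, for real u > 0. *)
Definition circle_norm (R : realType) (u : R) (f : R[i] -> R[i]) : \bar R :=
  Lnorm (haar R) u%:E (fun x => (cabs (f (expi x)))%:E).

Definition holomorphic_disc (R : realType) (h : R[i] -> R[i]) : Prop :=
  forall z, cabs z < 1 -> derivable (h : R[i]^o -> R[i]^o) z 1.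

(* The Hardy space H^u.  An element carries both the holomorphic function on
   the disc and its boundary function on the circle: the values on the circle
   are the radial limits, almost everywhere (they exist by Fatou's theorem).
   Values outside the closed disc are irrelevant. *)
Definition hardy (R : realType) (u : R) (h : R[i] -> R[i]) : Prop :=
  [/\ holomorphic_disc h,
      (ereal_sup [set circle_norm u (fun z => h (r%:C * z)%R)
                 | r in [set r : R | 0 <= r < 1]%R] < +oo)%E,
      measurable_fun setT (fun x : R => complex.Re (h (expi x))),
      measurable_fun setT (fun x : R => complex.Im (h (expi x))) &
      {ae haar R, forall x : R,
        (h (r%:C * expi x) : R[i]^o) @[r --> 1^'-] --> (h (expi x) : R[i]^o)}].

(* h(z) = lambda exp (int (zeta + z) / (zeta - z) log phi(zeta) dm(zeta)) with
   |lambda| = 1, phi > 0 and log phi integrable; phi is a function of the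
   angle. *)
Definition outer (R : realType) (h : R[i] -> R[i]) : Prop :=
  exists (lambda : R[i]) (phi : R -> R),
    [/\ cabs lambda = 1,
        forall x, 0 < phi x,
        (haar R).-integrable setT (fun x => (ln (phi x))%:E) &
        forall z, cabs z < 1 ->
          h z = lambda * cexp (cintegral (fun x =>
                  (expi x + z) / (expi x - z) * (ln (phi x))%:C))].

Definition poisson (R : realType) (a zeta : R[i]) : R :=
  (1 - cabs a ^+ 2) / cabs (1 - a^* * zeta) ^+ 2.

Definition calA (R : realType) (t : R) (K : nat) : set (R[i] -> R[i]) :=
  [set h | [/\ hardy t h, outer h &
    exists (a : 'I_K -> R[i]) (c : 'I_K -> R),
      [/\ forall nu, cabs (a nu) < 1,
          forall nu, 0 <= c nu,
          \sum_(nu < K) c nu = 1 &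
          {ae haar R, forall x : R, cabs (h (expi x)) `^ t =
             \sum_(nu < K) c nu * poisson (a nu) (expi x)}]]].

(* The norm of a linear operator from H^u to H^v. *)
Definition hardy_opnorm (R : realType) (u v : R)
    (T : (R[i] -> R[i]) -> (R[i] -> R[i])) : \bar R :=
  ereal_sup [set circle_norm v (T h)
            | h in [set h | hardy u h /\ (circle_norm u h <= 1)%E]].

Definition mul_op (R : realType) (X h : R[i] -> R[i]) : R[i] -> R[i] :=
  fun z => X z * h z.

Definition dirichlet (R : realType) (M : nat) (z : R[i]) : R[i] :=
  \sum_(k < M) z ^+ k.

Definition Xpoly (R : realType) (M N L : nat) (d : R) (z : R[i]) : R[i] :=
  (d / Num.sqrt M%:R)%:C * z ^+ L * dirichlet M (z ^+ N).

(* Main.v *)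
Require Import Defs.
From HB Require Import structures.
From mathcomp Require Import all_boot all_order all_algebra.
From mathcomp Require Import complex.
From mathcomp Require Import all_classical all_reals all_analysis.
From mathcomp Require Import measurable_realfun ring lra.

Set Implicit Arguments.
Unset Strict Implicit.
Unset Printing Implicit Defensive.

Import Order.TTheory GRing.Theory Num.Theory.
Import numFieldNormedType.Exports.

Local Open Scope classical_set_scope.
Local Open Scope ring_scope.

(** The upper bounds rest on Hoelder's inequality with [1/2 = 1/p + 1/t]. It
    gives [||X h||_2 <= ||X||_p ||h||_t], and [||X||_p^p <= (d sqrt M)^(p-2) d^2]
    because [|X| <= d sqrt M] and [||X||_2 = d]; the right-hand side is
    [(d M^(1/t))^p]. The norm of the multiplication operator is exactly
    [||X||_p] because the case of equality in Hoelder can be approached: there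
    is an outer [h] with [|h|^t] proportional to a truncation of [|X|^p]
    ([exists_almost_extremal]).

    For [h] in the class with [K] poles only the mixture
    [u = |h|^t = sum c_nu P_(a_nu)] matters: [||X h||_2^2] is the energy, the
    mean of [|X|^2 u^(2/t)]. On the circle [|D_M|^2] is the real part of a
    polynomial [F], so by the mean value property the mean of
    [|D_M(zeta^N)|^2 P_a(zeta)] equals [Re F(a^N)]. It is [O(M)] when
    [|a|^N <= 1/2], which holds when [a] is at distance at least [1/N] from the
    circle.
    Poles closer to the circle are moved to distance [1/N]
    ([poisson_retract]): the new kernel dominates the old one up to a
    constant, except where it is of size [N], and that set is small in the sense that
    [1] is bounded there by [4/N] times the sum of the new kernels. That is
    where the factor [K/N] comes from ([energy_le_poles]).

    For the lower bound, [h = 1] gives [d]. The other term comes from placing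
    [min K N] poles at [r omega^k] with [omega] a primitive [N]-th root of unity
    and [1 - r^N] of order [1/M], where [Re F] is of order [M^2]
    ([exists_energy_ge]). With [K = N] this also bounds [||X||_p] below.

    Membership in the class requires an actual outer function with the given
    boundary modulus, having radial limits. It is the exponential of the
    Herglotz integral of the logarithm [g] of the modulus. As [g] is Lipschitz,
    subtracting [g(w)] makes the Herglotz kernel at a boundary point [w]
    integrable, and the radial limit exists at every [w] with an explicit rate
    ([outer_log_radial]); its real part is [g(w)] since the kernel is imaginary
    for two points of the circle. *)

Local Notation "x %:C" := (real_complex _ x) (format "x %:C") : ring_scope.

(** * Modulus and the unit circle *)

Section Modulus.
Context {R : realType}.
Implicit Types (z w : R[i]) (x y : R).

Lemma normE z : `|z| = (cabs z)%:C.
Proof. by rewrite normc_def; case: z. Qed.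

Lemma cabs_ge0 z : 0 <= cabs z.
Proof. by rewrite -lecR -normE normr_ge0. Qed.

Lemma cabsM z w : cabs (z * w) = cabs z * cabs w.
Proof. exact: ComplexField.Normc.normcM. Qed.

Lemma cabsV z : cabs z^-1 = (cabs z)^-1.
Proof. exact: ComplexField.Normc.normcV. Qed.

Lemma cabs_div z w : cabs (z / w) = cabs z / cabs w.
Proof. by rewrite cabsM cabsV. Qed.

Lemma cabsN z : cabs (- z) = cabs z.
Proof. by apply: complexI; rewrite -!normE normrN. Qed.

Lemma cabsD z w : cabs (z + w) <= cabs z + cabs w.
Proof. by rewrite -lecR rmorphD /= -!normE ler_normD. Qed.

Lemma cabsB z w : cabs (z - w) <= cabs z + cabs w.
Proof. by rewrite -(cabsN w) cabsD. Qed.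

Lemma cabsBC z w : cabs (z - w) = cabs (w - z).
Proof. by rewrite -cabsN opprB. Qed.

Lemma cabs_dist z w : `|cabs z - cabs w| <= cabs (z - w).
Proof.
have := cabsD (z - w) w; have := cabsD (w - z) z.
rewrite !subrK (cabsBC w z) => h1 h2.
by rewrite ler_norml; apply/andP; split; lra.
Qed.

Lemma cabs0 : cabs (0 : R[i]) = 0.
Proof. exact: ComplexField.Normc.normc0. Qed.

Lemma cabs1 : cabs (1 : R[i]) = 1.
Proof. exact: ComplexField.Normc.normc1. Qed.

Lemma cabs_eq0 z : (cabs z == 0) = (z == 0).
Proof.
apply/eqP/eqP => [/ComplexField.Normc.eq0_normc //|->]; exact: cabs0.
Qed.

Lemma cabs_gt0 z : (0 < cabs z) = (z != 0).
Proof. by rewrite lt_def cabs_ge0 andbT cabs_eq0. Qed.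

Lemma cabsX z n : cabs (z ^+ n) = cabs z ^+ n.
Proof. by elim: n => [|n IH]; rewrite ?expr0 ?cabs1 // !exprS cabsM IH. Qed.

Lemma cabsC x : cabs x%:C = `|x|.
Proof. by rewrite /cabs /= expr0n addr0 sqrtr_sqr. Qed.

Lemma cabsJ z : cabs z^* = cabs z.
Proof. by case: z => a b; rewrite /cabs /= sqrrN. Qed.

Lemma sqr_cabs z : cabs z ^+ 2 = complex.Re z ^+ 2 + complex.Im z ^+ 2.
Proof. by case: z => a b; rewrite /cabs /= sqr_sqrtr // addr_ge0 ?sqr_ge0. Qed.

Lemma mulcJ z : z * z^* = (cabs z ^+ 2)%:C.
Proof.
rewrite sqr_cabs; case: z => a b; apply/eqP; rewrite eq_complex /=.
by apply/andP; split; apply/eqP; ring.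
Qed.

Lemma cabs_sum (I : Type) (r : seq I) (P : pred I) (F : I -> R[i]) :
  cabs (\sum_(i <- r | P i) F i) <= \sum_(i <- r | P i) cabs (F i).
Proof.
elim/big_ind2: _ => [|a u b v Ha Hb|//]; first by rewrite cabs0.
by apply: le_trans (cabsD _ _) (lerD Ha Hb).
Qed.

Lemma ReD z w : complex.Re (z + w) = complex.Re z + complex.Re w.
Proof. by case: z w => [a b] [c d]. Qed.

Lemma ImD z w : complex.Im (z + w) = complex.Im z + complex.Im w.
Proof. by case: z w => [a b] [c d]. Qed.

Lemma ReN z : complex.Re (- z) = - complex.Re z.
Proof. by case: z. Qed.

Lemma ImN z : complex.Im (- z) = - complex.Im z.
Proof. by case: z. Qed.

Lemma ReM z w : complex.Re (z * w) =
  complex.Re z * complex.Re w - complex.Im z * complex.Im w.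
Proof. by case: z w => [a b] [c d]. Qed.

Lemma ImM z w : complex.Im (z * w) =
  complex.Re z * complex.Im w + complex.Im z * complex.Re w.
Proof. by case: z w => [a b] [c d]. Qed.

Lemma ReJ z : complex.Re z^* = complex.Re z.
Proof. by case: z. Qed.

Lemma ImJ z : complex.Im z^* = - complex.Im z.
Proof. by case: z. Qed.

Lemma ReMC z x : complex.Re (z * x%:C) = complex.Re z * x.
Proof. by rewrite ReM /= mulr0 subr0. Qed.

Lemma ImMC z x : complex.Im (z * x%:C) = complex.Im z * x.
Proof. by rewrite ImM /= mulr0 add0r. Qed.

Lemma Re_sum (I : Type) (r : seq I) (P : pred I) (F : I -> R[i]) :
  complex.Re (\sum_(i <- r | P i) F i) = \sum_(i <- r | P i) complex.Re (F i).
Proof. by apply: (big_morph _ ReD). Qed.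

Lemma complex_eq z w :
  complex.Re z = complex.Re w -> complex.Im z = complex.Im w -> z = w.
Proof. by case: z w => [a b] [c d] /= -> ->. Qed.

Lemma ReV z : complex.Re z^-1 = complex.Re z / cabs z ^+ 2.
Proof. by rewrite sqr_cabs; case: z. Qed.

Lemma ImV z : complex.Im z^-1 = - (complex.Im z / cabs z ^+ 2).
Proof. by rewrite sqr_cabs; case: z. Qed.

Lemma Re_le_cabs z : `|complex.Re z| <= cabs z.
Proof.
rewrite -(@ler_pXn2r _ 2) ?nnegrE ?cabs_ge0 ?normr_ge0 // sqr_cabs real_normK ?num_real //.
by rewrite lerDl sqr_ge0.
Qed.

Lemma Im_le_cabs z : `|complex.Im z| <= cabs z.
Proof.
rewrite -(@ler_pXn2r _ 2) ?nnegrE ?cabs_ge0 ?normr_ge0 // sqr_cabs real_normK ?num_real //.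
by rewrite lerDr sqr_ge0.
Qed.

Lemma cabs_le_ReIm z : cabs z <= `|complex.Re z| + `|complex.Im z|.
Proof.
rewrite -(@ler_pXn2r _ 2) ?nnegrE ?cabs_ge0 ?addr_ge0 ?normr_ge0 // sqr_cabs.
have h : 0 <= `|complex.Re z| * `|complex.Im z| by rewrite mulr_ge0.
by rewrite sqrrD !real_normK ?num_real //; lra.
Qed.

Lemma cabs2 : cabs (2 : R[i]) = 2.
Proof. by rewrite -[2]/(2%:R) -(rmorph_nat (real_complex R)) cabsC ger0_norm. Qed.

Lemma cabs_expi x : cabs (expi x) = 1.
Proof. by rewrite /cabs /= cos2Dsin2 sqrtr1. Qed.

Lemma expi_neq0 x : expi x != 0.
Proof. by rewrite -cabs_gt0 cabs_expi. Qed.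

Lemma expiD x y : expi (x + y) = expi x * expi y.
Proof. by apply: complex_eq; rewrite ?ReM ?ImM /= ?cosD ?sinD //; ring. Qed.

Lemma expi0 : expi (0 : R) = 1.
Proof. by rewrite /expi cos0 sin0. Qed.

Lemma expiX x n : expi x ^+ n = expi (x *+ n).
Proof.
by elim: n => [|n IH]; rewrite ?mulr0n ?expi0 ?expr0 // exprS IH mulrS expiD.
Qed.

Lemma expiJ x : (expi x)^* = (expi x)^-1.
Proof.
apply: (mulfI (expi_neq0 x)); rewrite divff ?expi_neq0 // mulcJ cabs_expi.
by rewrite expr1n.
Qed.

Lemma cabs_unit_conj z : cabs z = 1 -> z^* = z^-1.
Proof.
move=> z1; have z0 : z != 0 by rewrite -cabs_gt0 z1.
by apply: (mulfI z0); rewrite divff // mulcJ z1 expr1n.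
Qed.

Lemma cabs_cexp z : cabs (cexp z) = expR (complex.Re z).
Proof. by rewrite /cexp cabsM cabs_expi mulr1 cabsC ger0_norm // expR_ge0. Qed.

Lemma cexpD z w : cexp (z + w) = cexp z * cexp w.
Proof. by rewrite /cexp ReD ImD expRD expiD rmorphM mulrACA. Qed.

End Modulus.

(** * Means of bounded measurable functions on the circle *)

Local Notation mean f := (\int[haar _]_x f x).

(** A class closed under the operations used below, on which integrability is
    automatic; only boundary values of general Hardy functions fall outside it. *)
Definition bmeas (R : realType) (f : R -> R) :=
  measurable_fun setT f /\ exists B, forall x, `|f x| <= B.

Section Mean.
Context {R : realType}.
Implicit Types (f g : R -> R).

Lemma haarT : haar R setT = 1%E.
Proof. exact: probability_setT. Qed.

Lemma bmeas_cst (c : R) : bmeas (fun _ => c).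
Proof. by split; [exact: measurable_cst|exists `|c|]. Qed.

Lemma bmeasD f g : bmeas f -> bmeas g -> bmeas (fun x => f x + g x).
Proof.
move=> [mf [A Af]] [mg [B Bg]]; split; first exact: measurable_funD.
by exists (A + B) => x; rewrite (le_trans (ler_normD _ _)) ?lerD.
Qed.

Lemma bmeasN f : bmeas f -> bmeas (fun x => - f x).
Proof.
move=> [mf [A Af]]; split; first exact: measurable_funN.
by exists A => x; rewrite normrN.
Qed.

Lemma bmeasB f g : bmeas f -> bmeas g -> bmeas (fun x => f x - g x).
Proof. by move=> hf hg; apply: bmeasD hf (bmeasN hg). Qed.

Lemma bmeasM f g : bmeas f -> bmeas g -> bmeas (fun x => f x * g x).
Proof.
move=> [mf [A Af]] [mg [B Bg]]; split; first exact: measurable_funM.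
by exists (A * B) => x; rewrite normrM ler_pM.
Qed.

Lemma bmeasZ (c : R) f : bmeas f -> bmeas (fun x => c * f x).
Proof. by apply: bmeasM; exact: bmeas_cst. Qed.

Lemma bmeasX f n : bmeas f -> bmeas (fun x => f x ^+ n).
Proof.
move=> hf; elim: n => [|n IH]; first by under eq_fun do rewrite expr0; exact: bmeas_cst.
by under eq_fun do rewrite exprS; apply: bmeasM.
Qed.

Lemma bmeas_sum (I : Type) (r : seq I) (F : I -> R -> R) :
  (forall i, bmeas (F i)) -> bmeas (fun x => \sum_(i <- r) F i x).
Proof.
move=> hF; elim: r => [|i r IH].
  by under eq_fun do rewrite big_nil; exact: bmeas_cst.
by under eq_fun do rewrite big_cons; apply: bmeasD.
Qed.

Lemma bmeas_powR f (s : R) : bmeas f -> 0 <= s ->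
  bmeas (fun x => (f x) `^ s).
Proof.
move=> [mf [B hB]] s0; split.
  exact: (measurableT_comp (measurable_powR s)).
have B0 : 0 <= B by apply: le_trans (hB 0).
exists (B `^ s + 1) => x; rewrite ger0_norm ?powR_ge0 //.
have [f0|f0] := leP 0 (f x).
  rewrite (@le_trans _ _ (B `^ s)) ?lerDl // ge0_ler_powR ?nnegrE //.
  by rewrite (le_trans _ (hB x)) // ler_norm.
have [-> | sn0] := eqVneq s 0; first by rewrite powRr0 lerDr powR_ge0.
rewrite /powR lt_eqF // ln0 ?(ltW f0) // mulr0 expR0.
by rewrite lerDr; case: ifP => // _; rewrite ?ler01 // expR_ge0.
Qed.

Lemma continuous_bmeas f B : continuous f -> (forall x, `|f x| <= B) -> bmeas f.
Proof. by move=> cf hB; split; [exact: continuous_measurable_fun|exists B]. Qed.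

Lemma bmeas_integrable f : bmeas f -> (haar R).-integrable setT (EFin \o f).
Proof.
move=> [mf [B hB]]; apply: measurable_bounded_integrable => //.
  by rewrite [X in (X < _)%E](_ : _ = 1%E) ?ltry; last exact: haarT.
exists B; split; first exact: num_real.
by move=> M BM x _ /=; exact: le_trans (hB x) (ltW BM).
Qed.

Lemma meanD f g : bmeas f -> bmeas g ->
  mean (fun x => f x + g x) = mean f + mean g.
Proof. by move=> hf hg; apply: RintegralD => //; exact: bmeas_integrable. Qed.

Lemma meanB f g : bmeas f -> bmeas g ->
  mean (fun x => f x - g x) = mean f - mean g.
Proof. by move=> hf hg; apply: RintegralB => //; exact: bmeas_integrable. Qed.

Lemma meanZ (c : R) f : bmeas f -> mean (fun x => c * f x) = c * mean f.
Proof. by move=> hf; apply: RintegralZl => //; exact: bmeas_integrable. Qed.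

Lemma mean_cst (c : R) : mean (fun _ => c) = c.
Proof.
rewrite Rintegral_cst // [X in fine X](_ : _ = 1%E) /= ?mulr1 //; exact: haarT.
Qed.

Lemma meanN f : bmeas f -> mean (fun x => - f x) = - mean f.
Proof.
by move=> hf; rewrite -mulN1r -meanZ //; apply: eq_Rintegral => x _; rewrite mulN1r.
Qed.

Lemma eq_mean f g : f =1 g -> mean f = mean g.
Proof. by move=> fg; apply: eq_Rintegral => x _; exact: fg. Qed.

Lemma le_mean f g : bmeas f -> bmeas g -> (forall x, f x <= g x) ->
  mean f <= mean g.
Proof. by move=> hf hg fg; apply: le_Rintegral => //; exact: bmeas_integrable. Qed.

Lemma mean_ge0 f : (forall x, 0 <= f x) -> 0 <= mean f.
Proof. by move=> f0; apply: Rintegral_ge0. Qed.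

Lemma le_mean_cst f c : bmeas f -> (forall x, f x <= c) -> mean f <= c.
Proof. by move=> hf fc; rewrite -[leRHS]mean_cst le_mean //; exact: bmeas_cst. Qed.

Lemma mean_sum (I : Type) (r : seq I) (F : I -> R -> R) :
  (forall i, bmeas (F i)) ->
  mean (fun x => \sum_(i <- r) F i x) = \sum_(i <- r) mean (F i).
Proof.
move=> hF; elim: r => [|i r IH].
  by rewrite big_nil -[RHS]mean_cst; apply: eq_mean => x; rewrite big_nil.
rewrite big_cons -IH -meanD //; last exact: bmeas_sum.
by apply: eq_mean => x; rewrite big_cons.
Qed.

Lemma integral_mean f : bmeas f ->
  (\int[haar R]_x (f x)%:E = (mean f)%:E)%E.
Proof.
by move=> hf; rewrite fineK //; apply: integrable_fin_num => //; exact: bmeas_integrable.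
Qed.

End Mean.

Definition cbmeas (R : realType) (f : R -> R[i]) :=
  bmeas (fun x => complex.Re (f x)) /\ bmeas (fun x => complex.Im (f x)).

Section ComplexMean.
Context {R : realType}.
Implicit Types (f g : R -> R[i]).

Lemma cbmeas_cst (c : R[i]) : cbmeas (fun _ => c).
Proof. by split; exact: bmeas_cst. Qed.

Lemma cbmeas_real (f : R -> R) : bmeas f -> cbmeas (fun x => (f x)%:C).
Proof. by move=> hf; split => //=; exact: bmeas_cst. Qed.

Lemma cbmeasD f g : cbmeas f -> cbmeas g -> cbmeas (fun x => f x + g x).
Proof.
move=> [f1 f2] [g1 g2]; split.
  by under eq_fun do rewrite ReD; exact: bmeasD.
by under eq_fun do rewrite ImD; exact: bmeasD.
Qed.

Lemma cbmeasM f g : cbmeas f -> cbmeas g -> cbmeas (fun x => f x * g x).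
Proof.
move=> [f1 f2] [g1 g2]; split.
  by under eq_fun do rewrite ReM; apply: bmeasB; apply: bmeasM.
by under eq_fun do rewrite ImM; apply: bmeasD; apply: bmeasM.
Qed.

Lemma cbmeasN f : cbmeas f -> cbmeas (fun x => - f x).
Proof.
move=> [f1 f2]; split.
  by under eq_fun do rewrite ReN; exact: bmeasN.
by under eq_fun do rewrite ImN; exact: bmeasN.
Qed.

Lemma cbmeasB f g : cbmeas f -> cbmeas g -> cbmeas (fun x => f x - g x).
Proof. by move=> hf hg; apply: cbmeasD hf (cbmeasN hg). Qed.

Lemma cbmeasZ c f : cbmeas f -> cbmeas (fun x => c * f x).
Proof. by apply: cbmeasM; exact: cbmeas_cst. Qed.

Lemma cbmeasX f n : cbmeas f -> cbmeas (fun x => f x ^+ n).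
Proof.
move=> hf; elim: n => [|n IH]; first by under eq_fun do rewrite expr0; exact: cbmeas_cst.
by under eq_fun do rewrite exprS; apply: cbmeasM.
Qed.

Lemma cbmeas_sum (I : Type) (r : seq I) (F : I -> R -> R[i]) :
  (forall i, cbmeas (F i)) -> cbmeas (fun x => \sum_(i <- r) F i x).
Proof.
move=> hF; elim: r => [|i r IH].
  by under eq_fun do rewrite big_nil; exact: cbmeas_cst.
by under eq_fun do rewrite big_cons; apply: cbmeasD.
Qed.

Lemma cbmeas_expi : cbmeas (@expi R).
Proof.
split; apply: (@continuous_bmeas _ _ 1) => x.
- exact: continuous_cos.
- by rewrite (le_trans (Re_le_cabs _)) // cabs_expi.
- exact: continuous_sin.
- by rewrite (le_trans (Im_le_cabs _)) // cabs_expi.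
Qed.

Lemma measurable_cabs f :
  measurable_fun setT (fun x => complex.Re (f x)) ->
  measurable_fun setT (fun x => complex.Im (f x)) ->
  measurable_fun setT (fun x => cabs (f x)).
Proof.
move=> m1 m2.
have -> : (fun x => cabs (f x)) =
   (fun x => (complex.Re (f x) ^+ 2 + complex.Im (f x) ^+ 2) `^ 2^-1).
  apply: funext => x; rewrite -sqr_cabs -powR_mulrn ?cabs_ge0 // -powRrM.
  by rewrite mulfV ?powRr1 ?cabs_ge0 // pnatr_eq0.
apply: (measurableT_comp (measurable_powR _)).
by apply: measurable_funD; apply: measurable_funX.
Qed.

Lemma cbmeas_cabs f : cbmeas f -> bmeas (fun x => cabs (f x)).
Proof.
move=> [[m1 [A hA]] [m2 [B hB]]]; split; first exact: measurable_cabs.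
exists (A + B) => x; rewrite ger0_norm ?cabs_ge0 //.
by apply: le_trans (cabs_le_ReIm _) (lerD (hA x) (hB x)).
Qed.

Lemma measurable_cinv f : cbmeas f ->
  measurable_fun setT (fun x => complex.Re (f x)^-1) /\
  measurable_fun setT (fun x => complex.Im (f x)^-1).
Proof.
move=> hf; have [[m1 _] [m2 _]] := hf.
have mi : measurable_fun setT (fun x => (cabs (f x) ^+ 2)^-1).
  have -> : (fun x => (cabs (f x) ^+ 2)^-1) = (fun x => (cabs (f x) ^+ 2) `^ (-1)).
    by apply: funext => x; rewrite powR_inv1 // exprn_ge0 // cabs_ge0.
  apply: (measurableT_comp (measurable_powR _)); apply: measurable_funX.
  exact: (cbmeas_cabs hf).1.
split.
  by under eq_fun do rewrite ReV; apply: measurable_funM.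
under eq_fun do rewrite ImV; apply: measurable_funN; exact: measurable_funM.
Qed.

Lemma cbmeas_bound f B :
  measurable_fun setT (fun x => complex.Re (f x)) ->
  measurable_fun setT (fun x => complex.Im (f x)) ->
  (forall x, cabs (f x) <= B) -> cbmeas f.
Proof.
move=> m1 m2 hB; split; split => //; exists B => x.
  exact: le_trans (Re_le_cabs _) (hB x).
exact: le_trans (Im_le_cabs _) (hB x).
Qed.

Lemma cbmeas_div f g B : cbmeas f -> cbmeas g ->
  (forall x, cabs (f x / g x) <= B) -> cbmeas (fun x => f x / g x).
Proof.
move=> [[f1 _] [f2 _]] hg; have [g1 g2] := measurable_cinv hg.
apply: cbmeas_bound.
  by under eq_fun do rewrite ReM; apply: measurable_funB; apply: measurable_funM.
by under eq_fun do rewrite ImM; apply: measurable_funD; apply: measurable_funM.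
Qed.

Lemma cintD f g : cbmeas f -> cbmeas g ->
  cintegral (fun x => f x + g x) = cintegral f + cintegral g.
Proof.
move=> [f1 f2] [g1 g2]; apply: complex_eq; rewrite ?ReD ?ImD /cintegral /= -meanD //.
  by apply: eq_mean => x; rewrite ReD.
by apply: eq_mean => x; rewrite ImD.
Qed.

Lemma cintZ c f : cbmeas f -> cintegral (fun x => c * f x) = c * cintegral f.
Proof.
move=> [f1 f2]; apply: complex_eq; rewrite ?ReM ?ImM /cintegral /= -!meanZ //.
  rewrite -meanB; [|exact: bmeasZ|exact: bmeasZ].
  by apply: eq_mean => x; rewrite ReM.
rewrite -meanD; [|exact: bmeasZ|exact: bmeasZ].
by apply: eq_mean => x; rewrite ImM.
Qed.

Lemma cintB f g : cbmeas f -> cbmeas g ->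
  cintegral (fun x => f x - g x) = cintegral f - cintegral g.
Proof.
move=> hf hg; rewrite -mulN1r -cintZ // -cintD //; last exact: cbmeasZ.
by congr cintegral; apply: funext => x; rewrite mulN1r.
Qed.

Lemma cintJ f : cbmeas f -> cintegral (fun x => (f x)^*) = (cintegral f)^*.
Proof.
move=> [f1 f2]; apply: complex_eq; rewrite ?ReJ ?ImJ /cintegral /=.
  by apply: eq_mean => x; rewrite ReJ.
by rewrite -meanN //; apply: eq_mean => x; rewrite ImJ.
Qed.

Lemma cint_cst (c : R[i]) : cintegral (fun _ => c) = c.
Proof. by apply: complex_eq; rewrite /cintegral /= mean_cst. Qed.

(** Multiplying by a unimodular constant makes the integral nonnegative; then
    only the real part of the integrand matters. *)
Lemma cabs_cint_le f : cbmeas f -> cabs (cintegral f) <= mean (fun x => cabs (f x)).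
Proof.
move=> hf; set I := cintegral f.
have [->|I0] := eqVneq I 0.
  by rewrite cabs0 mean_ge0 // => x; exact: cabs_ge0.
have I1 : 0 < cabs I by rewrite cabs_gt0.
pose u := I^* / (cabs I)%:C.
have u1 : cabs u = 1.
  by rewrite cabs_div cabsJ cabsC ger0_norm ?divff ?gt_eqF ?ltW.
have -> : cabs I = complex.Re (u * I).
  rewrite /u mulrAC (mulrC I^*) mulcJ.
  rewrite -fmorphV /= mulr0 subr0 expr2 mulfK //.
  by rewrite gt_eqF.
rewrite -cintZ // /cintegral /= le_mean //.
- exact: (cbmeasZ u hf).1.
- exact: cbmeas_cabs.
move=> x; rewrite (le_trans (ler_norm _)) // (le_trans (Re_le_cabs _)) //.
by rewrite cabsM u1 mul1r.
Qed.

End ComplexMean.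

(** * The Poisson kernel and its mean value property *)

Section Kernels.
Context {R : realType}.
Implicit Types (f F : R -> R) (z a w : R[i]).

(** Nonnegativity is what lets the uniform law be replaced by Lebesgue measure;
    it is reached below by adding the constant 1. *)
Lemma mean_FTC f F B : continuous f -> (forall x, 0 <= f x <= B) ->
  (forall x : R, is_derive x (1 : R) F (f x)) ->
  mean f = (F (2 * pi) - F 0) / (2 * pi).
Proof.
move=> cf f0B dF.
have mf : measurable_fun setT f by exact: continuous_measurable_fun.
have cF : continuous F.
  move=> x; apply/differentiable_continuous/derivable1_diffP.
  by apply: ex_derive; exact: dF.
rewrite /Rintegral integral_uniform; last 2 first.
- exact/measurable_EFinP.
- by move=> x; rewrite lee_fin; case/andP: (f0B x).
rewrite (@continuous_FTC2 _ f F) ?two_pi_gt0 //.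
- by rewrite subr0 -EFinD -EFinM /= mulrC.
- exact: continuous_subspaceT.
- split.
  + by move=> x _; apply: ex_derive; exact: dF.
  + exact/cvg_at_right_filter/cF.
  + exact/cvg_at_left_filter/cF.
- by move=> x _; rewrite derive1E; exact: derive_val.
Qed.

Lemma mean_cos_nat n : mean (fun x : R => cos (x *+ n.+1)) = 0.
Proof.
have bc : bmeas (fun x : R => cos (x *+ n.+1)).
  apply: (@continuous_bmeas _ _ 1) => x.
    apply: (@continuous_comp _ _ _ (fun x : R => x *+ n.+1) cos); last exact: continuous_cos.
    exact: natmul_continuous.
  by rewrite ler_norml cos_geN1 cos_le1.
suff : mean (fun x : R => 1 + cos (x *+ n.+1)) = 1.
  by rewrite meanD ?mean_cst //; [lra|exact: bmeas_cst].
have dF (x : R) : is_derive x (1 : R) (fun x => x + sin (n.+1%:R * x) / n.+1%:R)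
    (1 + cos (x *+ n.+1)).
  apply: is_derive_eq; rewrite /GRing.scale /= mulr0 mulr0 add0r mulr1 mulrCA.
  by rewrite mulVf ?mulr1 ?pnatr_eq0 // mulr_natl.
rewrite (@mean_FTC (fun x => 1 + cos (x *+ n.+1)) _ 2 _ _ dF).
- rewrite mulr0 sin0 mul0r addr0 subr0.
  have -> : sin (n.+1%:R * (2 * pi)) = 0 :> R.
    elim: n.+1 => [|k IH]; first by rewrite mul0r sin0.
    by rewrite mulrSr mulrDl mul1r [2 * pi]mulr_natl sinD2pi -[pi *+ 2]mulr_natl.
  by rewrite mul0r addr0 divff // gt_eqF // two_pi_gt0.
- move=> x; apply: cvgD; first exact: cvg_cst.
  apply: (@continuous_comp _ _ _ (fun x : R => x *+ n.+1) cos); last exact: continuous_cos.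
  exact: natmul_continuous.
- move=> x; have := cos_geN1 (x *+ n.+1); have := cos_le1 (x *+ n.+1).
  by move=> *; apply/andP; split; lra.
Qed.

Lemma mean_sin_nat n : mean (fun x : R => sin (x *+ n.+1)) = 0.
Proof.
have bc : bmeas (fun x : R => sin (x *+ n.+1)).
  apply: (@continuous_bmeas _ _ 1) => x.
    apply: (@continuous_comp _ _ _ (fun x : R => x *+ n.+1) sin); last exact: continuous_sin.
    exact: natmul_continuous.
  by rewrite ler_norml sin_geN1 sin_le1.
suff : mean (fun x : R => 1 + sin (x *+ n.+1)) = 1.
  by rewrite meanD ?mean_cst //; [lra|exact: bmeas_cst].
have dF (x : R) : is_derive x (1 : R) (fun x => x - cos (n.+1%:R * x) / n.+1%:R)
    (1 + sin (x *+ n.+1)).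
  apply: is_derive_eq; rewrite /GRing.scale /= mulr0 mulr0 add0r mulr1 mulrCA.
  by rewrite mulVf ?mulr1 ?pnatr_eq0 // mulr_natl opprK.
rewrite (@mean_FTC (fun x => 1 + sin (x *+ n.+1)) _ 2 _ _ dF).
- rewrite mulr0 cos0.
  have -> : cos (n.+1%:R * (2 * pi)) = 1 :> R.
    elim: n.+1 => [|k IH]; first by rewrite mul0r cos0.
    by rewrite mulrSr mulrDl mul1r [2 * pi]mulr_natl cosD2pi -[pi *+ 2]mulr_natl.
  by rewrite sub0r opprK subrK divff // gt_eqF // two_pi_gt0.
- move=> x; apply: cvgD; first exact: cvg_cst.
  apply: (@continuous_comp _ _ _ (fun x : R => x *+ n.+1) sin); last exact: continuous_sin.
  exact: natmul_continuous.
- move=> x; have := sin_geN1 (x *+ n.+1); have := sin_le1 (x *+ n.+1).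
  by move=> *; apply/andP; split; lra.
Qed.

Lemma cint_expiX n : cintegral (fun x : R => expi x ^+ n) = (n == 0%N)%:R.
Proof.
case: n => [|n]; first by rewrite -[RHS]cint_cst; congr cintegral; apply: funext.
apply: complex_eq; rewrite /cintegral /=.
  by rewrite -[RHS](mean_cos_nat n); apply: eq_mean => x; rewrite expiX.
by rewrite -[RHS](mean_sin_nat n); apply: eq_mean => x; rewrite expiX.
Qed.

Lemma sub1_bound w : cabs w < 1 -> 1 - cabs w <= cabs (1 - w).
Proof.
move=> w1; have := cabs_dist 1 w; rewrite cabs1; apply: le_trans; exact: ler_norm.
Qed.

Lemma sub1_neq0 w : cabs w < 1 -> 1 - w != 0.
Proof.
by move=> w1; rewrite -cabs_gt0 (lt_le_trans _ (sub1_bound w1)) // subr_gt0.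
Qed.

Lemma cabs_mul_expi z x : cabs (z * expi x) = cabs z.
Proof. by rewrite cabsM cabs_expi mulr1. Qed.

Lemma cabs_geom_le z m x : cabs z < 1 ->
  cabs (expi x ^+ m / (1 - z * expi x)) <= (1 - cabs z)^-1.
Proof.
move=> z1; rewrite cabs_div cabsX cabs_expi expr1n mul1r.
have z2 : cabs (z * expi x) < 1 by rewrite cabs_mul_expi.
rewrite lef_pV2 ?posrE ?subr_gt0 //.
  by rewrite -{1}(cabs_mul_expi z x) sub1_bound.
by rewrite cabs_gt0 sub1_neq0.
Qed.

Lemma cbmeas_geom z m : cabs z < 1 ->
  cbmeas (fun x => expi x ^+ m / (1 - z * expi x)).
Proof.
move=> z1; apply: (@cbmeas_div _ _ _ (1 - cabs z)^-1).
- exact/cbmeasX/cbmeas_expi.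
- apply: cbmeasB; first exact: cbmeas_cst.
  exact/cbmeasZ/cbmeas_expi.
- by move=> x; exact: cabs_geom_le.
Qed.

Lemma geom_vanish (q B y : R) : 0 <= q < 1 -> 0 <= y ->
  (forall k, y <= q ^+ k * B) -> y = 0.
Proof.
move=> /andP[q0 q1] y0 h.
have c1 : (fun k => q ^+ k * B : R) @ \oo --> (0 * B : R).
  by apply: cvgM; [apply: cvg_expr; rewrite ger0_norm|exact: cvg_cst].
apply/eqP; rewrite eq_le y0 andbT -(mul0r B) -(cvg_lim _ c1) //.
by apply: limr_ge; [apply/cvg_ex; exists (0 * B)|exact: nearW].
Qed.

(** The means [A m] satisfy [A m = (m == 0) + z * A m.+1] and are bounded, so
    iterating the recursion kills [A m] for [m > 0]. *)
Lemma cint_geom z m : cabs z < 1 ->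
  cintegral (fun x => expi x ^+ m / (1 - z * expi x)) = (m == 0%N)%:R.
Proof.
move=> z1; pose A m := cintegral (fun x => expi x ^+ m / (1 - z * expi x)).
have rec k : A k = (k == 0%N)%:R + z * A k.+1.
  rewrite -cint_expiX /A -cintZ; last exact: cbmeas_geom.
  rewrite -cintD; last 2 first.
  - exact/cbmeasX/cbmeas_expi.
  - exact/cbmeasZ/cbmeas_geom.
  congr cintegral; apply: funext => x; rewrite exprS.
  have z2 : 1 - z * expi x != 0 by rewrite sub1_neq0 // cabs_mul_expi.
  by field.
have bd k : cabs (A k) <= (1 - cabs z)^-1.
  apply: le_trans (cabs_cint_le (cbmeas_geom k z1)) _.
  apply: le_mean_cst => [|x]; last exact: cabs_geom_le.
  exact/cbmeas_cabs/cbmeas_geom.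
have A0 k : A k.+1 = 0.
  have iterA j : A k.+1 = z ^+ j * A (k.+1 + j)%N.
    elim: j => [|j ->]; first by rewrite expr0 mul1r addn0.
    by rewrite rec addSn /= add0r exprSr mulrA addnS.
  apply/eqP; rewrite -cabs_eq0; apply/eqP.
  apply: (@geom_vanish (cabs z) (1 - cabs z)^-1); rewrite ?cabs_ge0 //.
  move=> j; rewrite (iterA j) cabsM cabsX ler_wpM2l //.
  by rewrite exprn_ge0 // cabs_ge0.
by rewrite -/(A m) rec A0 mulr0 addr0.
Qed.

(** The form of the Poisson kernel in which sums over poles become sums of
    geometric series. *)
Lemma poissonE a w : cabs w = 1 -> cabs a < 1 ->
  poisson a w = 2 * complex.Re (1 - a^* * w)^-1 - 1.
Proof.
move=> w1 a1; rewrite /poisson ReV.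
set v := a^* * w; have va : cabs v = cabs a by rewrite cabsM cabsJ w1 mulr1.
rewrite -va in a1 *.
have nz : cabs (1 - v) ^+ 2 != 0 by rewrite sqrf_eq0 cabs_eq0 sub1_neq0.
have e : cabs v ^+ 2 = cabs (1 - v) ^+ 2 - 1 + 2 * complex.Re v.
  by rewrite !sqr_cabs ReD ReN ImD ImN /=; ring.
have -> : complex.Re (1 - v) = 1 - complex.Re v by rewrite ReD ReN.
by rewrite e; move: nz; set S := cabs (1 - v) ^+ 2 => nz; field.
Qed.

Lemma bmeas_poisson a : cabs a < 1 -> bmeas (fun x => poisson a (expi x)).
Proof.
move=> a1; have a2 : cabs a^* < 1 by rewrite cabsJ.
under eq_fun do rewrite poissonE ?cabs_expi //.
apply: bmeasB; last exact: bmeas_cst; apply: bmeasZ.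
have := (cbmeas_geom 0 a2).1.
by under eq_fun do rewrite expr0 mul1r.
Qed.

Lemma poisson_gt0 a w : cabs w = 1 -> cabs a < 1 -> 0 < poisson a w.
Proof.
move=> w1 a1; rewrite divr_gt0 //.
  by rewrite subr_gt0 expr_lt1 // cabs_ge0.
by rewrite exprn_gt0 // cabs_gt0 sub1_neq0 // cabsM cabsJ w1 mulr1.
Qed.

Lemma mean_poisson a : cabs a < 1 -> mean (fun x => poisson a (expi x)) = 1.
Proof.
move=> a1; have a2 : cabs a^* < 1 by rewrite cabsJ.
have h := cbmeas_geom 0 a2.
have e : cintegral (fun x => expi x ^+ 0 / (1 - a^* * expi x)) = 1 by rewrite cint_geom.
have {}e : mean (fun x => complex.Re (expi x ^+ 0 / (1 - a^* * expi x))) = 1.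
  by have := congr1 (@complex.Re R) e.
transitivity (mean (fun x => 2 * complex.Re (expi x ^+ 0 / (1 - a^* * expi x)) - 1)).
  by apply: eq_mean => x; rewrite expr0 mul1r poissonE // cabs_expi.
rewrite meanB; [|apply: bmeasZ; exact: h.1|exact: bmeas_cst].
rewrite meanZ; last exact: h.1.
by rewrite e mean_cst mulr1; lra.
Qed.

(** Since [(zeta - a) P_a(zeta) = (1 - |a|^2) zeta / (1 - a^* zeta)] on the
    circle, consecutive moments of [P_a] differ by the factor [a], by
    [cint_geom]. *)
Lemma cint_expiX_poisson a m : cabs a < 1 ->
  cintegral (fun x => expi x ^+ m * (poisson a (expi x))%:C) = a ^+ m.
Proof.
move=> a1; have a2 : cabs a^* < 1 by rewrite cabsJ.
have hb k : cbmeas (fun x => expi x ^+ k * (poisson a (expi x))%:C).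
  by apply: cbmeasM; [exact/cbmeasX/cbmeas_expi|exact/cbmeas_real/bmeas_poisson].
elim: m => [|m IH].
  rewrite expr0; apply: complex_eq; rewrite /cintegral /=.
    by rewrite -[RHS](mean_poisson a1); apply: eq_mean => x; rewrite ?expr0 ?mul1r ?ReMC /= ?mul1r ?mul0r ?subr0.
  by rewrite -[RHS](mean_cst 0); apply: eq_mean => x; rewrite ?ImMC ?ImM /= ?mul1r ?mul0r ?mulr0 ?addr0.
apply/eqP; rewrite exprS -IH -cintZ // -subr_eq0 -cintB //; last exact: cbmeasZ.
apply/eqP; transitivity ((1 - cabs a ^+ 2)%:C *
   cintegral (fun x => expi x ^+ m.+1 / (1 - a^* * expi x))); last first.
  by rewrite cint_geom // mulr0.
rewrite -cintZ; last exact: cbmeas_geom.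
congr cintegral; apply: funext => x.
have n1 : 1 - a^* * expi x != 0 by rewrite sub1_neq0 // cabs_mul_expi.
have n2 : 1 - a / expi x != 0.
  by rewrite sub1_neq0 // cabs_div cabs_expi divr1.
have -> : (poisson a (expi x))%:C =
    (1 - cabs a ^+ 2)%:C / ((1 - a^* * expi x) * (1 - a / expi x)).
  rewrite /poisson rmorphM fmorphV /=; congr (_ / _).
  rewrite -mulcJ; congr (_ * _). by rewrite rmorphB rmorph1 rmorphM /= conjCK expiJ.
have n3 : expi x - a != 0.
  have -> : expi x - a = expi x * (1 - a / expi x).
    by rewrite mulrBr mulr1 mulrCA mulfV ?mulr1 ?expi_neq0.
  by rewrite mulf_neq0 ?expi_neq0.
by rewrite exprS; field; rewrite ?n1 ?expi_neq0 ?n2 ?n3.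
Qed.

Lemma poisson0 (w : R[i]) : poisson 0 w = 1.
Proof. by rewrite /poisson cabs0 expr0n /= conjC0 mul0r !subr0 cabs1 expr1n divr1. Qed.

End Kernels.

(** * Complex derivatives and radial limits *)

Section Topology.
Context {R : realType}.
Implicit Types (z w : R[i]) (f h : R[i] -> R[i]).

Lemma cvg_cabsP {T : Type} {F : set_system T} {FF : Filter F} (f : T -> R[i]) (l : R[i]) :
  (f x : R[i]^o) @[x --> F] --> (l : R[i]^o) <->
  forall e : R, 0 < e -> \forall x \near F, cabs (l - f x) < e.
Proof.
split => [/cvgrPdist_lt H e e0|H].
  have e0' : 0 < e%:C :> R[i] by rewrite ltcR.
  by have := H _ e0'; apply: filterS => x; rewrite normE ltcR.
apply/cvgrPdist_lt => e; rewrite ltcE /= => /andP[/eqP e1 e2].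
have -> : e = (complex.Re e)%:C by apply: complex_eq.
by have := H _ e2; apply: filterS => x; rewrite normE ltcR.
Qed.

Lemma near0P (P : set R[i]) (d : R) : 0 < d ->
  (forall z, z != 0 -> cabs z < d -> P z) -> \forall z \near (0 : R[i]^o)^', P z.
Proof.
move=> d0 H; rewrite /dnbhs /= /within /=.
have d0' : 0 < d%:C :> R[i] by rewrite ltcR.
apply/nbhs_ballP; exists (d%:C) => //= z; rewrite -ball_normE /= sub0r normrN normE ltcR.
by move=> zd z0; apply: H.
Qed.

Lemma near0E (P : set R[i]) : (\forall z \near (0 : R[i]^o)^', P z) ->
  exists2 d : R, 0 < d & forall z, z != 0 -> cabs z < d -> P z.
Proof.
rewrite /dnbhs /= /within /= => /nbhs_ballP [e /=].
rewrite ltcE /= => /andP[/eqP e1 e2] H; exists (complex.Re e) => // z z0 ze.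
apply: H => //; rewrite -ball_normE /= sub0r normrN normE.
by rewrite ltcE /= e1 eqxx.
Qed.

(** Complex differentiability with its little-o spelled out in terms of real
    numbers. *)
Definition cderiv f z (D : R[i]) := forall e : R, 0 < e ->
  exists2 d : R, 0 < d & forall k, cabs k < d ->
    cabs (f (z + k) - f z - k * D) <= e * cabs k.

Lemma cderiv_derivable f z D : cderiv f z D ->
  derivable (f : R[i]^o -> R[i]^o) z 1.
Proof.
move=> H; apply/cvg_ex; exists D; apply/cvg_cabsP => e e0.
have [d d0 Hd] := H (e / 2) (divr_gt0 e0 (ltr0Sn _ 1)).
apply: (near0P d0) => k k0 kd.
have := Hd _ kd; rewrite /= /GRing.scale /= mulr1 (addrC k z).
have kn : 0 < cabs k by rewrite cabs_gt0.
have -> : D - k^-1 * (f (z + k) - f z) = - ((f (z + k) - f z - k * D) / k) by field.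
rewrite cabsN cabs_div => h; rewrite ltr_pdivrMr //.
by apply: le_lt_trans h _; rewrite ltr_pM2r //; lra.
Qed.

Lemma derivable_cont f z : derivable (f : R[i]^o -> R[i]^o) z 1 ->
  forall e : R, 0 < e ->
  exists2 d : R, 0 < d & forall w, cabs (w - z) < d -> cabs (f w - f z) < e.
Proof.
move=> /cvg_ex [D /cvg_cabsP H] e e0.
have [d d0 Hd] := near0E (H 1 ltr01).
pose B := 1 + cabs D; have B0 : 0 < B by rewrite /B; have := cabs_ge0 D; lra.
exists (Num.min d (e / B)); first by rewrite lt_min d0 divr_gt0.
move=> w; rewrite lt_min => /andP[wd we].
have [->|wz] := eqVneq w z; first by rewrite subrr cabs0.
have kz : w - z != 0 by rewrite subr_eq0.
have := Hd _ kz wd; rewrite /= /GRing.scale /= mulr1 subrK => h.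
have kn : 0 < cabs (w - z) by rewrite cabs_gt0.
have : cabs ((w - z)^-1 * (f w - f z)) <= B.
  have := cabs_dist D ((w - z)^-1 * (f w - f z)).
  by rewrite ler_norml => /andP[h1 _]; rewrite /B; lra.
rewrite mulrC cabs_div ler_pdivrMr // => h2; apply: le_lt_trans h2 _.
by rewrite mulrC -ltr_pdivlMr.
Qed.

Lemma real_little_o (f : R -> R) (x l : R) : is_derive x (1 : R) f l ->
  forall e : R, 0 < e -> exists2 d : R, 0 < d &
    forall k, `|k| < d -> `|f (x + k) - f x - k * l| <= e * `|k|.
Proof.
move=> [df fl] e e0.
have /cvgrPdist_lt/(_ _ e0) : h^-1 *: (f (h *: (1 : R) + x) - f x) @[h --> 0^'] --> l.
  by rewrite -fl; exact: df.
rewrite /dnbhs /within /= => /nbhs_ballP [d /= d0 H]; exists d => // k kd.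
have [->|k0] := eqVneq k 0; first by rewrite addr0 subrr mul0r subr0 normr0 mulr0.
have : `|l - k^-1 *: (f (k *: (1 : R) + x) - f x)| < e.
  by apply: (H k) => //; rewrite -ball_normE /= sub0r normrN.
rewrite /GRing.scale /= mulr1 (addrC k) => h.
have -> : f (x + k) - f x - k * l = - (l - k^-1 * (f (x + k) - f x)) * k by field.
by rewrite normrM normrN ler_wpM2r // ltW.
Qed.

(** With [k = x + iy], split [cexp k - 1 - k] as
    [e^x (e^(iy) - 1 - iy) + (e^x - 1 - x) + iy (e^x - 1)]; each term is
    controlled by a real derivative at 0. *)
Lemma cderiv_cexp0 : cderiv (@cexp R) 0 1.
Proof.
move=> e e0; have e6 : 0 < e / 8 by lra.
have [d1 d10 H1] := real_little_o (is_derive_expR (0 : R)) e6.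
have [d2 d20 H2] := real_little_o (is_derive_cos (0 : R)) e6.
have [d3 d30 H3] := real_little_o (is_derive_sin (0 : R)) e6.
have m0 : 0 < Num.min (1 + e)^-1 (Num.min (e / (8 * (1 + e))) (Num.min d1 (Num.min d2 d3))).
  by rewrite !lt_min d10 d20 d30 invr_gt0 divr_gt0 // ?mulr_gt0 ?addr_gt0.
(* the first two radii make [|e^x - 1|] at most 1 and at most [e / 8] *)
exists (Num.min (1 + e)^-1 (Num.min (e / (8 * (1 + e))) (Num.min d1 (Num.min d2 d3)))) => // k.
rewrite !lt_min => /and5P[k1 k2 kd1 kd2 kd3].
have c0 : cexp (0 : R[i]) = 1 by rewrite /cexp /= expR0 expi0 mulr1.
rewrite add0r mulr1 c0.
set x := complex.Re k; set y := complex.Im k.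
have xk : `|x| <= cabs k := Re_le_cabs k.
have yk : `|y| <= cabs k := Im_le_cabs k.
have := H1 x (le_lt_trans xk kd1); have := H2 y (le_lt_trans yk kd2).
have := H3 y (le_lt_trans yk kd3).
rewrite !add0r cos0 sin0 expR0 oppr0 mulr0 !subr0 ?addr0 !mulr1 => hs hc hx.
have -> : cexp k - 1 - k = (expR x)%:C * (expi y - 1 - 'i%C * y%:C) +
     (expR x - 1 - x)%:C + 'i%C * (y * (expR x - 1))%:C.
  by apply: complex_eq; rewrite /cexp -/x -/y !(ReD, ImD, ReN, ImN, ReM, ImM) /= -/x -/y; ring.
have hE : cabs (expi y - 1 - 'i%C * y%:C) <= e / 4 * cabs k.
  apply: le_trans (cabs_le_ReIm _) _.
  rewrite !(ReD, ImD, ReN, ImN, ReM, ImM) /= !(mul0r, mul1r, mulr0, subr0, addr0, oppr0, add0r).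
  have : e / 8 * `|y| <= e / 8 * cabs k by rewrite ler_wpM2l // ltW.
  by lra.
have e8x : e / 8 * `|x| <= e / 8 * cabs k by rewrite ler_wpM2l // ltW.
have hx1 : `|expR x - 1| <= (1 + e) * cabs k.
  have -> : expR x - 1 = (expR x - 1 - x) + x by ring.
  have ek : 0 <= e * cabs k by rewrite mulr_ge0 ?cabs_ge0 // ltW.
  by apply: le_trans (ler_normD _ _) _; lra.
have k2' : (1 + e) * cabs k <= e / 8.
  rewrite -ler_pdivlMl ?addr_gt0 // (le_trans (ltW k2)) //.
  by rewrite invfM mulrA mulrC.
have ex2 : expR x <= 1 + e / 8.
  have := ler_norm (expR x - 1); lra.
have hx3 : `|expR x - 1| <= 2.
  have ek : (1 + e) * cabs k <= 1.
    by rewrite -ler_pdivlMl ?addr_gt0 // mulr1 ltW.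
  by lra.
apply: le_trans (cabsD _ _) _; rewrite !cabsM !cabsC.
have -> : cabs ('i%C : R[i]) = 1 by rewrite /cabs /= expr0n expr1n add0r sqrtr1.
have : cabs ((expR x)%:C * (expi y - 1 - 'i%C * y%:C) + (expR x - 1 - x)%:C) <=
   expR x * (e / 4 * cabs k) + e / 8 * `|x|.
  apply: le_trans (cabsD _ _) _; apply: lerD; last by rewrite cabsC.
  by rewrite cabsM cabsC ger0_norm ?expR_ge0 // ler_wpM2l // expR_ge0.
have : `|y * (expR x - 1)| <= cabs k * (e / 8).
  by rewrite normrM ler_pM // (le_trans hx1).
have : expR x * (e / 4 * cabs k) <= 3 * (e / 4 * cabs k).
  rewrite ler_wpM2r //; first by rewrite mulr_ge0 ?cabs_ge0 //; lra.
  by have := ler_norm (expR x - 1); lra.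
by rewrite mul1r; lra.
Qed.

Lemma cderiv_cexp_comp f z D : cderiv f z D ->
  cderiv (fun z => cexp (f z)) z (cexp (f z) * D).
Proof.
move=> H e e0.
pose A := cabs (cexp (f z)) + 1; pose B := cabs D + 1.
have A0 : 0 < A by rewrite /A; have := cabs_ge0 (cexp (f z)); lra.
have B0 : 0 < B by rewrite /B; have := cabs_ge0 D; lra.
have e1 : 0 < e / (2 * A * B) by rewrite divr_gt0 // !mulr_gt0.
have e2 : 0 < Num.min 1 (e / (2 * A)) by rewrite lt_min ltr01 divr_gt0 // mulr_gt0.
have [d1 d10 H1] := cderiv_cexp0 e1.
have [d2 d20 H2] := H _ e2.
exists (Num.min d2 (d1 / B)); first by rewrite lt_min d20 divr_gt0.
move=> k; rewrite lt_min => /andP[kd2 kd1].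
have {}H2 := H2 _ kd2; set r := f (z + k) - f z in H2 *.
have k0 := cabs_ge0 k.
have m1 : Num.min 1 (e / (2 * A)) <= 1 by rewrite ge_min lexx.
have m2 : Num.min 1 (e / (2 * A)) <= e / (2 * A) by rewrite ge_min lexx orbT.
have rB : cabs r <= B * cabs k.
  have -> : r = (r - k * D) + k * D by rewrite subrK.
  apply: le_trans (cabsD _ _) _; rewrite (cabsM k D).
  apply: (@le_trans _ _ (1 * cabs k + cabs k * cabs D)); last by rewrite /B; lra.
  by rewrite lerD2r (le_trans H2) // ler_wpM2r.
have rd : cabs r < d1 by rewrite (le_lt_trans rB) // mulrC -ltr_pdivlMr.
have := H1 _ rd; rewrite add0r mulr1.
have -> : cexp (0 : R[i]) = 1 by rewrite /cexp /= expR0 expi0 mulr1.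
move=> {}H1.
have -> : cexp (f (z + k)) - cexp (f z) - k * (cexp (f z) * D) =
   cexp (f z) * ((cexp r - 1 - r) + (r - k * D)).
  have -> : f (z + k) = f z + r by rewrite /r; ring.
  by rewrite cexpD; ring.
rewrite cabsM.
have h1 : e / (2 * A * B) * cabs r <= e / (2 * A) * cabs k.
  apply: (@le_trans _ _ (e / (2 * A * B) * (B * cabs k))); first by rewrite ler_wpM2l // ltW.
  by rewrite le_eqVlt; apply/orP; left; apply/eqP; field; rewrite !gt_eqF.
have h2 : cabs ((cexp r - 1 - r) + (r - k * D)) <= e / A * cabs k.
  apply: le_trans (cabsD _ _) _.
  have h3 : Num.min 1 (e / (2 * A)) * cabs k <= e / (2 * A) * cabs k by rewrite ler_wpM2r.
  have -> : e / A * cabs k = e / (2 * A) * cabs k + e / (2 * A) * cabs k.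
    by field; rewrite gt_eqF.
  by apply: lerD; [apply: le_trans H1 _|apply: le_trans H2 _].
apply: (@le_trans _ _ (A * (e / A * cabs k))).
  by apply: ler_pM; rewrite ?cabs_ge0 // /A; lra.
by rewrite le_eqVlt; apply/orP; left; apply/eqP; field; rewrite gt_eqF.
Qed.

(** Used to measure the functions [x |-> h (r e^(ix))]. *)
Lemma holomorphic_slice_continuous h (r : R) : holomorphic_disc h -> 0 <= r < 1 ->
  continuous (fun x : R => complex.Re (h (r%:C * expi x))) /\
  continuous (fun x : R => complex.Im (h (r%:C * expi x))).
Proof.
move=> hh /andP[r0 r1].
have key x (e : R) : 0 < e -> \forall y \near x,
    cabs (h (r%:C * expi y) - h (r%:C * expi x)) < e.
  move=> e0; have zx : cabs (r%:C * expi x) < 1 by rewrite cabs_mul_expi cabsC ger0_norm.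
  have [d d0 Hd] := derivable_cont (hh _ zx) e0.
  have d2 : 0 < d / 2 by lra.
  have hc : \forall y \near x, `|cos x - cos y| < d / 2.
    by have /cvgrPdist_lt H := @continuous_cos R x; exact: H.
  have hs : \forall y \near x, `|sin x - sin y| < d / 2.
    by have /cvgrPdist_lt H := @continuous_sin R x; exact: H.
  near=> y.
  apply: Hd; rewrite -mulrBr cabsM cabsC ger0_norm //.
  apply: (@le_lt_trans _ _ (1 * cabs (expi y - expi x))).
    by rewrite ler_wpM2r ?cabs_ge0 // ltW.
  rewrite mul1r cabsBC; apply: le_lt_trans (cabs_le_ReIm _) _.
  rewrite ReD ImD ReN ImN /=.
  have : `|cos x - cos y| < d / 2 by near: y.
  have : `|sin x - sin y| < d / 2 by near: y.
  by lra.
split => x; apply/cvgrPdist_lt => e e0.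
  by have := key x e e0; apply: filterS => y; apply: le_lt_trans;
    rewrite cabsBC -ReN -ReD Re_le_cabs.
by have := key x e e0; apply: filterS => y; apply: le_lt_trans;
    rewrite cabsBC -ImN -ImD Im_le_cabs.
Unshelve. all: by end_near.
Qed.

(** A boundary function is the pointwise limit of continuous functions along
    the radii [1 - 1 / (n + 1)]. *)
Lemma radial_limit_measurable h : holomorphic_disc h ->
  (forall x : R, (h (r%:C * expi x) : R[i]^o) @[r --> 1^'-] --> (h (expi x) : R[i]^o)) ->
  measurable_fun setT (fun x : R => complex.Re (h (expi x))) /\
  measurable_fun setT (fun x : R => complex.Im (h (expi x))).
Proof.
move=> hh hr; pose r (n : nat) : R := 1 - n.+1%:R^-1.
have r01 n : 0 <= r n < 1.
  rewrite /r subr_ge0 invf_le1 ?ltr0n // ler1n /=.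
  by rewrite ltrBlDr ltrDl invr_gt0 ltr0n.
have rc : r @ \oo --> (1 : R).
  rewrite /r -[X in _ --> X]subr0; apply: cvgB; first exact: cvg_cst.
  exact: cvg_harmonic.
have key x (e : R) : 0 < e -> \forall n \near \oo,
   cabs (h (expi x) - h ((r n)%:C * expi x)) < e.
  move=> e0; have /cvg_cabsP/(_ e e0) := hr x.
  rewrite /at_left /within /= => H.
  have {}H : \forall n \near \oo, r n < 1 ->
      cabs (h (expi x) - h ((r n)%:C * expi x)) < e by exact: rc _ H.
  by move: H; apply: filterS => n; apply; case/andP: (r01 n).
split.
  apply: (@measurable_fun_cvg _ _ _ _ (fun n x => complex.Re (h ((r n)%:C * expi x)))).
    by move=> n; apply: continuous_measurable_fun;
      case: (holomorphic_slice_continuous hh (r01 n)).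
  move=> x _; apply/cvgrPdist_lt => e e0; have := key x e e0; apply: filterS => n.
  by apply: le_lt_trans; rewrite -ReN -ReD Re_le_cabs.
apply: (@measurable_fun_cvg _ _ _ _ (fun n x => complex.Im (h ((r n)%:C * expi x)))).
  by move=> n; apply: continuous_measurable_fun;
    case: (holomorphic_slice_continuous hh (r01 n)).
move=> x _; apply/cvgrPdist_lt => e e0; have := key x e e0; apply: filterS => n.
by apply: le_lt_trans; rewrite -ImN -ImD Im_le_cabs.
Qed.

End Topology.

(** * Norms on the circle *)

Section CircleNorm.
Context {R : realType}.
Implicit Types (f : R[i] -> R[i]) (u B : R).

Lemma circle_normE u f : u != 0 -> circle_norm u f =
  ((\int[haar R]_x (cabs (f (expi x)) `^ u)%:E) `^ u^-1)%E.
Proof.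
move=> u0; rewrite /circle_norm unlock; congr (_ `^ _)%E.
by apply: eq_integral => x _ /=; rewrite ger0_norm ?cabs_ge0.
Qed.

Lemma circle_norm_mean u f : u != 0 -> bmeas (fun x => cabs (f (expi x)) `^ u) ->
  circle_norm u f = ((mean (fun x => cabs (f (expi x)) `^ u)) `^ u^-1)%:E.
Proof. by move=> u0 hf; rewrite circle_normE // integral_mean // poweR_EFin. Qed.

Lemma circle_norm_bound u f B : 0 < u ->
  measurable_fun setT (fun x : R => complex.Re (f (expi x))) ->
  measurable_fun setT (fun x : R => complex.Im (f (expi x))) ->
  (forall x, cabs (f (expi x)) <= B) -> (circle_norm u f <= B%:E)%E.
Proof.
move=> u0 m1 m2 hB; have un0 : u != 0 by rewrite gt_eqF.
have B0 : 0 <= B by apply: le_trans (hB 0); exact: cabs_ge0.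
have hb : bmeas (fun x => cabs (f (expi x)) `^ u).
  by apply: bmeas_powR (ltW u0); apply: cbmeas_cabs; exact: (cbmeas_bound m1 m2 hB).
rewrite circle_norm_mean // lee_fin.
have -> : B = (B `^ u) `^ u^-1 by rewrite -powRrM divff // powRr1.
apply: ge0_ler_powR; rewrite ?nnegrE ?invr_ge0 ?powR_ge0 ?(ltW u0) //.
  by apply: mean_ge0 => x; exact: powR_ge0.
apply: le_mean_cst => // x; apply: ge0_ler_powR; rewrite ?nnegrE ?cabs_ge0 ?(ltW u0) //.
Qed.

End CircleNorm.

(** * The Herglotz integral *)

Section Herglotz.
Context {R : realType}.
Implicit Types (z w : R[i]).

Definition herglotz z (x : R) : R[i] := (expi x + z) / (expi x - z).

Lemma expi_sub z x : expi x - z = expi x * (1 - z / expi x).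
Proof. by rewrite mulrBr mulr1 mulrCA mulfV ?mulr1 ?expi_neq0. Qed.

Lemma cabs_expi_sub z x : 1 - cabs z <= cabs (expi x - z).
Proof. by have := cabs_dist (expi x) z; rewrite cabs_expi; apply: le_trans; exact: ler_norm. Qed.

Lemma expi_sub_neq0 z x : cabs z < 1 -> expi x - z != 0.
Proof. by move=> z1; rewrite -cabs_gt0 (lt_le_trans _ (cabs_expi_sub z x)) // subr_gt0. Qed.

Lemma cabs_conj_expi z x : cabs (1 - z^* * expi x) = cabs (expi x - z).
Proof.
have -> : 1 - z^* * expi x = expi x * (expi x - z)^*.
  by rewrite rmorphB /= expiJ mulrBr divff ?expi_neq0 // mulrC.
by rewrite cabsM cabs_expi mul1r cabsJ.
Qed.

Lemma poisson_expi z x : poisson z (expi x) = (1 - cabs z ^+ 2) / cabs (expi x - z) ^+ 2.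
Proof. by rewrite /poisson cabs_conj_expi. Qed.

Lemma cabs_herglotz_le z x : cabs z < 1 -> cabs (herglotz z x) <= 2 / (1 - cabs z).
Proof.
move=> z1; rewrite cabs_div; apply: ler_pM; rewrite ?invr_ge0 ?cabs_ge0 //.
  by apply: le_trans (cabsD _ _) _; rewrite cabs_expi; lra.
rewrite lef_pV2 ?posrE ?subr_gt0 ?cabs_expi_sub //.
by rewrite cabs_gt0 expi_sub_neq0.
Qed.

Lemma cbmeas_expi_add z : cbmeas (fun x : R => expi x + z).
Proof. by apply: cbmeasD; [exact: cbmeas_expi|exact: cbmeas_cst]. Qed.

Lemma cbmeas_herglotz z : cabs z < 1 -> cbmeas (herglotz z).
Proof.
move=> z1; apply: (@cbmeas_div _ _ _ (2 / (1 - cabs z))) => [||x].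
- exact: cbmeas_expi_add.
- exact: cbmeas_expi_add.
- exact: cabs_herglotz_le.
Qed.

Lemma cint_herglotz z : cabs z < 1 -> cintegral (herglotz z) = 1.
Proof.
move=> z1; have z2 : cabs z^* < 1 by rewrite cabsJ.
have h := cbmeas_geom 0 z2.
have e : cintegral (fun x => (2 * (expi x ^+ 0 / (1 - z^* * expi x)) - 1)^*) = 1.
  rewrite cintJ; last by apply: cbmeasB; [exact: cbmeasZ|exact: cbmeas_cst].
  rewrite cintB; [|exact: cbmeasZ|exact: cbmeas_cst].
  rewrite cintZ // cint_geom // cint_cst.
  have -> : 2 * (0%N == 0%N)%:R - 1 = 1 :> R[i] by rewrite /=; ring.
  by rewrite rmorph1.
rewrite -e; congr cintegral; apply: funext => x.
have n1 := expi_sub_neq0 x z1.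
have n2 : 1 - z / expi x != 0.
  by move: n1; rewrite expi_sub mulf_eq0 negb_or => /andP[].
rewrite expr0 rmorphB rmorph1 rmorphM rmorph_nat rmorphM rmorph1 fmorphV /=.
rewrite rmorphB rmorph1 rmorphM /= conjCK expiJ /herglotz.
by field; rewrite ?n1 ?n2 ?expi_neq0.
Qed.

(** For [|z| < 1] this is the Poisson kernel; for [|z| = 1] it vanishes, even
    where the denominator is zero, thanks to [0^-1 = 0]. *)
Lemma Re_herglotz z x : complex.Re (herglotz z x) =
  (1 - cabs z ^+ 2) / cabs (expi x - z) ^+ 2.
Proof.
rewrite /herglotz ReM ReV ImV.
have e : cabs (expi x) ^+ 2 = 1 by rewrite cabs_expi expr1n.
rewrite -e !(sqr_cabs z, sqr_cabs (expi x)) !(ReD, ImD, ReN, ImN).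
by set q := (_ ^+ 2)%R; rewrite mulrN opprK !mulrA -mulrDl; congr (_ / _); ring.
Qed.

Variables (g : R -> R) (B : R).
Hypothesis (gm : bmeas g) (gB : forall x, `|g x| <= B).

Definition herglotz_int z := cintegral (fun x => herglotz z x * (g x)%:C).

Let B0 : 0 <= B. Proof. exact: le_trans (gB 0). Qed.

Lemma cbmeas_herglotz_mul z : cabs z < 1 -> cbmeas (fun x => herglotz z x * (g x)%:C).
Proof.
by move=> z1; apply: cbmeasM; [exact: cbmeas_herglotz|exact: cbmeas_real].
Qed.

Lemma Re_herglotz_int_le z : cabs z < 1 -> complex.Re (herglotz_int z) <= B.
Proof.
move=> z1; have hp := bmeas_poisson z1.
apply: (@le_trans _ _ (mean (fun x => B * poisson z (expi x)))); last first.
  by rewrite meanZ // mean_poisson // mulr1.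
apply: le_mean => [||x]; [exact: (cbmeas_herglotz_mul z1).1|exact: bmeasZ|].
rewrite ReMC Re_herglotz -poisson_expi mulrC ler_wpM2r //.
  by rewrite ltW // poisson_gt0 // cabs_expi.
exact: le_trans (ler_norm _) (gB x).
Qed.

(** The first-order remainder of the kernel is
    [2 zeta k^2 / ((zeta - z - k) (zeta - z)^2)], which is [O(k^2)] uniformly
    on the circle, so differentiation under the integral sign is elementary. *)
Lemma herglotz_int_cderiv z : cabs z < 1 -> exists D, cderiv herglotz_int z D.
Proof.
move=> z1; pose s := 1 - cabs z; have s0 : 0 < s by rewrite subr_gt0.
have cE : cbmeas (@expi R) := cbmeas_expi.
pose D2 x : R[i] := (2 * expi x) / (expi x - z) ^+ 2 * (g x)%:C.
have cD2 : cbmeas D2.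
  apply: cbmeasM; last exact: cbmeas_real.
  apply: (@cbmeas_div _ _ _ (2 / s ^+ 2)) => [||x].
  - exact: cbmeasZ.
  - exact/cbmeasX/cbmeas_expi_add.
  - rewrite cabs_div cabsM cabs_expi mulr1 cabsX.
    rewrite cabs2 ler_pM2l // lef_pV2 ?posrE ?exprn_gt0 ?cabs_gt0 ?expi_sub_neq0 //.
    by rewrite ler_pXn2r ?nnegrE ?cabs_ge0 ?(ltW s0) // cabs_expi_sub.
exists (cintegral D2) => e e0.
(* half the distance to the circle is kept, hence a denominator [s^3 / 2] *)
pose C := 4 * B / s ^+ 3 + 1.
have C0 : 0 < C by rewrite /C ltr_wpDl // divr_ge0 ?mulr_ge0 ?exprn_ge0 ?(ltW s0).
exists (Num.min (s / 2) (e / C)); first by rewrite lt_min !divr_gt0.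
move=> k; rewrite lt_min => /andP[ks ke].
have k0 := cabs_ge0 k.
have zk : cabs (z + k) <= 1 - s / 2.
  by apply: le_trans (cabsD _ _) _; rewrite /s in ks *; lra.
have zk1 : cabs (z + k) < 1 by apply: le_lt_trans zk _; lra.
have h1 := cbmeas_herglotz_mul zk1; have h2 := cbmeas_herglotz_mul z1.
rewrite /herglotz_int -cintB // -cintZ // -cintB; [|exact: cbmeasB|exact: cbmeasZ].
have hb : cbmeas (fun x => herglotz (z + k) x * (g x)%:C - herglotz z x * (g x)%:C - k * D2 x).
  by apply: cbmeasB; [exact: cbmeasB|exact: cbmeasZ].
apply: le_trans (cabs_cint_le hb) _.
apply: (@le_trans _ _ (C * cabs k * cabs k)); last first.
  by rewrite ler_wpM2r // mulrC -ler_pdivlMr // ltW.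
apply: le_mean_cst => [|x]; first exact: cbmeas_cabs.
have n1 := expi_sub_neq0 x z1; have n2 := expi_sub_neq0 x zk1.
have -> : herglotz (z + k) x * (g x)%:C - herglotz z x * (g x)%:C - k * D2 x =
   2 * expi x * (g x)%:C * k * k / ((expi x - (z + k)) * (expi x - z) ^+ 2).
  by rewrite /herglotz /D2; field; rewrite n1 n2.
rewrite cabs_div (cabsM _ (_ ^+ 2)) cabsX !cabsM cabs_expi mulr1 cabsC.
rewrite cabs2 ler_pdivrMr; last first.
  by rewrite mulr_gt0 ?exprn_gt0 // cabs_gt0.
have hk : 0 <= cabs k * cabs k by rewrite mulr_ge0.
apply: (@le_trans _ _ (2 * B * (cabs k * cabs k))).
  by rewrite -[leLHS]mulrA ler_wpM2r // ler_pM2l.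
have : s / 2 * s ^+ 2 <= cabs (expi x - (z + k)) * cabs (expi x - z) ^+ 2.
  have a1 := cabs_expi_sub (z + k) x; have a2 := cabs_expi_sub z x.
  apply: ler_pM; rewrite ?exprn_ge0 ?(ltW s0) //; first by lra.
    by apply: le_trans a1; lra.
  by rewrite ler_pXn2r ?nnegrE ?cabs_ge0 ?(ltW s0).
move=> h3; apply: (@le_trans _ _ (C * cabs k * cabs k * (s / 2 * s ^+ 2))); last first.
  by rewrite ler_wpM2l // !mulr_ge0 // ltW.
have -> : C * cabs k * cabs k * (s / 2 * s ^+ 2) =
   (2 * B + s ^+ 3 / 2) * (cabs k * cabs k).
  by rewrite /C; field; rewrite gt_eqF.
by rewrite ler_wpM2r // lerDl divr_ge0 // exprn_ge0 // ltW.
Qed.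

End Herglotz.

(** * Outer functions with prescribed Lipschitz log-modulus *)

Definition circle_lipschitz (R : realType) (L : R) (g : R[i] -> R) :=
  forall z w, cabs z = 1 -> cabs w = 1 -> `|g z - g w| <= L * cabs (z - w).

Section OuterFunction.
Context {R : realType}.
Variables (g : R[i] -> R) (L : R).
Hypothesis (gL : circle_lipschitz L g).
Implicit Types (z w : R[i]).

Let L0 : 0 <= L.
Proof.
have := @gL 1 (-1); rewrite cabsN cabs1 => /(_ erefl erefl).
rewrite opprK => h; have h2 : 0 <= L * cabs (1 + 1 : R[i]) by apply: le_trans h.
have c : 0 < cabs (1 + 1 : R[i]) by rewrite cabs_gt0 -[1 + 1]/(2%:R) pnatr_eq0.
by move: h2; rewrite pmulr_lge0.
Qed.

Lemma circle_lipschitz_bound x : `|g (expi x)| <= `|g 1| + 2 * L.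
Proof.
have -> : g (expi x) = g 1 + (g (expi x) - g 1) by ring.
apply: le_trans (ler_normD _ _) _; rewrite lerD2l.
apply: le_trans (gL _ _) _; rewrite ?cabs_expi ?cabs1 //.
rewrite mulrC ler_wpM2r //; apply: le_trans (cabsB _ _) _.
by rewrite cabs_expi cabs1.
Qed.

Lemma circle_lipschitz_bmeas : bmeas (fun x => g (expi x)).
Proof.
apply: (@continuous_bmeas _ _ (`|g 1| + 2 * L)); last exact: circle_lipschitz_bound.
move=> x; apply/cvgrPdist_lt => e e0.
have d2 : 0 < e / (2 * (L + 1)) by rewrite divr_gt0 // mulr_gt0 // ltr_wpDl.
have hc : \forall y \near x, `|cos x - cos y| < e / (2 * (L + 1)).
  by have /cvgrPdist_lt H := @continuous_cos R x; exact: H.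
have hs : \forall y \near x, `|sin x - sin y| < e / (2 * (L + 1)).
  by have /cvgrPdist_lt H := @continuous_sin R x; exact: H.
near=> y.
apply: le_lt_trans (gL _ _) _; rewrite ?cabs_expi //.
have h : cabs (expi x - expi y) < e / (L + 1).
  apply: le_lt_trans (cabs_le_ReIm _) _.
  have -> : e / (L + 1) = e / (2 * (L + 1)) + e / (2 * (L + 1)).
    by field; rewrite gt_eqF // ltr_wpDl.
  rewrite ReD ImD ReN ImN /=; apply: ltrD.
    by near: y.
  by near: y.
apply: (@le_lt_trans _ _ ((L + 1) * cabs (expi x - expi y))).
  by rewrite ler_wpM2r ?cabs_ge0 // lerDl.
by rewrite mulrC -ltr_pdivlMr // ltr_wpDl.
Unshelve. all: by end_near.
Qed.

Let gm := circle_lipschitz_bmeas.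

(** On the circle the singular Herglotz kernel is made integrable by subtracting
    the value of [g] at the singularity. Inside the disc the kernel has mean 1,
    so both branches extend the same expression. *)
Definition outer_log z : R[i] :=
  if cabs z < 1 then herglotz_int (fun x => g (expi x)) z
  else (g z)%:C + cintegral (fun x => herglotz z x * (g (expi x) - g z)%:C).

Lemma bmeas_gB w : bmeas (fun x => g (expi x) - g w).
Proof. by apply: bmeasB gm (bmeas_cst _). Qed.

Lemma cbmeas_singular w : cabs w = 1 ->
  cbmeas (fun x => herglotz w x * (g (expi x) - g w)%:C).
Proof.
move=> w1; under eq_fun do rewrite /herglotz mulrAC.
apply: (@cbmeas_div _ _ _ (2 * L)) => [||x].
- by apply: cbmeasM; [exact: cbmeas_expi_add|exact/cbmeas_real/bmeas_gB].
- exact: cbmeas_expi_add.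
have [->|n] := eqVneq (expi x - w) 0.
  by rewrite invr0 mulr0 cabs0 mulr_ge0.
rewrite cabs_div cabsM cabsC ler_pdivrMr ?cabs_gt0 // -mulrA.
apply: ler_pM; rewrite ?cabs_ge0 //; last by apply: gL; rewrite ?cabs_expi.
by apply: le_trans (cabsD _ _) _; rewrite cabs_expi w1.
Qed.

(** The kernel is purely imaginary when both points lie on the circle. *)
Lemma Re_outer_log w : cabs w = 1 -> complex.Re (outer_log w) = g w.
Proof.
move=> w1; rewrite /outer_log w1 ltxx ReD /=.
rewrite [X in _ + X](_ : _ = 0) ?addr0 // -[RHS](mean_cst 0).
by apply: eq_mean => x; rewrite ReMC Re_herglotz w1 expr1n subrr !mul0r.
Qed.

(** Arithmetic-geometric mean inequality for [s^2 / |zeta - z|], arranged so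
    that the right-hand side has mean [s]. *)
Lemma poisson_young z x (s : R) : cabs z < 1 -> 0 < s -> s ^+ 2 = 1 - cabs z ->
  s ^+ 2 / cabs (expi x - z) <= 2^-1 * (s + s * poisson z (expi x)).
Proof.
move=> z1 s0 sE; rewrite poisson_expi.
have n0 : 0 < cabs (expi x - z) by rewrite cabs_gt0 expi_sub_neq0.
set y := cabs (expi x - z) in n0 *.
have h1 : s ^+ 2 <= 1 - cabs z ^+ 2.
  by rewrite sE; have := cabs_ge0 z; nra.
have h2 : s ^+ 2 / y ^+ 2 <= (1 - cabs z ^+ 2) / y ^+ 2.
  by rewrite ler_wpM2r // invr_ge0 exprn_ge0 // ltW.
apply: (@le_trans _ _ (2^-1 * (s + s * (s ^+ 2 / y ^+ 2)))); last first.
  by rewrite ler_pM2l // lerD2l ler_pM2l.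
have -> : s ^+ 2 / y ^+ 2 = (s / y) ^+ 2 by rewrite expr_div_n.
have -> : s ^+ 2 / y = s * (s / y) by rewrite expr2 mulrA.
have : 0 <= s * (1 - s / y) ^+ 2 by rewrite mulr_ge0 ?sqr_ge0 // ltW.
by rewrite sqrrB; lra.
Qed.

(** The difference of the two integrands is at most
    [2 L (1 - r) / |zeta - r w|], because the Lipschitz bound cancels the
    singularity at [w]; [poisson_young] with [s = sqrt (1 - r)] integrates it. *)
Lemma outer_log_radial w (r s : R) : cabs w = 1 -> 0 <= r < 1 -> 0 < s -> s ^+ 2 = 1 - r ->
  cabs (outer_log w - outer_log (r%:C * w)) <= 2 * L * s.
Proof.
move=> w1 /andP[r0 r1] s0 sE.
have rw : cabs (r%:C * w) = r by rewrite cabsM w1 mulr1 cabsC ger0_norm.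
set z := r%:C * w in rw *; have z1 : cabs z < 1 by rewrite rw.
have hz : cbmeas (fun x => herglotz z x * (g (expi x) - g w)%:C).
  by apply: cbmeasM; [exact: cbmeas_herglotz|exact/cbmeas_real/bmeas_gB].
have hw := cbmeas_singular w1.
have -> : outer_log z = (g w)%:C + cintegral (fun x => herglotz z x * (g (expi x) - g w)%:C).
  have -> : (g w)%:C = cintegral (fun x => (g w)%:C * herglotz z x).
    by rewrite cintZ ?cint_herglotz ?mulr1 //; exact: cbmeas_herglotz.
  rewrite -cintD //; last exact/cbmeasZ/cbmeas_herglotz.
  rewrite /outer_log z1; congr cintegral; apply: funext => x.
  by rewrite rmorphB /=; ring.
rewrite /outer_log w1 ltxx opprD addrACA subrr add0r -cintB //.
have hb : cbmeas (fun x => herglotz w x * (g (expi x) - g w)%:C -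
                           herglotz z x * (g (expi x) - g w)%:C) by exact: cbmeasB.
have hP := bmeas_poisson z1.
apply: le_trans (cabs_cint_le hb) _.
apply: (@le_trans _ _ (mean (fun x => L * (s + s * poisson z (expi x))))); last first.
  have hsP : bmeas (fun x => s * poisson z (expi x)) by exact: bmeasZ.
  have hc : bmeas (fun _ : R => s) by exact: bmeas_cst.
  rewrite meanZ; last exact: bmeasD.
  by rewrite meanD // mean_cst meanZ // mean_poisson //; lra.
apply: le_mean => [||x]; first exact: cbmeas_cabs.
  by apply: bmeasZ; apply: bmeasD; [exact: bmeas_cst|exact: bmeasZ].
have hp : 0 <= poisson z (expi x) by rewrite ltW // poisson_gt0 // cabs_expi.
have [/eqP|n] := eqVneq (expi x - w) 0.
  rewrite subr_eq0 => /eqP ew; rewrite ew in hp *; rewrite subrr mulr0 mulr0 subr0 cabs0.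
  apply: mulr_ge0 => //; apply: addr_ge0; [exact: ltW|apply: mulr_ge0 => //; exact: ltW].
have nz := expi_sub_neq0 x z1.
have -> : herglotz w x * (g (expi x) - g w)%:C - herglotz z x * (g (expi x) - g w)%:C =
   2 * expi x * (w - z) * ((g (expi x) - g w)%:C / (expi x - w)) / (expi x - z).
  by rewrite /herglotz; field; rewrite n nz.
have wz : cabs (w - z) = s ^+ 2.
  have -> : w - z = (1 - r)%:C * w by rewrite /z rmorphB rmorph1 mulrBl mul1r.
  by rewrite cabsM w1 mulr1 cabsC sE ger0_norm // subr_ge0 ltW.
rewrite cabs_div !cabsM cabs2 cabs_expi wz mulr1 cabsV cabsC.
have hL : `|g (expi x) - g w| / cabs (expi x - w) <= L.
  by rewrite ler_pdivrMr ?cabs_gt0 // gL // cabs_expi.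
have hy := @poisson_young z x s z1 s0 _; rewrite rw in hy; have {}hy := hy sE.
have s2 : 0 <= s ^+ 2 / cabs (expi x - z) by rewrite divr_ge0 ?sqr_ge0 ?cabs_ge0.
have -> : 2 * s ^+ 2 * (`|g (expi x) - g w| / cabs (expi x - w)) / cabs (expi x - z) =
  (`|g (expi x) - g w| / cabs (expi x - w)) * (2 * (s ^+ 2 / cabs (expi x - z))).
  by field; rewrite !cabs_eq0 n nz.
apply: ler_pM => //; first by rewrite divr_ge0 ?cabs_ge0.
  by rewrite mulr_ge0.
by lra.
Qed.

Lemma outer_log_cvg w : cabs w = 1 ->
  forall e : R, 0 < e -> \forall r \near 1^'-, cabs (outer_log w - outer_log (r%:C * w)) < e.
Proof.
move=> w1 e e0; pose d := e / (2 * L + 1).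
have L1 : 0 < 2 * L + 1 by rewrite ltr_wpDl // mulr_ge0.
have d0 : 0 < d by rewrite divr_gt0.
have m0 : 0 < Num.min 1 (d ^+ 2) by rewrite lt_min ltr01 exprn_gt0.
near=> r.
have r1 : r < 1 by near: r; exact: nbhs_left_lt.
have : 1 - r < Num.min 1 (d ^+ 2) by near: r; exact: nbhs_left_ltBl.
rewrite lt_min => /andP[r0 rd].
have rr : 0 < 1 - r by rewrite subr_gt0.
have h := @outer_log_radial w r (Num.sqrt (1 - r)) w1.
apply: le_lt_trans (h _ _ _) _.
- by apply/andP; split => //; lra.
- by rewrite sqrtr_gt0.
- by rewrite sqr_sqrtr // ltW.
have hs : Num.sqrt (1 - r) <= d.
  by rewrite -[leRHS](ger0_norm (ltW d0)) -sqrtr_sqr ler_sqrt ?sqr_ge0 ?(ltW rd).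
apply: (@le_lt_trans _ _ (2 * L * d)); first by rewrite ler_wpM2l // mulr_ge0.
rewrite /d mulrA ltr_pdivrMr //.
by rewrite mulrC ltr_pM2l //; lra.
Unshelve. all: by end_near.
Qed.

Definition outer_fun z := cexp (outer_log z).

Lemma outer_fun_radial w : cabs w = 1 ->
  (outer_fun (r%:C * w) : R[i]^o) @[r --> 1^'-] --> (outer_fun w : R[i]^o).
Proof.
move=> w1; apply/cvg_cabsP => e e0.
have hc : cderiv (@cexp R) (outer_log w) (cexp (outer_log w) * 1).
  apply: (@cderiv_cexp_comp _ id) => e' e'0; exists 1 => // k _.
  by rewrite (_ : _ - _ - _ = 0) ?cabs0 ?mulr_ge0 ?cabs_ge0 // ?ltW //; ring.
have [d d0 Hd] := derivable_cont (cderiv_derivable hc) e0.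
have := outer_log_cvg w1 d0; apply: filterS => r hr.
by rewrite cabsBC; apply: Hd; rewrite cabsBC.
Qed.

Lemma cabs_outer_fun w : cabs w = 1 -> cabs (outer_fun w) = expR (g w).
Proof. by move=> w1; rewrite cabs_cexp Re_outer_log. Qed.

Lemma outer_fun_holomorphic : holomorphic_disc outer_fun.
Proof.
move=> z z1.
have [D HD] := herglotz_int_cderiv gm circle_lipschitz_bound z1.
have := cderiv_cexp_comp HD; set D' := cexp _ * D => H.
apply: (@cderiv_derivable _ _ _ D') => e e0.
have [d d0 Hd] := H e e0.
exists (Num.min d (1 - cabs z)); first by rewrite lt_min d0 subr_gt0.
move=> k; rewrite lt_min => /andP[kd kz].
have zk : cabs (z + k) < 1 by apply: le_lt_trans (cabsD _ _) _; lra.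
by rewrite /outer_fun /outer_log z1 zk; exact: Hd.
Qed.

Lemma outer_fun_outer : outer outer_fun.
Proof.
exists 1, (fun x => expR (g (expi x))); split; first exact: cabs1.
- by move=> x; exact: expR_gt0.
- under eq_fun do rewrite expRK.
  exact: bmeas_integrable.
- move=> z z1; rewrite mul1r /outer_fun /outer_log z1; congr cexp.
  by congr cintegral; apply: funext => x; rewrite expRK.
Qed.

Lemma outer_fun_hardy (u : R) : 0 < u -> hardy u outer_fun.
Proof.
move=> u0; split.
- exact: outer_fun_holomorphic.
- apply: (@le_lt_trans _ _ (expR (`|g 1| + 2 * L))%:E); last exact: ltry.
  apply: ge_ereal_sup => _ [r /= r01 <-].
  have [c1 c2] := holomorphic_slice_continuous outer_fun_holomorphic r01.
  apply: circle_norm_bound => //; try exact: continuous_measurable_fun.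
  move=> x; rewrite cabs_cexp ler_expR /outer_log.
  have rx : cabs (r%:C * expi x) < 1.
    by rewrite cabs_mul_expi cabsC; case/andP: r01 => r0 r1; rewrite ger0_norm.
  rewrite rx; exact: (Re_herglotz_int_le gm circle_lipschitz_bound rx).
- by case: (radial_limit_measurable outer_fun_holomorphic
       (fun x => outer_fun_radial (cabs_expi x))).
- by case: (radial_limit_measurable outer_fun_holomorphic
       (fun x => outer_fun_radial (cabs_expi x))).
- by apply: aeW => x; exact: outer_fun_radial (cabs_expi x).
Qed.

End OuterFunction.

(** * The Dirichlet kernel against Poisson kernels *)

Section Dirichlet.
Context {R : realType}.
Implicit Types (z w a : R[i]).

Lemma dirichletS M w : dirichlet M.+1 w = 1 + w * dirichlet M w.
Proof.
rewrite /dirichlet big_ord_recl expr0; congr (_ + _).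
by rewrite mulr_sumr; apply: eq_bigr => i _; rewrite /= /bump /= exprS.
Qed.

Lemma sub1_mul_dirichlet M w : (1 - w) * dirichlet M w = 1 - w ^+ M.
Proof.
elim: M => [|M IH]; first by rewrite /dirichlet big_ord0 mulr0 expr0 subrr.
rewrite dirichletS mulrDr mulr1 mulrCA IH exprS; ring.
Qed.

Lemma cabs_dirichlet_le M w : cabs w <= 1 -> cabs (dirichlet M w) <= M%:R.
Proof.
move=> w1; apply: le_trans (cabs_sum _ _ _) _.
rewrite -[M in leRHS]card_ord -sumr_const; apply: ler_sum => i _.
by rewrite cabsX exprn_ile1 // cabs_ge0.
Qed.

(** On the circle [|D_M|^2 = Re (fejer M)]; having a polynomial makes integrals
    against Poisson kernels explicit. *)
Definition fejer M w : R[i] := \sum_(k < M) (2 * dirichlet k.+1 w - 1).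

(** From [D_(M+1) = 1 + w D_M] one gets
    [|D_(M+1)|^2 = |D_M|^2 + Re (1 + 2 w D_M)], and
    [1 + 2 w D_M = 2 D_(M+1) - 1]. *)
Lemma sqr_dirichlet M w : cabs w = 1 ->
  cabs (dirichlet M w) ^+ 2 = complex.Re (fejer M w).
Proof.
move=> w1; elim: M => [|M IH].
  by rewrite /dirichlet /fejer !big_ord0 cabs0 expr0n.
rewrite /fejer big_ord_recr /= ReD -/(fejer M w) -IH.
rewrite dirichletS.
have e : cabs (w * dirichlet M w) ^+ 2 = cabs (dirichlet M w) ^+ 2.
  by rewrite cabsM w1 mul1r.
rewrite -e; set v := w * _.
by rewrite !sqr_cabs !(ReD, ImD, ReN, ReM) /=; ring.
Qed.

Lemma cabs_fejer_le M w : cabs w <= 2^-1 -> cabs (fejer M w) <= 5 * M%:R.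
Proof.
move=> w1; apply: le_trans (cabs_sum _ _ _) _.
rewrite mulr_natr -[M in leRHS]card_ord -sumr_const; apply: ler_sum => k _.
have n1 : 2^-1 <= cabs (1 - w).
  have := cabs_dist 1 w; rewrite cabs1 => h; have := ler_norm (1 - cabs w); lra.
have w0 := cabs_ge0 w.
have -> : (2 * dirichlet k.+1 w - 1 : R[i]) = 1 + 2 * w * dirichlet k w.
  by rewrite dirichletS; ring.
have d2 : cabs (dirichlet k w) <= 4.
  have := congr1 (@cabs R) (sub1_mul_dirichlet k w); rewrite cabsM => e.
  have : cabs (1 - w ^+ k) <= 1 + cabs w ^+ k.
    by apply: le_trans (cabsB _ _) _; rewrite cabs1 cabsX.
  have : cabs w ^+ k <= 1 by rewrite exprn_ile1 //; lra.
  have : 2^-1 * cabs (dirichlet k w) <= cabs (1 - w) * cabs (dirichlet k w).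
    by rewrite ler_wpM2r ?cabs_ge0.
  by lra.
apply: le_trans (cabsD _ _) _; rewrite cabs1 !cabsM cabs2.
have : cabs w * cabs (dirichlet k w) <= 2^-1 * 4 by apply: ler_pM; rewrite ?cabs_ge0.
by lra.
Qed.

(** The Poisson integral of the restriction to the circle gives the function
    back, as it does for every harmonic polynomial. *)
Definition poisson_reproduced (f : R[i] -> R[i]) :=
  cbmeas (fun x => f (expi x)) /\
  forall a, cabs a < 1 ->
    cintegral (fun x => f (expi x) * (poisson a (expi x))%:C) = f a.

Lemma poisson_reproducedX n : poisson_reproduced (fun z => z ^+ n).
Proof.
split; first exact/cbmeasX/cbmeas_expi.
by move=> a a1; exact: cint_expiX_poisson.
Qed.

Lemma poisson_reproducedD f g : poisson_reproduced f -> poisson_reproduced g ->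
  poisson_reproduced (fun z => f z + g z).
Proof.
move=> [f1 f2] [g1 g2]; split; first exact: cbmeasD.
move=> a a1; rewrite -f2 // -g2 //.
have hP := cbmeas_real (bmeas_poisson a1).
rewrite -cintD; [|exact: cbmeasM|exact: cbmeasM].
by congr cintegral; apply: funext => x; rewrite mulrDl.
Qed.

Lemma poisson_reproducedZ c f : poisson_reproduced f -> poisson_reproduced (fun z => c * f z).
Proof.
move=> [f1 f2]; split; first exact: cbmeasZ.
move=> a a1; rewrite -f2 //.
have hP := cbmeas_real (bmeas_poisson a1).
rewrite -cintZ; last exact: cbmeasM.
by congr cintegral; apply: funext => x; rewrite mulrA.
Qed.

Lemma poisson_reproduced_sum n (F : nat -> R[i] -> R[i]) : (forall i, poisson_reproduced (F i)) ->
  poisson_reproduced (fun z => \sum_(i < n) F i z).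
Proof.
move=> hF; elim: n => [|n IH].
  rewrite (_ : (fun _ => _) = (fun z => 0 * z ^+ 0)); last first.
    by apply: funext => z; rewrite big_ord0 mul0r.
  exact/poisson_reproducedZ/poisson_reproducedX.
under eq_fun do rewrite big_ord_recr /=.
exact: poisson_reproducedD.
Qed.

Lemma fejer_reproduced M N : poisson_reproduced (fun z => fejer M (z ^+ N)).
Proof.
apply: (@poisson_reproduced_sum _ (fun k z => 2 * dirichlet k.+1 (z ^+ N) - 1)) => k.
apply: poisson_reproducedD.
  apply: poisson_reproducedZ.
  apply: (@poisson_reproduced_sum _ (fun k z => (z ^+ N) ^+ k)) => j.
  under eq_fun do rewrite -exprM; exact: poisson_reproducedX.
rewrite (_ : (fun _ => _) = (fun z => -1 * z ^+ 0)); last first.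
  by apply: funext => z; rewrite expr0 mulr1.
exact/poisson_reproducedZ/poisson_reproducedX.
Qed.

Lemma mean_sqr_dirichlet_poisson M N a : cabs a < 1 ->
  mean (fun x => cabs (dirichlet M (expi x ^+ N)) ^+ 2 * poisson a (expi x)) =
  complex.Re (fejer M (a ^+ N)).
Proof.
move=> a1; have [_ /(_ a a1) <-] := fejer_reproduced M N.
apply: eq_mean => x; rewrite ReMC sqr_dirichlet //.
by rewrite cabsX cabs_expi expr1n.
Qed.

Lemma bernoulli_ineq (x : R) n : -1 <= x -> 1 + n%:R * x <= (1 + x) ^+ n.
Proof.
move=> x1; elim: n => [|n IH]; first by rewrite mul0r addr0 expr0.
rewrite exprS mulrS.
have h : (1 + x) * (1 + n%:R * x) <= (1 + x) * (1 + x) ^+ n by rewrite ler_wpM2l //; lra.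
have h2 : 0 <= n%:R * x ^+ 2 by rewrite mulr_ge0 ?sqr_ge0.
by apply: le_trans h; rewrite expr2 in h2; lra.
Qed.

(** At [q = 1 - 1 / (2 M)] Bernoulli's inequality keeps every power [q^i],
    [i < M], above 1/2, so the value is comparable to [|D_M(1)|^2 = M^2]. *)
Lemma Re_fejer_ge M : (1 <= M)%N ->
  M%:R ^+ 2 / 4 <= complex.Re (fejer M (1 - (2 * M%:R)^-1 : R)%:C).
Proof.
move=> M1; have M0 : 0 < M%:R :> R by rewrite ltr0n.
set q : R := 1 - _.
have i1 : (2 * M%:R)^-1 <= 2^-1 :> R.
  by rewrite lef_pV2 ?posrE ?mulr_gt0 // -[leLHS]mulr1 ler_pM2l // ler1n.
have i0 : 0 < (2 * M%:R)^-1 :> R by rewrite invr_gt0 mulr_gt0.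
have q0 : 0 <= q by rewrite /q; lra.
have q1 : q <= 1 by rewrite /q; lra.
have qM : 2^-1 <= q ^+ M.
  have := @bernoulli_ineq (- (2 * M%:R)^-1) M; rewrite -/q.
  have -> : 1 + M%:R * - (2 * M%:R)^-1 = 2^-1 :> R by field; rewrite gt_eqF.
  by apply; lra.
have hD k : (k < M)%N -> 1 <= complex.Re (dirichlet k.+1 q%:C) /\
    k.+1%:R / 2 <= complex.Re (dirichlet k.+1 q%:C).
  move=> kM; rewrite /dirichlet Re_sum.
  have e (i : 'I_k.+1) : complex.Re (q%:C ^+ i) = q ^+ i by rewrite -rmorphXn.
  under eq_bigr do rewrite e; split.
    by rewrite big_ord_recl expr0 lerDl sumr_ge0 // => i _; rewrite exprn_ge0.
  rewrite -[k.+1 in leLHS]card_ord -sumr_const mulr_suml.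
  apply: ler_sum => i _; rewrite mul1r; apply: le_trans qM _.
  have iM : (i <= M)%N by apply: leq_trans kM; exact: ltnW (ltn_ord i).
  by rewrite ler_wiXn2l.
rewrite /fejer Re_sum.
have hS : \sum_(k < M) (k.+1%:R / 2) <= \sum_(k < M) complex.Re (2 * dirichlet k.+1 q%:C - 1).
  apply: ler_sum => k _; have [h1 h2] := hD _ (ltn_ord k).
  have -> : 2 * dirichlet k.+1 q%:C = dirichlet k.+1 q%:C + dirichlet k.+1 q%:C by ring.
  by rewrite !ReD ReN /=; lra.
apply: le_trans hS.
have -> : \sum_(k < M) (k.+1%:R / 2) = M%:R * (M%:R + 1) / 4 :> R.
  elim: (M) => [|m IH]; first by rewrite big_ord0 mul0r mul0r.
  by rewrite big_ord_recr /= IH -[m.+1]addn1 natrD; field.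
by rewrite expr2; lra.
Qed.

End Dirichlet.

(** * Poisson kernels at scaled roots of unity *)

Section RootsOfUnity.
Context {R : realType}.
Variable N : nat.
Hypothesis N0 : (0 < N)%N.

Definition unity_root : R[i] := expi (2 * pi / N%:R).

Let NR : N%:R != 0 :> R. Proof. by rewrite pnatr_eq0 -lt0n. Qed.

Lemma cabs_unity_root k : cabs (unity_root ^+ k) = 1.
Proof. by rewrite cabsX cabs_expi expr1n. Qed.

Lemma unity_rootX : unity_root ^+ N = 1.
Proof.
rewrite /unity_root expiX -[_ *+ N]mulr_natr divfK // mulr_natl.
by rewrite /expi cos2pi sin2pi.
Qed.

Lemma unity_root_neq1 k : (0 < k < N)%N -> unity_root ^+ k != 1.
Proof.
move=> /andP[k0 kN]; apply/eqP; rewrite /unity_root expiX => /(congr1 (@complex.Re R)) /=.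
set y := pi * (k%:R / N%:R) : R.
have -> : 2 * pi / N%:R *+ k = y *+ 2.
  by rewrite /y -mulr_natr -[RHS]mulr_natr; field.
rewrite cos_mulr2n => h.
have h2 : sin y ^+ 2 = 0 by rewrite sin2cos2; rewrite -mulr_natr in h; lra.
have : 0 < sin y.
  apply: sin_gt0_pi; rewrite /y mulr_gt0 ?pi_gt0 ?divr_gt0 ?ltr0n //=.
  by rewrite gtr_pMr ?pi_gt0 // ltr_pdivrMr ?ltr0n // mul1r ltr_nat.
by move=> s0; have := exprn_gt0 2 s0; rewrite h2 ltxx.
Qed.

(** Write [1 / (1 - v) = D_N(v) / (1 - v^N)] at [v = u / omega^k], where [v^N]
    is independent of [k], and use the orthogonality of the roots of unity. *)
Lemma sum_inv_sub_roots (u : R[i]) : cabs u < 1 ->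
  \sum_(k < N) (1 - u * (unity_root ^+ k)^-1)^-1 = N%:R / (1 - u ^+ N).
Proof.
move=> u1; have uN : 1 - u ^+ N != 0.
  by rewrite sub1_neq0 // cabsX expr_lt1 // cabs_ge0.
have r0 k : unity_root ^+ k != 0 by rewrite -cabs_gt0 cabs_unity_root.
have e k : (1 - u * (unity_root ^+ k)^-1)^-1 =
    (\sum_(j < N) u ^+ j * ((unity_root ^+ j)^-1) ^+ k) / (1 - u ^+ N).
  have v1 : cabs (u * (unity_root ^+ k)^-1) < 1.
    by rewrite cabs_div cabs_unity_root divr1.
  have n1 := sub1_neq0 v1.
  have h := sub1_mul_dirichlet N (u * (unity_root ^+ k)^-1).
  rewrite exprMn exprVn -exprM mulnC exprM unity_rootX expr1n invr1 mulr1 in h.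
  rewrite (_ : \sum_(j < N) _ = dirichlet N (u * (unity_root ^+ k)^-1)); last first.
    apply: eq_bigr => j _; rewrite exprMn !exprVn -!exprM mulnC //.
  apply: (mulfI n1); rewrite divff // mulrA h divff //.
under eq_bigr do rewrite e.
rewrite -mulr_suml exchange_big /=; congr (_ / _).
rewrite (bigD1 (Ordinal N0)) //= [X in _ + X]big1 ?addr0.
  rewrite (eq_bigr (fun _ => 1)); first by rewrite sumr_const card_ord.
  by move=> k _; rewrite !expr0 invr1 expr1n mulr1.
move=> j j0; rewrite -mulr_sumr.
have jn : unity_root ^+ j != 1.
  by apply: unity_root_neq1; rewrite ltn_ord andbT lt0n;
    apply: contra j0 => /eqP h; apply/eqP/val_inj.
have := sub1_mul_dirichlet N ((unity_root ^+ j)^-1).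
rewrite exprVn -exprM mulnC exprM unity_rootX expr1n invr1 subrr => /eqP.
rewrite mulf_eq0 subr_eq0 eq_sym invr_eq1 (negbTE jn) /= => /eqP.
by rewrite /dirichlet => ->; rewrite mulr0.
Qed.

(** The poles average out to a single Poisson kernel in [zeta^N] with pole
    [r^N]. *)
Lemma sum_poisson_roots (r : R) x : 0 <= r < 1 ->
  \sum_(k < N) poisson (r%:C * unity_root ^+ k) (expi x) <= 2 * N%:R / (1 - r ^+ N).
Proof.
move=> /andP[r0 r1].
have cr : cabs (r%:C * expi x) < 1 by rewrite cabs_mul_expi cabsC ger0_norm.
have e k : poisson (r%:C * unity_root ^+ k) (expi x) =
   2 * complex.Re (1 - (r%:C * expi x) * (unity_root ^+ k)^-1)^-1 - 1.
  rewrite poissonE ?cabs_expi //; last first.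
    by rewrite cabsM cabs_unity_root mulr1 cabsC ger0_norm.
  have -> : (r%:C * unity_root ^+ k)^* * expi x = r%:C * expi x / unity_root ^+ k.
    rewrite rmorphM /= (cabs_unit_conj (cabs_unity_root k)).
    have -> : (r%:C)^*%R = r%:C :> R[i] by exact: conjc_real.
    by rewrite mulrAC.
  by [].
under eq_bigr do rewrite e.
rewrite sumrB -mulr_sumr -Re_sum sum_inv_sub_roots // sumr_const card_ord.
have h : complex.Re (N%:R / (1 - (r%:C * expi x) ^+ N)) <= N%:R / (1 - r ^+ N).
  apply: le_trans (ler_norm _) _; apply: le_trans (Re_le_cabs _) _.
  rewrite cabs_div -(rmorph_nat (real_complex R)) cabsC ger0_norm // ler_wpM2l //.
  have rN : r ^+ N < 1 by rewrite expr_lt1.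
  have cN : cabs ((r%:C * expi x) ^+ N) = r ^+ N.
    by rewrite cabsX cabs_mul_expi cabsC ger0_norm.
  rewrite lef_pV2 ?posrE ?subr_gt0 //.
    by rewrite -{1}cN sub1_bound // cN.
  by rewrite cabs_gt0 sub1_neq0 // cN.
have n0 : 0 <= N%:R :> R by [].
by rewrite -mulrA; lra.
Qed.

End RootsOfUnity.

(** * Moving the poles away from the circle *)

Section Retraction.
Context {R : realType}.
Variable N : nat.
Hypothesis N0 : (0 < N)%N.
Implicit Types (a : R[i]).

Let q : R := 1 - N%:R^-1.

(** Poles closer than [1 / N] to the circle are moved radially to distance
    [1 / N]. *)
Definition retract a : R[i] := if cabs a <= q then a else (q / cabs a)%:C * a.

Let n0 : 0 < N%:R^-1 :> R. Proof. by rewrite invr_gt0 ltr0n. Qed.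
Let q0 : 0 <= q. Proof. by rewrite subr_ge0 invf_le1 ?ltr0n // ler1n. Qed.

Lemma cabs_retract a : cabs (retract a) <= q.
Proof.
rewrite /retract; case: ifPn => //; rewrite -ltNge => qa.
have a0 : 0 < cabs a by apply: le_lt_trans qa.
by rewrite cabsM cabsC ger0_norm ?divr_ge0 ?cabs_ge0 // divfK // gt_eqF.
Qed.

Lemma cabs_retract_lt1 a : cabs (retract a) < 1.
Proof. by apply: le_lt_trans (cabs_retract a) _; rewrite ltrBlDr ltrDl. Qed.

(** [(1 - 1/N)^N (1 + 1/N)^N <= 1], and the second factor is at least 2. *)
Lemma cabs_retractX a : cabs (retract a ^+ N) <= 2^-1.
Proof.
rewrite cabsX; apply: (@le_trans _ _ (q ^+ N)).
  by rewrite ler_pXn2r ?nnegrE ?cabs_ge0 // cabs_retract.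
have h1 : 2 <= (1 + N%:R^-1) ^+ N :> R.
  have hb : -1 <= N%:R^-1 :> R by have := n0; lra.
  by have := bernoulli_ineq N hb; rewrite divff ?gt_eqF ?ltr0n.
have h2 : q ^+ N * (1 + N%:R^-1) ^+ N <= 1.
  rewrite -exprMn exprn_ile1 //.
    by rewrite mulr_ge0 // addr_ge0 // ltW.
  rewrite /q; have := mulr_gt0 n0 n0; lra.
have : q ^+ N * 2 <= q ^+ N * (1 + N%:R^-1) ^+ N by rewrite ler_wpM2l // exprn_ge0.
by lra.
Qed.

(** Within [2 / N] of the retracted pole its kernel is of size [N]; further away
    the two poles are seen from comparable distances, so moving the pole
    inwards can only increase the kernel, up to a factor. *)
Lemma poisson_retract a x : cabs a < 1 ->
  poisson a (expi x) <= 4 * poisson (retract a) (expi x) \/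
  N%:R / 4 <= poisson (retract a) (expi x).
Proof.
move=> a1; have b1 := cabs_retract_lt1 a.
have [qa|qa] := leP (cabs a) q.
  by left; rewrite /retract qa; have := poisson_gt0 (cabs_expi x) a1; lra.
have a0 : 0 < cabs a by apply: le_lt_trans qa.
have cb : cabs ((q / cabs a)%:C * a) = q.
  by rewrite cabsM cabsC ger0_norm ?divr_ge0 ?cabs_ge0 // divfK // gt_eqF.
rewrite /retract leNgt qa /= in b1 *.
set b := (q / cabs a)%:C * a in cb b1 *.
have nb : 0 < cabs (expi x - b) by rewrite cabs_gt0 expi_sub_neq0.
have na : 0 < cabs (expi x - a) by rewrite cabs_gt0 expi_sub_neq0.
rewrite !poisson_expi cb.
have N0' : 0 < N%:R :> R by rewrite ltr0n.
have [s|s] := leP (cabs (expi x - b)) (2 * N%:R^-1); [right|left].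
  rewrite ler_pdivlMr ?exprn_gt0 //.
  apply: (@le_trans _ _ (N%:R / 4 * (2 * N%:R^-1) ^+ 2)).
    by rewrite ler_wpM2l ?divr_ge0 // ler_pXn2r ?nnegrE ?mulr_ge0 ?cabs_ge0 // ltW.
  have -> : N%:R / 4 * (2 * N%:R^-1) ^+ 2 = N%:R^-1 :> R by field; rewrite gt_eqF.
  have : 0 <= q * (1 - q) by rewrite mulr_ge0 // /q; lra.
  by rewrite expr2 /q; lra.
have ab : cabs (a - b) <= N%:R^-1.
  have -> : a - b = (1 - q / cabs a)%:C * a by rewrite /b rmorphB rmorph1; ring.
  rewrite cabsM cabsC ger0_norm; last by rewrite subr_ge0 ler_pdivrMr // mul1r ltW.
  by rewrite mulrBl divfK ?gt_eqF // /q; lra.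
have sa : cabs (expi x - b) / 2 <= cabs (expi x - a).
  have := cabsD (expi x - a) (a - b); rewrite addrA subrK => h; lra.
have qa2 : 1 - cabs a ^+ 2 <= 1 - q ^+ 2.
  by rewrite lerD2l lerN2 ler_pXn2r ?nnegrE ?cabs_ge0 // ltW.
have a2 : 0 <= 1 - cabs a ^+ 2 by rewrite subr_ge0 exprn_ile1 ?cabs_ge0 // ltW.
rewrite ler_pdivrMr ?exprn_gt0 //.
have -> : 4 * ((1 - q ^+ 2) / cabs (expi x - b) ^+ 2) * cabs (expi x - a) ^+ 2 =
  (1 - q ^+ 2) * (2 ^+ 2 * cabs (expi x - a) ^+ 2) / cabs (expi x - b) ^+ 2 by ring.
rewrite ler_pdivlMr ?exprn_gt0 //.
have : cabs (expi x - b) ^+ 2 <= (2 * cabs (expi x - a)) ^+ 2.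
  by rewrite ler_pXn2r ?nnegrE ?mulr_ge0 ?cabs_ge0 //; lra.
rewrite exprMn => h.
by apply: ler_pM => //; rewrite sqr_ge0.
Qed.

End Retraction.

(** * Existence of admissible outer functions *)

Section Lipschitz.
Context {R : realType}.
Implicit Types (g h : R[i] -> R) (z w a : R[i]).

Definition lipschitz_on_circle g := exists2 L : R, 0 <= L & circle_lipschitz L g.

Lemma circle_lip_cst (c : R) : lipschitz_on_circle (fun=> c).
Proof. by exists 0 => // z w _ _; rewrite subrr normr0 mul0r. Qed.

Lemma circle_lipD g h : lipschitz_on_circle g -> lipschitz_on_circle h ->
  lipschitz_on_circle (fun z => g z + h z).
Proof.
move=> [A A0 gA] [B B0 hB]; exists (A + B); first exact: addr_ge0.
move=> z w z1 w1; rewrite opprD addrACA mulrDl.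
by apply: le_trans (ler_normD _ _) _; rewrite lerD ?gA ?hB.
Qed.

Lemma circle_lipM g h (G H : R) : lipschitz_on_circle g -> lipschitz_on_circle h ->
  (forall z, cabs z = 1 -> `|g z| <= G) -> (forall z, cabs z = 1 -> `|h z| <= H) ->
  lipschitz_on_circle (fun z => g z * h z).
Proof.
move=> [A A0 gA] [B B0 hB] gG hH.
have G0 : 0 <= G by apply: le_trans (gG 1 (cabs1)).
have H0 : 0 <= H by apply: le_trans (hH 1 (cabs1)).
exists (A * H + G * B); first by rewrite addr_ge0 ?mulr_ge0.
move=> z w z1 w1.
have -> : g z * h z - g w * h w = (g z - g w) * h z + g w * (h z - h w) by ring.
apply: le_trans (ler_normD _ _) _; rewrite !normrM mulrDl; apply: lerD.
  by rewrite mulrAC; apply: ler_pM; rewrite ?gA ?hH.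
by rewrite -mulrA; apply: ler_pM; rewrite ?hB ?gG.
Qed.

Lemma circle_lipZ (c : R) g : lipschitz_on_circle g ->
  lipschitz_on_circle (fun z => c * g z).
Proof.
move=> [A A0 gA]; exists (`|c| * A); first by rewrite mulr_ge0.
by move=> z w z1 w1; rewrite -mulrBr normrM -mulrA ler_wpM2l // gA.
Qed.

Lemma circle_lip_sum n (F : 'I_n -> R[i] -> R) :
  (forall i, lipschitz_on_circle (F i)) ->
  lipschitz_on_circle (fun z => \sum_(i < n) F i z).
Proof.
move=> hF.
have : forall s : seq 'I_n, lipschitz_on_circle (fun z => \sum_(i <- s) F i z).
  elim=> [|i s IH].
    by under eq_fun do rewrite big_nil; exact: circle_lip_cst.
  by under eq_fun do rewrite big_cons; exact: circle_lipD.
exact.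
Qed.

Lemma circle_lipV g (m : R) : 0 < m -> lipschitz_on_circle g ->
  (forall z, cabs z = 1 -> m <= g z) -> lipschitz_on_circle (fun z => (g z)^-1).
Proof.
move=> m0 [A A0 gA] gm; exists (A / m ^+ 2); first by rewrite divr_ge0 ?exprn_ge0 // ltW.
move=> z w z1 w1.
have gz := lt_le_trans m0 (gm z z1); have gw := lt_le_trans m0 (gm w w1).
have -> : (g z)^-1 - (g w)^-1 = (g w - g z) / (g z * g w) by field; rewrite !gt_eqF.
rewrite normrM normfV (gtr0_norm (mulr_gt0 gz gw)) mulrAC.
apply: ler_pM => //; first by rewrite invr_ge0 mulr_ge0 // ltW.
  by rewrite cabsBC gA.
rewrite lef_pV2 ?posrE ?mulr_gt0 ?exprn_gt0 // expr2.
by apply: ler_pM; rewrite ?gm // ltW.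
Qed.

Lemma circle_lip_ln g (m : R) : 0 < m -> lipschitz_on_circle g ->
  (forall z, cabs z = 1 -> m <= g z) -> lipschitz_on_circle (fun z => ln (g z)).
Proof.
move=> m0 [A A0 gA] gm; exists (A / m); first by rewrite divr_ge0 // ltW.
have key z w : cabs z = 1 -> cabs w = 1 -> ln (g z) - ln (g w) <= A / m * cabs (z - w).
  move=> z1 w1.
  have gz := lt_le_trans m0 (gm z z1); have gw := lt_le_trans m0 (gm w w1).
  rewrite -ln_div ?posrE //.
  have -> : g z / g w = 1 + (g z - g w) / g w by field; rewrite gt_eqF.
  have -> : A / m * cabs (z - w) = A * cabs (z - w) / m by ring.
  apply: le_trans (le_ln1Dx _) _.
    by rewrite mulrBl divff ?gt_eqF // ltrBrDr addrC subrr divr_gt0.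
  apply: le_trans (ler_norm _) _; rewrite normrM normfV (gtr0_norm gw).
  apply: ler_pM => //; first by rewrite invr_ge0 ltW.
    exact: gA.
  by rewrite lef_pV2 ?posrE // gm.
move=> z w z1 w1; rewrite ler_norml lerNl opprB key // andbT.
by rewrite cabsBC key.
Qed.

Lemma circle_lip_maxr g (m : R) : lipschitz_on_circle g ->
  lipschitz_on_circle (fun z => Num.max (g z) m).
Proof.
move=> [A A0 gA]; exists A => // z w z1 w1; apply: le_trans (gA z w z1 w1).
rewrite !maxEle; case: (leP (g z) m) => h1; case: (leP (g w) m) => h2.
- by rewrite subrr normr0.
- rewrite (@ltr0_norm _ (m - g w)) ?subr_lt0 // (@ler0_norm _ (g z - g w)); lra.
- by rewrite (@gtr0_norm _ (g z - m)) ?subr_gt0 // (@ger0_norm _ (g z - g w)); lra.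
- by [].
Qed.

Lemma cabs_conj_sub_lip a : lipschitz_on_circle (fun z => cabs (1 - a^* * z)).
Proof.
exists (cabs a); first exact: cabs_ge0.
move=> z w _ _; apply: le_trans (cabs_dist _ _) _.
have -> : 1 - a^* * z - (1 - a^* * w) = - a^* * (z - w) by ring.
by rewrite cabsM cabsN cabsJ.
Qed.

Lemma poisson_lip a : cabs a < 1 -> lipschitz_on_circle (poisson a).
Proof.
move=> a1; apply: circle_lipZ.
have hb z : cabs z = 1 -> 1 - cabs a <= cabs (1 - a^* * z).
  move=> z1; have e : cabs (a^* * z) = cabs a by rewrite cabsM cabsJ z1 mulr1.
  by rewrite -{1}e sub1_bound // e.
have s0 : 0 < 1 - cabs a by rewrite subr_gt0.
apply: (@circle_lipV _ ((1 - cabs a) ^+ 2)).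
- exact: exprn_gt0.
- have h2 z : cabs z = 1 -> `|cabs (1 - a^* * z)| <= 2.
    move=> z1; rewrite ger0_norm ?cabs_ge0 //.
    by apply: le_trans (cabsB _ _) _; rewrite cabs1 cabsM cabsJ z1; lra.
  exact: (circle_lipM (cabs_conj_sub_lip a) (cabs_conj_sub_lip a) h2 h2).
- by move=> z z1; rewrite ler_pXn2r ?nnegrE ?cabs_ge0 ?(ltW s0) ?hb.
Qed.

Lemma circle_lip_pow_sum n (c : R[i]) (k : nat -> nat) :
  lipschitz_on_circle (fun z => cabs (c * \sum_(i < n) z ^+ (k i))).
Proof.
have hp j : exists2 L : R, 0 <= L & forall z w, cabs z = 1 -> cabs w = 1 ->
    cabs (z ^+ j - w ^+ j) <= L * cabs (z - w).
  elim: j => [|j [L L0 IH]].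
    by exists 0 => // z w _ _; rewrite !expr0 subrr cabs0 mul0r.
  exists (L + 1); first by rewrite addr_ge0.
  move=> z w z1 w1; rewrite !exprS.
  have -> : z * z ^+ j - w * w ^+ j = z * (z ^+ j - w ^+ j) + (z - w) * w ^+ j by ring.
  apply: le_trans (cabsD _ _) _.
  by rewrite !cabsM cabsX z1 w1 expr1n mul1r mulr1 mulrDl mul1r lerD2r IH.
have [L L0 hL] : exists2 L : R, 0 <= L & forall z w, cabs z = 1 -> cabs w = 1 ->
    cabs (\sum_(i < n) z ^+ (k i) - \sum_(i < n) w ^+ (k i)) <= L * cabs (z - w).
  elim: n => [|n [L L0 IH]].
    by exists 0 => // z w _ _; rewrite !big_ord0 subrr cabs0 mul0r.
  have [L' L'0 h'] := hp (k n); exists (L + L'); first exact: addr_ge0.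
  move=> z w z1 w1; rewrite !big_ord_recr /= opprD addrACA mulrDl.
  by apply: le_trans (cabsD _ _) _; rewrite lerD ?IH ?h'.
exists (cabs c * L); first by rewrite mulr_ge0 ?cabs_ge0.
move=> z w z1 w1; apply: le_trans (cabs_dist _ _) _.
by rewrite -mulrBr cabsM -mulrA ler_wpM2l ?cabs_ge0 // hL.
Qed.

(** Szego's theorem for Lipschitz data, where the modulus is attained at every
    point of the circle rather than almost everywhere. *)
Lemma exists_outer g (u : R) : 0 < u -> lipschitz_on_circle g ->
  exists h : R[i] -> R[i],
    [/\ hardy u h, outer h & forall w, cabs w = 1 -> cabs (h w) = expR (g w)].
Proof.
move=> u0 [L L0 gL]; exists (outer_fun g); split.
- exact: (outer_fun_hardy gL u0).
- exact: (outer_fun_outer gL).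
- exact: cabs_outer_fun.
Qed.

Lemma poisson_sum_ge0 K (a : 'I_K -> R[i]) (c : 'I_K -> R) w :
  (forall i, cabs (a i) < 1) -> (forall i, 0 <= c i) -> cabs w = 1 ->
  0 <= \sum_(i < K) c i * poisson (a i) w.
Proof.
move=> a1 c0 w1; apply: sumr_ge0 => i _; rewrite mulr_ge0 // ltW //.
exact: poisson_gt0.
Qed.

Lemma poisson_lower a w : cabs w = 1 -> cabs a < 1 -> (1 - cabs a) / 4 <= poisson a w.
Proof.
move=> w1 a1; rewrite /poisson.
have a0 := cabs_ge0 a.
have n1 : 0 < cabs (1 - a^* * w) by rewrite cabs_gt0 sub1_neq0 // cabsM cabsJ w1 mulr1.
have n2 : cabs (1 - a^* * w) <= 2.
  by apply: le_trans (cabsB _ _) _; rewrite cabs1 cabsM cabsJ w1; lra.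
apply: ler_pM; rewrite ?invr_ge0 ?subr_ge0 ?(ltW a1) //.
  by rewrite lerD2l lerN2 expr2 ler_piMr // ltW.
rewrite lef_pV2 ?posrE ?exprn_gt0 //.
apply: (@le_trans _ _ (2 ^+ 2)); first by rewrite ler_pXn2r ?nnegrE ?(ltW n1).
by rewrite expr2 -natrM.
Qed.

(** A convex combination of Poisson kernels is Lipschitz and bounded below, hence
    so is its logarithm up to constants, and [exists_outer] applies to
    [t^-1 ln u]. *)
Lemma exists_calA (t : R) K (a : 'I_K -> R[i]) (c : 'I_K -> R) : 0 < t ->
  (forall i, cabs (a i) < 1) -> (forall i, 0 <= c i) -> \sum_(i < K) c i = 1 ->
  exists2 h : R[i] -> R[i], calA t K h &
    {ae haar R, forall x : R, cabs (h (expi x)) `^ t =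
             \sum_(nu < K) c nu * poisson (a nu) (expi x)}.
Proof.
move=> t0 a1 c0 c1; pose u w := \sum_(i < K) c i * poisson (a i) w.
have [m m0 hm] : exists2 m : R, 0 < m & forall w, cabs w = 1 -> m <= u w.
  exists (\sum_(i < K) c i * ((1 - cabs (a i)) / 4)).
    have h0 i : 0 <= c i * ((1 - cabs (a i)) / 4).
      by rewrite mulr_ge0 // divr_ge0 // subr_ge0 ltW.
    rewrite lt_def sumr_ge0 // andbT; apply/eqP => /psumr_eq0P h.
    have c00 i : c i = 0.
      have /eqP := h (fun i _ => h0 i) i isT; rewrite mulf_eq0 => /orP[/eqP //|].
      by rewrite gt_eqF // divr_gt0 // subr_gt0.
    by move: c1; rewrite big1 // => /eqP; rewrite eq_sym oner_eq0.
  move=> w w1; apply: ler_sum => i _; rewrite ler_wpM2l //; exact: poisson_lower.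
have ul : lipschitz_on_circle u.
  by apply: circle_lip_sum => i; apply: circle_lipZ; exact: poisson_lip.
have [h [h1 h2 h3]] := exists_outer t0 (circle_lipZ t^-1 (circle_lip_ln m0 ul hm)).
have e : {ae haar R, forall x : R, cabs (h (expi x)) `^ t =
             \sum_(nu < K) c nu * poisson (a nu) (expi x)}.
  apply: aeW => x; rewrite h3 ?cabs_expi // -expRM mulrAC mulVf ?gt_eqF // mul1r.
  by rewrite lnK // posrE (lt_le_trans m0) // hm // cabs_expi.
exists h => //; split => //.
by exists a, c; split.
Qed.

End Lipschitz.

(** * Powers and the weighted Young inequality *)

Section Powers.
Context {R : realType}.

Lemma powR_le1 (x s : R) : 0 <= x -> x <= 1 -> 0 <= s -> x `^ s <= 1.
Proof.
move=> x0 x1 s0; have : x `^ s <= 1 `^ s by apply: ge0_ler_powR; rewrite ?nnegrE.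
by rewrite powR1.
Qed.

Lemma sqrt_powR_le (E B : R) : 0 <= E -> 0 <= B -> E <= B ^+ 2 -> E `^ 2^-1 <= B.
Proof.
move=> E0 B0 h; have -> : B = (B ^+ 2) `^ 2^-1.
  by rewrite -powR_mulrn // -powRrM divff ?pnatr_eq0 // powRr1.
by apply: ge0_ler_powR; rewrite ?nnegrE ?sqr_ge0 ?invr_ge0.
Qed.

Lemma le_sqrt_powR (E B : R) : 0 <= B -> B ^+ 2 <= E -> B <= E `^ 2^-1.
Proof.
move=> B0 h; have {1}-> : B = (B ^+ 2) `^ 2^-1.
  by rewrite -powR_mulrn // -powRrM divff ?pnatr_eq0 // powRr1.
by apply: ge0_ler_powR; rewrite ?nnegrE ?sqr_ge0 ?invr_ge0 // (le_trans _ h) ?sqr_ge0.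
Qed.

End Powers.

Section Young.
Context {R : realType}.
Variable p : R.
Hypothesis hp : 2 < p.

Let p0 : 0 < p. Proof. by apply: lt_trans hp. Qed.
Let pn : p != 0. Proof. by rewrite gt_eqF. Qed.

Lemma conj_gt0 : 0 < 1 - 2 / p.
Proof. by rewrite subr_gt0 ltr_pdivrMr // mul1r. Qed.

Lemma conj_le1 : 1 - 2 / p <= 1.
Proof. by rewrite lerBlDr lerDl divr_ge0 // ltW. Qed.

Lemma powRK2p (A : R) : 0 <= A -> (A `^ (2 / p)) `^ (p / 2) = A.
Proof.
by move=> A0; rewrite -powRrM mulrA divfK // divff ?pnatr_eq0 // powRr1.
Qed.

Lemma sqr_powRp (x : R) : 0 <= x -> (x ^+ 2) `^ (p / 2) = x `^ p.
Proof.
by move=> x0; rewrite -powR_mulrn // -powRrM mulrC divfK // pnatr_eq0.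
Qed.

(** Young's inequality with exponents [p / 2] and its conjugate [t / 2], where
    [2 / t = 1 - 2 / p]; the parameter [A] makes the integrated form sharp. *)
Lemma young_sqr (A x b : R) : 0 < A -> 0 <= x -> 0 <= b ->
  x ^+ 2 * b `^ (1 - 2 / p) <=
  A `^ (2 / p) * (2 / p / A) * x `^ p + A `^ (2 / p) * (1 - 2 / p) * b.
Proof.
move=> A0 x0 b0; have s0 := conj_gt0.
have B0 : 0 < A `^ (2 / p) by rewrite powR_gt0.
have e1 : (x ^+ 2 / A `^ (2 / p)) `^ (p / 2) = x `^ p / A.
  rewrite powRM ?sqr_ge0 ?invr_ge0 ?(ltW B0) // sqr_powRp //; congr (_ * _).
  by rewrite -powR_inv1 ?powR_ge0 // powRAC powRK2p ?(ltW A0) // powR_inv1 // ltW.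
have e2 : (b `^ (1 - 2 / p)) `^ (1 - 2 / p)^-1 = b.
  by rewrite -powRrM divff ?gt_eqF // powRr1.
have := @conjugate_powR R (x ^+ 2 / A `^ (2 / p)) (b `^ (1 - 2 / p)) (p / 2) (1 - 2 / p)^-1.
rewrite e1 e2 invf_div invrK => h.
have {}h := h (divr_ge0 (sqr_ge0 _) (ltW B0)) (powR_ge0 _ _) (divr_gt0 p0 (ltr0n _ 2)) _ _.
have {}h : x ^+ 2 / A `^ (2 / p) * b `^ (1 - 2 / p) <= x `^ p / A * (2 / p) + b * (1 - 2 / p).
  by apply: h; rewrite ?invr_gt0 // addrC subrK.
have -> : x ^+ 2 * b `^ (1 - 2 / p) =
   A `^ (2 / p) * (x ^+ 2 / A `^ (2 / p) * b `^ (1 - 2 / p)).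
  by field; rewrite gt_eqF.
apply: (@le_trans _ _ (A `^ (2 / p) * (x `^ p / A * (2 / p) + b * (1 - 2 / p)))).
  by rewrite ler_pM2l.
by rewrite le_eqVlt; apply/orP; left; apply/eqP; ring.
Qed.

(** Integrating [young_sqr] with [A] the mean of [v^p] is Hoelder's inequality with
    the sharp constant; other values of [A] are allowed so that upper bounds of
    that mean can be used directly. *)
Lemma holder_mean (v u : R -> R) (A : R) : bmeas v -> bmeas u ->
  (forall x, 0 <= v x) -> (forall x, 0 <= u x) -> 0 < A ->
  mean (fun x => v x `^ p) <= A -> mean u <= 1 ->
  mean (fun x => v x ^+ 2 * u x `^ (1 - 2 / p)) <= A `^ (2 / p).
Proof.
move=> bv bu v0 u0 A0 vA u1; have s0 := conj_gt0.
have bp : bmeas (fun x => v x `^ p) by apply: bmeas_powR => //; exact: ltW.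
have b1 : bmeas (fun x => (2 / p / A) * v x `^ p) by exact: bmeasZ.
have b2 : bmeas (fun x => (1 - 2 / p) * u x) by exact: bmeasZ.
apply: (@le_trans _ _ (mean (fun x => A `^ (2 / p) *
   ((2 / p / A) * v x `^ p + (1 - 2 / p) * u x)))).
  apply: le_mean => [||x].
  - by apply: bmeasM; [exact: bmeasX|apply: bmeas_powR => //; exact: ltW].
  - by apply: bmeasZ; exact: bmeasD.
  - by rewrite mulrDr (mulrA _ (2 / p / A)) (mulrA _ (1 - 2 / p)); exact: young_sqr.
rewrite meanZ; last exact: bmeasD.
rewrite meanD // !meanZ // -[leRHS]mulr1 ler_wpM2l ?powR_ge0 //.
have h1 : 2 / p / A * mean (fun x => v x `^ p) <= 2 / p / A * A.
  by rewrite ler_wpM2l // !divr_ge0 // ltW.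
have h2 : (1 - 2 / p) * mean u <= (1 - 2 / p) * 1 by rewrite ler_wpM2l // ltW.
by rewrite divfK ?gt_eqF // in h1; lra.
Qed.

End Young.

(** * The symbol on the circle and the energy of a Poisson mixture *)

Section KernelX.
Context {R : realType}.
Variables (p : R) (M N L : nat) (d : R).
Hypotheses (hp : 2 < p) (hM : (2 <= M)%N) (hN : (2 <= N)%N) (hd : 0 < d).

Let p0 : 0 < p. Proof. by apply: lt_trans hp. Qed.
Let pn : p != 0. Proof. by rewrite gt_eqF. Qed.
Let M0 : 0 < M%:R :> R. Proof. by rewrite ltr0n (leq_trans _ hM). Qed.
Let N0 : (0 < N)%N. Proof. by rewrite (leq_trans _ hN). Qed.
Let N0R : 0 < N%:R :> R. Proof. by rewrite ltr0n. Qed.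

Let t : R := 2 * p / (p - 2).

Lemma conj_exponent_gt0 : 0 < t.
Proof. by rewrite divr_gt0 ?mulr_gt0 // subr_gt0. Qed.

Lemma two_div_t : 2 / t = 1 - 2 / p.
Proof.
have h : p - 2 != 0 by rewrite gt_eqF // subr_gt0.
by rewrite /t; field; rewrite ?pn ?h.
Qed.

Lemma inv_t : t^-1 = (1 - 2 / p) / 2.
Proof. by rewrite -two_div_t; field; rewrite gt_eqF // conj_exponent_gt0. Qed.

Local Notation X := (Xpoly M N L d).
Definition absX (x : R) := cabs (X (expi x)).

Lemma absXE x : absX x = d / Num.sqrt M%:R * cabs (dirichlet M (expi x ^+ N)).
Proof.
rewrite /absX /Xpoly !cabsM cabsX cabs_expi expr1n mulr1 cabsC ger0_norm //.
by rewrite divr_ge0 ?sqrtr_ge0 // ltW.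
Qed.

Lemma absX_ge0 x : 0 <= absX x.
Proof. exact: cabs_ge0. Qed.

Lemma sqr_absX x : absX x ^+ 2 = d ^+ 2 / M%:R * cabs (dirichlet M (expi x ^+ N)) ^+ 2.
Proof. by rewrite absXE exprMn expr_div_n sqr_sqrtr // ltW. Qed.

Lemma absX_le x : absX x <= d * Num.sqrt M%:R.
Proof.
rewrite absXE; have s0 : 0 < Num.sqrt M%:R :> R by rewrite sqrtr_gt0.
have -> : d * Num.sqrt M%:R = d / Num.sqrt M%:R * M%:R.
  by rewrite -[in X in _ = _ * X](sqr_sqrtr (ltW M0)) expr2; field; rewrite gt_eqF.
rewrite ler_wpM2l ?divr_ge0 ?(ltW hd) ?(ltW s0) //.
by rewrite cabs_dirichlet_le // cabsX cabs_expi expr1n.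
Qed.

Lemma cbmeas_X : cbmeas (fun x => X (expi x)).
Proof.
apply: cbmeasM.
  by apply: cbmeasZ; exact/cbmeasX/cbmeas_expi.
by apply: cbmeas_sum => k; apply: cbmeasX; exact/cbmeasX/cbmeas_expi.
Qed.

Lemma bmeas_absX : bmeas absX.
Proof. exact: cbmeas_cabs cbmeas_X. Qed.

Lemma bmeas_sqr_absX : bmeas (fun x => absX x ^+ 2).
Proof. exact: bmeasX bmeas_absX. Qed.

Lemma bmeas_absXp : bmeas (fun x => absX x `^ p).
Proof. by apply: bmeas_powR; [exact: bmeas_absX|exact: ltW]. Qed.

Lemma mean_absX_poisson a : cabs a < 1 ->
  mean (fun x => absX x ^+ 2 * poisson a (expi x)) =
  d ^+ 2 / M%:R * complex.Re (fejer M (a ^+ N)).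
Proof.
move=> a1; rewrite -mean_sqr_dirichlet_poisson // -meanZ.
  by apply: eq_mean => x; rewrite sqr_absX mulrA.
have -> : (fun x : R => cabs (dirichlet M (expi x ^+ N)) ^+ 2 * poisson a (expi x)) =
   (fun x => (M%:R / d ^+ 2) * (absX x ^+ 2 * poisson a (expi x))).
  by apply: funext => x; rewrite sqr_absX; field; rewrite !gt_eqF.
by apply: bmeasZ; apply: bmeasM; [exact: bmeas_sqr_absX|exact: bmeas_poisson].
Qed.

Lemma mean_sqr_absX : mean (fun x => absX x ^+ 2) = d ^+ 2.
Proof.
have c0 : cabs (0 : R[i]) < 1 by rewrite cabs0.
have := mean_absX_poisson c0.
under eq_mean do rewrite poisson0 mulr1.
have -> : (0 : R[i]) ^+ N = 0 by rewrite expr0n gtn_eqF.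
move=> ->; rewrite /fejer Re_sum.
rewrite (eq_bigr (fun _ => 1)) => [|k _]; last first.
  by rewrite dirichletS mul0r addr0 (_ : 2 * 1 - 1 = 1) //; ring.
by rewrite sumr_const card_ord divfK // gt_eqF.
Qed.

Lemma mean_absX_poisson_le a : cabs (a ^+ N) <= 2^-1 -> cabs a < 1 ->
  mean (fun x => absX x ^+ 2 * poisson a (expi x)) <= 5 * d ^+ 2.
Proof.
move=> aN a1; rewrite mean_absX_poisson //.
have -> : 5 * d ^+ 2 = d ^+ 2 / M%:R * (5 * M%:R) by field; rewrite gt_eqF.
rewrite ler_wpM2l ?divr_ge0 ?sqr_ge0 ?(ltW M0) //.
apply: le_trans (ler_norm _) _; apply: le_trans (Re_le_cabs _) _.
exact: cabs_fejer_le.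
Qed.

(** The expected size of [X] in [L^p]. *)
Definition sizeX : R := d * M%:R `^ t^-1.

Lemma sizeX_gt0 : 0 < sizeX.
Proof. by rewrite mulr_gt0 // powR_gt0. Qed.

Lemma sqr_sizeX : sizeX ^+ 2 = d ^+ 2 * M%:R `^ (1 - 2 / p).
Proof.
rewrite /sizeX exprMn; congr (_ * _).
rewrite -powR_mulrn ?powR_ge0 // -powRrM inv_t divfK //.
Qed.

(** [|X|] is at most [d sqrt M], so the [p]-th power costs at most [p - 2] factors
    of this bound over the square, whose mean is known. *)
Lemma absXp_le x : absX x `^ p <= (d * Num.sqrt M%:R) `^ (p - 2) * absX x ^+ 2.
Proof.
have -> : absX x `^ p = absX x `^ (p - 2) * absX x ^+ 2.
  rewrite -powR_mulrn ?absX_ge0 // -powRD ?subrK //.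
  by rewrite gt_eqF.
rewrite ler_wpM2r ?sqr_ge0 // ge0_ler_powR ?nnegrE ?absX_ge0 ?absX_le //.
  by rewrite subr_ge0 ltW.
by rewrite mulr_ge0 ?sqrtr_ge0 // ltW.
Qed.

Lemma sizeXp : (d * Num.sqrt M%:R) `^ (p - 2) * d ^+ 2 = sizeX `^ p.
Proof.
rewrite /sizeX !powRM ?sqrtr_ge0 ?powR_ge0 ?(ltW hd) //.
rewrite -powR12_sqrt ?(ltW M0) // -!powRrM inv_t.
rewrite mulrAC -(powR_mulrn _ (ltW hd)) -powRD ?subrK; last by rewrite ?subrK (negbTE pn).
congr (_ * _ `^ _); field; exact: pn.
Qed.

Lemma mean_absXp_le : mean (fun x => absX x `^ p) <= sizeX `^ p.
Proof.
rewrite -sizeXp -mean_sqr_absX -meanZ; last exact: bmeas_sqr_absX.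
apply: le_mean => [||x]; [exact: bmeas_absXp| |exact: absXp_le].
exact: bmeasZ bmeas_sqr_absX.
Qed.

Section PoissonSum.
Variables (K : nat) (a : 'I_K -> R[i]) (c : 'I_K -> R).
Hypotheses (a1 : forall i, cabs (a i) < 1) (c0 : forall i, 0 <= c i)
  (c1 : \sum_(i < K) c i = 1).

Definition psum (x : R) := \sum_(i < K) c i * poisson (a i) (expi x).

Lemma psum_ge0 x : 0 <= psum x.
Proof. by apply: poisson_sum_ge0 => //; rewrite cabs_expi. Qed.

Lemma bmeas_psum : bmeas psum.
Proof. by apply: bmeas_sum => i; apply: bmeasZ; exact: bmeas_poisson. Qed.

Lemma mean_psum : mean psum = 1.
Proof.
rewrite -[RHS]c1 mean_sum => [|i]; last by apply: bmeasZ; exact: bmeas_poisson.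
apply: eq_bigr => i _; rewrite meanZ ?mean_poisson ?mulr1 //.
exact: bmeas_poisson.
Qed.

(** [|X h|^2] integrated, for an [h] whose modulus to the power [t] is [psum]. *)
Definition energy := mean (fun x => absX x ^+ 2 * psum x `^ (1 - 2 / p)).

Lemma bmeas_energy : bmeas (fun x => absX x ^+ 2 * psum x `^ (1 - 2 / p)).
Proof.
apply: bmeasM; first exact: bmeas_sqr_absX.
apply: bmeas_powR; [exact: bmeas_psum|exact: ltW (conj_gt0 hp)].
Qed.

Lemma energy_le_Lp (A : R) : 0 < A -> mean (fun x => absX x `^ p) <= A ->
  energy <= A `^ (2 / p).
Proof.
move=> A0 hA; apply: holder_mean => //.
- exact: bmeas_absX.
- exact: bmeas_psum.
- exact: absX_ge0.
- exact: psum_ge0.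
- by rewrite mean_psum.
Qed.

Lemma powR_2p (A : R) : 0 <= A -> (A `^ p) `^ (2 / p) = A ^+ 2.
Proof. by move=> A0; rewrite -powRrM mulrC divfK // powR_mulrn. Qed.

Lemma energy_le_sizeX : energy <= sizeX ^+ 2.
Proof.
rewrite -powR_2p ?(ltW sizeX_gt0) //; apply: energy_le_Lp.
  by rewrite powR_gt0 // sizeX_gt0.
exact: mean_absXp_le.
Qed.

Let b i := retract N (a i).
Let b1 i : cabs (b i) < 1. Proof. exact: cabs_retract_lt1. Qed.

Let y : R := M%:R `^ t^-1 * (K%:R / N%:R) `^ p^-1.

Hypothesis K0 : (0 < K)%N.

(** Let [v] be the sum and [u'] the [c]-mixture of the Poisson kernels at the
    retracted poles. At each point either [psum <= 4 u'] or [4 v / N >= 1], by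
    [poisson_retract]. In the first case [psum^(2/t) <= 1 + 4 u'], and the mean
    of [|X|^2 u'] is [O(d^2)] because [|D_M|^2] has mean [O(M)] against a
    retracted kernel. In the second case insert the factor
    [(4 v / N)^(2/p) >= 1] and apply Hoelder; it remains to bound the mean of
    [|X|^p v], which is at most [(d sqrt M)^(p-2)] times that of [|X|^2 v].
    The latter is [O(K d^2)], and dividing by [N] produces [K / N]. *)
Lemma energy_le_poles : energy <= (5 * (d * (1 + y))) ^+ 2.
Proof.
have s0 := conj_gt0 hp; have s1 := conj_le1 hp.
pose u' x := \sum_(i < K) c i * poisson (b i) (expi x).
pose v x := \sum_(i < K) poisson (b i) (expi x).
have bP i : bmeas (fun x => poisson (b i) (expi x)) by exact: bmeas_poisson.
have bu : bmeas u' by apply: bmeas_sum => i; exact: bmeasZ.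
have bv : bmeas v by exact: bmeas_sum.
have P0 i x : 0 <= poisson (b i) (expi x) by rewrite ltW // poisson_gt0 // cabs_expi.
have v0 x : 0 <= v x by exact: sumr_ge0.
have u'0 x : 0 <= u' x by apply: sumr_ge0 => i _; rewrite mulr_ge0.
have dich x : psum x <= 4 * u' x \/ 1 <= 4 / N%:R * v x.
  have [[i hi]|H] := pselect (exists i, N%:R / 4 <= poisson (b i) (expi x)).
    right; rewrite mulrAC ler_pdivlMr // mul1r.
    have : poisson (b i) (expi x) <= v x.
      by rewrite /v (bigD1 i) //= lerDl sumr_ge0.
    by lra.
  left; rewrite mulr_sumr; apply: ler_sum => i _; rewrite [leRHS]mulrCA ler_wpM2l //.
  have [//|h] := poisson_retract N0 x (a1 i).
  by exfalso; apply: H; exists i.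
(* bound for the mean of [|X|^p * 4 v / N]: 4 from the dichotomy, 5 from the
   Fejer bound *)
pose Lam := 20 * (d * y) `^ p.
have KN0 : 0 < K%:R / N%:R :> R by rewrite divr_gt0 // ltr0n.
have y0 : 0 < y by rewrite mulr_gt0 ?powR_gt0.
have L0 : 0 < Lam by rewrite mulr_gt0 // powR_gt0 // mulr_gt0.
(* [w^2] carries the factor [(4 v / N)^(2/p)], [w^p] the factor [4 v / N] *)
pose w x := absX x * (4 / N%:R * v x) `^ p^-1.
have pV0 : 0 <= p^-1 by rewrite invr_ge0 ltW.
have bw : bmeas w.
  by apply: bmeasM; [exact: bmeas_absX|apply: bmeas_powR => //; exact: bmeasZ].
have w0 x : 0 <= w x by rewrite mulr_ge0 ?absX_ge0 ?powR_ge0.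
have v40 x : 0 <= 4 / N%:R * v x by rewrite mulr_ge0 // divr_ge0.
have wp x : w x `^ p = absX x `^ p * (4 / N%:R * v x).
  by rewrite powRM ?powR_ge0 ?absX_ge0 // -powRrM mulVf // powRr1.
have w2 x : w x ^+ 2 = absX x ^+ 2 * (4 / N%:R * v x) `^ (2 / p).
  rewrite exprMn; congr (_ * _); rewrite -(powR_mulrn 2 (powR_ge0 _ _)) -powRrM.
  by congr (_ `^ _); rewrite mulrC.
have bVP i : bmeas (fun x => absX x ^+ 2 * poisson (b i) (expi x)).
  exact: bmeasM bmeas_sqr_absX (bP i).
have hVP i : mean (fun x => absX x ^+ 2 * poisson (b i) (expi x)) <= 5 * d ^+ 2.
  by apply: mean_absX_poisson_le => //; exact: cabs_retractX.
have hLam : mean (fun x => w x `^ p) <= Lam.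
  apply: (@le_trans _ _ (mean (fun x => (d * Num.sqrt M%:R) `^ (p - 2) * (4 / N%:R) *
     \sum_(i < K) (absX x ^+ 2 * poisson (b i) (expi x))))).
    apply: le_mean => [||x].
    - by apply: bmeas_powR => //; exact: ltW.
    - by apply: bmeasZ; exact: bmeas_sum.
    rewrite wp -mulr_sumr -/(v x).
    rewrite (_ : _ * (absX x ^+ 2 * v x) =
        (d * Num.sqrt M%:R) `^ (p - 2) * absX x ^+ 2 * (4 / N%:R * v x)).
      by rewrite ler_wpM2r // absXp_le.
    by ring.
  rewrite meanZ; last exact: bmeas_sum.
  rewrite mean_sum //.
  have : \sum_(i < K) mean (fun x => absX x ^+ 2 * poisson (b i) (expi x)) <= K%:R * (5 * d ^+ 2).
    rewrite [leRHS]mulr_natl -[K in leRHS]card_ord -sumr_const.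
    by apply: ler_sum => i _; exact: hVP.
  move=> h; apply: (@le_trans _ _ ((d * Num.sqrt M%:R) `^ (p - 2) * (4 / N%:R) * (K%:R * (5 * d ^+ 2)))).
    by rewrite ler_wpM2l // mulr_ge0 ?powR_ge0 // divr_ge0.
  rewrite (_ : _ * _ = 20 * ((d * Num.sqrt M%:R) `^ (p - 2) * d ^+ 2) * (K%:R / N%:R)); last by ring.
  have e : (d * y) `^ p = sizeX `^ p * (K%:R / N%:R).
    have -> : d * y = sizeX * (K%:R / N%:R) `^ p^-1 by rewrite /y /sizeX mulrA.
    rewrite powRM ?powR_ge0 ?(ltW sizeX_gt0) //; congr (_ * _).
    by rewrite -powRrM mulVf // powRr1 // ltW.
  by rewrite sizeXp /Lam e mulrA.
have bs : bmeas (fun x => psum x `^ (1 - 2 / p)).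
  by apply: bmeas_powR; [exact: bmeas_psum|exact: ltW].
have hw := holder_mean hp bw bmeas_psum w0 psum_ge0 L0 hLam _.
have {}hw : mean (fun x => w x ^+ 2 * psum x `^ (1 - 2 / p)) <= Lam `^ (2 / p).
  by apply: hw; rewrite mean_psum.
have bw2 : bmeas (fun x => w x ^+ 2 * psum x `^ (1 - 2 / p)).
  by apply: bmeasM => //; exact: bmeasX.
have bX := bmeas_sqr_absX.
have b2 : bmeas (fun x => 4 * \sum_(i < K) c i * (absX x ^+ 2 * poisson (b i) (expi x))).
  by apply: bmeasZ; apply: bmeas_sum => i; exact: bmeasZ.
have key : energy <= mean (fun x => absX x ^+ 2 +
    4 * \sum_(i < K) c i * (absX x ^+ 2 * poisson (b i) (expi x)) +
    w x ^+ 2 * psum x `^ (1 - 2 / p)).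
  apply: le_mean => [||x]; first exact: bmeas_energy.
    by apply: bmeasD => //; exact: bmeasD.
  have -> : \sum_(i < K) c i * (absX x ^+ 2 * poisson (b i) (expi x)) = absX x ^+ 2 * u' x.
    by rewrite mulr_sumr; apply: eq_bigr => i _; rewrite mulrCA.
  have x2 := sqr_ge0 (absX x).
  have us : psum x `^ (1 - 2 / p) <= 1 + psum x.
    have [h|h] := leP 1 (psum x).
      by apply: le_trans (ler1_powR h s1) _; lra.
    have := psum_ge0 x; move=> h0.
    have : psum x `^ (1 - 2 / p) <= 1 `^ (1 - 2 / p).
      by apply: ge0_ler_powR; rewrite ?nnegrE ?(ltW h) ?(ltW s0).
    by rewrite powR1; lra.
  have us0 : 0 <= psum x `^ (1 - 2 / p) := powR_ge0 _ _.
  case: (dich x) => h.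
    have h1 : absX x ^+ 2 * psum x `^ (1 - 2 / p) <= absX x ^+ 2 * (1 + 4 * u' x).
      by rewrite ler_wpM2l //; lra.
    have h2 : 0 <= w x ^+ 2 * psum x `^ (1 - 2 / p) by rewrite mulr_ge0 ?sqr_ge0.
    by rewrite mulrDr mulr1 in h1; lra.
  have h1 : 1 <= (4 / N%:R * v x) `^ (2 / p).
    have : 1 `^ (2 / p) <= (4 / N%:R * v x) `^ (2 / p).
      by apply: ge0_ler_powR; rewrite ?nnegrE // divr_ge0 // ltW.
    by rewrite powR1.
  have h2 : absX x ^+ 2 * psum x `^ (1 - 2 / p) <= w x ^+ 2 * psum x `^ (1 - 2 / p).
    by rewrite ler_wpM2r // w2 ler_peMr.
  have h3 : 0 <= absX x ^+ 2 * u' x by rewrite mulr_ge0.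
  by lra.
apply: le_trans key _.
rewrite meanD //; last exact: bmeasD.
rewrite meanD // mean_sqr_absX meanZ; last by apply: bmeas_sum => i; exact: bmeasZ.
have h4 : mean (fun x => \sum_(i < K) c i * (absX x ^+ 2 * poisson (b i) (expi x))) <= 5 * d ^+ 2.
  rewrite mean_sum => [|i]; last exact: bmeasZ.
  rewrite -[leRHS]mul1r -[X in _ <= X * _]c1 mulr_suml; apply: ler_sum => i _.
  by rewrite meanZ // ler_wpM2l.
have h5 : Lam `^ (2 / p) <= 20 * (d * y) ^+ 2.
  rewrite /Lam powRM ?powR_ge0 // powR_2p; last by rewrite mulr_ge0 ?(ltW hd) ?(ltW y0).
  rewrite ler_wpM2r ?sqr_ge0 // ler1_powR //; first by rewrite (ler_nat R 1 20).
  by rewrite ler_pdivrMr // mul1r ltW.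
have h6 : 0 <= d ^+ 2 * y by rewrite mulr_ge0 ?sqr_ge0 ?(ltW y0).
have h7 : 0 <= d ^+ 2 * y ^+ 2 by rewrite mulr_ge0 ?sqr_ge0.
have h8 : (d * y) ^+ 2 = d ^+ 2 * y ^+ 2 by rewrite exprMn.
have h9 : (5 * (d * (1 + y))) ^+ 2 = 25 * (d ^+ 2 + 2 * (d ^+ 2 * y) + d ^+ 2 * y ^+ 2) by ring.
rewrite h8 in h5; rewrite h9; have := sqr_ge0 d.
by lra.
Qed.

End PoissonSum.
End KernelX.

(** * Poles with large energy *)

Section LowerBound.
Context {R : realType}.
Variables (p : R) (M N L : nat) (d : R).
Hypotheses (hp : 2 < p) (hM : (2 <= M)%N) (hN : (2 <= N)%N) (hd : 0 < d).

Let p0 : 0 < p. Proof. by apply: lt_trans hp. Qed.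
Let pn : p != 0. Proof. by rewrite gt_eqF. Qed.
Let M0 : 0 < M%:R :> R. Proof. by rewrite ltr0n (leq_trans _ hM). Qed.
Let N0 : (0 < N)%N. Proof. by rewrite (leq_trans _ hN). Qed.
Let N0R : 0 < N%:R :> R. Proof. by rewrite ltr0n. Qed.

Let t : R := 2 * p / (p - 2).

(** Put [K' = min K N] equal masses at [r omega^k], [k < K'], where [omega] is a
    primitive [N]-th root of unity and [r^N = 1 - 1 / (2 M)]. All these poles
    give the same mean of [|X|^2 P_a], of order [d^2 M], while the mixture [u]
    is at most a multiple of [M N / K'], since completing the poles to all [N]
    of them gives [sum_poisson_roots]. Finally
    [u <= sup(u)^(2/p) u^(1 - 2/p)]. *)
Lemma exists_energy_ge K : (0 < K)%N ->
  exists (a : 'I_K -> R[i]) (c : 'I_K -> R),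
    [/\ forall i, cabs (a i) < 1, forall i, 0 <= c i, \sum_(i < K) c i = 1 &
      (d * (M%:R `^ t^-1 * Num.min 1 ((K%:R / N%:R) `^ p^-1)) / 4) ^+ 2 <=
      energy p M N L d a c].
Proof.
move=> K0; pose K' := minn K N.
have K'0 : (0 < K')%N by rewrite leq_min K0 N0.
have KK : (K' <= K)%N by exact: geq_minl.
have KN' : (K' <= N)%N by exact: geq_minr.
have K'R : 0 < K'%:R :> R by rewrite ltr0n.
pose q : R := 1 - (2 * M%:R)^-1.
have i0 : 0 < (2 * M%:R)^-1 :> R by rewrite invr_gt0 mulr_gt0.
have i1 : (2 * M%:R)^-1 <= 2^-1 :> R.
  rewrite lef_pV2 ?posrE ?mulr_gt0 // -[leLHS]mulr1 ler_pM2l // ler1n.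
  exact: ltnW.
have q0 : 0 < q by rewrite /q; lra.
have q1 : q < 1 by rewrite /q; lra.
pose r : R := q `^ N%:R^-1.
have rN : r ^+ N = q.
  by rewrite -powR_mulrn ?powR_ge0 // -powRrM mulVf ?gt_eqF // powRr1 // ltW.
have r0 : 0 <= r by exact: powR_ge0.
have r1 : r < 1.
  rewrite ltNge; apply/negP => h; have := exprn_ege1 N h; rewrite rN; lra.
pose a (i : 'I_K) : R[i] := r%:C * @unity_root R N ^+ i.
pose c (i : 'I_K) : R := if (i < K')%N then K'%:R^-1 else 0.
have a1 i : cabs (a i) < 1.
  by rewrite cabsM cabs_unity_root mulr1 cabsC ger0_norm.
have c0 i : 0 <= c i by rewrite /c; case: ifP => // _; rewrite invr_ge0 ltW.
have sumc (F : nat -> R) : \sum_(i < K) c i * F i = K'%:R^-1 * \sum_(i < K') F i.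
  rewrite (big_ord_widen K F KK) [X in _ * X]big_mkcond mulr_sumr.
  by apply: eq_bigr => i _; rewrite /c; case: ifP => _; rewrite ?mul0r ?mulr0.
have c1 : \sum_(i < K) c i = 1.
  transitivity (\sum_(i < K) c i * 1); first by apply: eq_bigr => i _; rewrite mulr1.
  by rewrite (sumc (fun=> 1)) sumr_const card_ord mulVf // gt_eqF.
exists a, c; split => //.
have s0 := conj_gt0 hp; have s1 := conj_le1 hp.
have t2 : 0 < 2 / p by rewrite divr_gt0.
pose kap : R := K'%:R / N%:R.
have kap0 : 0 < kap by exact: divr_gt0.
(* [2 N / (1 - r^N)] from the roots of unity, divided by [K'] *)
pose U : R := 4 * M%:R / kap.
have U0 : 0 < U by apply: divr_gt0 => //; apply: mulr_gt0.
have uU x : psum a c x <= U.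
  rewrite /psum (sumc (fun i => poisson (r%:C * @unity_root R N ^+ i) (expi x))).
  have -> : U = K'%:R^-1 * (4 * M%:R * N%:R).
    by rewrite /U /kap; field; rewrite !gt_eqF.
  rewrite ler_wpM2l ?invr_ge0 ?(ltW K'R) //.
  have r01 : 0 <= r < 1 by rewrite r0.
  have h := sum_poisson_roots N0 x r01.
  have -> : 4 * M%:R * N%:R = 2 * N%:R / (1 - r ^+ N) :> R.
    by rewrite rN /q subKr invrK; ring.
  apply: le_trans h; rewrite (big_ord_widen N (fun i => poisson (r%:C * @unity_root R N ^+ i) (expi x)) KN').
  rewrite [leLHS]big_mkcond; apply: ler_sum => i _; case: ifP => // _.
  by rewrite ltW // poisson_gt0 ?cabs_expi // cabsM cabs_unity_root mulr1 cabsC ger0_norm.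
have bX := bmeas_sqr_absX M N L d.
have bu : bmeas (psum a c) := bmeas_psum c a1.
have u0 := psum_ge0 a1 c0.
have hmean : d ^+ 2 * M%:R / 4 <= mean (fun x => absX M N L d x ^+ 2 * psum a c x).
  have e x : absX M N L d x ^+ 2 * psum a c x =
     \sum_(i < K) c i * (absX M N L d x ^+ 2 * poisson (a i) (expi x)).
    by rewrite mulr_sumr; apply: eq_bigr => i _; rewrite mulrCA.
  under eq_mean do rewrite e.
  have bi i : bmeas (fun x => absX M N L d x ^+ 2 * poisson (a i) (expi x)).
    by apply: bmeasM => //; exact: bmeas_poisson.
  rewrite mean_sum => [|i]; last exact: bmeasZ.
  rewrite -[leLHS]mul1r -[X in X * _ <= _]c1 mulr_suml; apply: ler_sum => i _.
  rewrite meanZ // ler_wpM2l // mean_absX_poisson //.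
  have -> : a i ^+ N = q%:C.
    rewrite exprMn -exprM mulnC exprM unity_rootX // expr1n mulr1.
    by rewrite -rN rmorphXn.
  have -> : d ^+ 2 * M%:R / 4 = d ^+ 2 / M%:R * (M%:R ^+ 2 / 4) by field; rewrite gt_eqF.
  by rewrite ler_wpM2l ?divr_ge0 ?sqr_ge0 ?(ltW M0) // Re_fejer_ge // ltnW.
have hE : mean (fun x => absX M N L d x ^+ 2 * psum a c x) <= U `^ (2 / p) * energy p M N L d a c.
  rewrite /energy -meanZ; last exact: bmeas_energy.
  apply: le_mean => [||x]; first exact: bmeasM.
    by apply: bmeasZ; exact: bmeas_energy.
  rewrite mulrCA ler_wpM2l ?sqr_ge0 //.
  have hs : 2 / p + (1 - 2 / p) = 1 by rewrite addrC subrK.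
  rewrite -[leLHS]powRr1 // -[X in _ `^ X]hs powRD ?hs ?oner_eq0 //.
  rewrite ler_wpM2r ?powR_ge0 // ge0_ler_powR ?nnegrE ?(ltW t2) ?(ltW U0) //.
have UE0 : 0 < U `^ (2 / p) by rewrite powR_gt0.
rewrite -(ler_pM2l UE0); apply: le_trans hE; apply: le_trans hmean.
have -> : Num.min 1 ((K%:R / N%:R) `^ p^-1) = kap `^ p^-1.
  have [KN|NK] := leqP K N.
    rewrite /kap /K' (minn_idPl KN); apply/min_idPr.
    have : (K%:R / N%:R) `^ p^-1 <= 1 `^ p^-1 :> R.
      rewrite ge0_ler_powR ?nnegrE ?invr_ge0 ?divr_ge0 ?(ltW p0) //.
      by rewrite ler_pdivrMr // mul1r ler_nat.
    by rewrite powR1.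
  rewrite /kap /K' (minn_idPr (ltnW NK)) divff ?gt_eqF // powR1; apply/min_idPl.
  have : 1 `^ p^-1 <= (K%:R / N%:R) `^ p^-1 :> R.
    rewrite ge0_ler_powR ?nnegrE ?invr_ge0 ?divr_ge0 ?(ltW p0) //.
    by rewrite ler_pdivlMr // mul1r ler_nat ltnW.
  by rewrite powR1.
have e1 : (d * (M%:R `^ t^-1 * kap `^ p^-1) / 4) ^+ 2 =
   d ^+ 2 * M%:R `^ (1 - 2 / p) * kap `^ (2 / p) / 16.
  have h1 : (kap `^ p^-1) ^+ 2 = kap `^ (2 / p).
    by rewrite -powR_mulrn ?powR_ge0 // -powRrM mulrC.
  have h2 := sqr_sizeX M d hp; rewrite /sizeX -/t exprMn in h2.
  rewrite -h1 -h2; set A := M%:R `^ _; set B := kap `^ _; by field.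
have e2 : U `^ (2 / p) = 4 `^ (2 / p) * M%:R `^ (2 / p) / kap `^ (2 / p).
  rewrite /U powRM ?invr_ge0 ?mulr_ge0 ?(ltW kap0) //.
  rewrite powRM //; congr (_ * _).
  by rewrite -powR_inv1 ?(ltW kap0) // powRAC powR_inv1 // powR_ge0.
have k0 : 0 < kap `^ (2 / p) by rewrite powR_gt0.
rewrite e1 e2.
have e3 : M%:R `^ (2 / p) * M%:R `^ (1 - 2 / p) = M%:R :> R.
  have hs : 2 / p + (1 - 2 / p) = 1 by rewrite addrC subrK.
  by rewrite -powRD hs ?oner_eq0 // powRr1.
rewrite [leLHS](_ : _ = 4 `^ (2 / p) * (d ^+ 2 * (M%:R `^ (2 / p) * M%:R `^ (1 - 2 / p))) / 16); last first.
  by field; rewrite gt_eqF.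
rewrite e3.
have h4 : 4 `^ (2 / p) <= 4 :> R.
  by rewrite ler1_powR ?(ler_nat R 1 4) // ler_pdivrMr // mul1r ltW.
have h5 : 4 `^ (2 / p) * (d ^+ 2 * M%:R) <= 4 * (d ^+ 2 * M%:R).
  by rewrite ler_wpM2r // mulr_ge0 ?sqr_ge0 // ltW.
by lra.
Qed.

End LowerBound.

(** * The multiplication operator *)

Section Multiplier.
Context {R : realType}.
Variables (p : R) (M N L : nat) (d : R).
Hypotheses (hp : 2 < p) (hM : (2 <= M)%N) (hN : (2 <= N)%N) (hd : 0 < d).

Let p0 : 0 < p. Proof. by apply: lt_trans hp. Qed.
Let pn : p != 0. Proof. by rewrite gt_eqF. Qed.
Let M0 : 0 < M%:R :> R. Proof. by rewrite ltr0n (leq_trans _ hM). Qed.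

Let t : R := 2 * p / (p - 2).
Let t0 : 0 < t. Proof. exact: conj_exponent_gt0. Qed.
Let tn : t != 0. Proof. by rewrite gt_eqF. Qed.
Let t2 : 2 / t = 1 - 2 / p. Proof. exact: two_div_t. Qed.

Local Notation X := (Xpoly M N L d).
Local Notation absX := (absX M N L d).
Local Notation A := (mean (fun x => absX x `^ p)).

Lemma circle_norm_X : circle_norm p X = (A `^ p^-1)%:E.
Proof. by rewrite circle_norm_mean //; exact: bmeas_absXp. Qed.

Lemma sqr_powRt (x : R) : 0 <= x -> x ^+ 2 = (x `^ t) `^ (1 - 2 / p).
Proof.
move=> x0; rewrite -t2 -powRrM mulrC divfK // powR_mulrn //.
Qed.

Lemma cabs_mul_X (h : R[i] -> R[i]) x :
  cabs (mul_op X h (expi x)) `^ 2 = absX x ^+ 2 * cabs (h (expi x)) ^+ 2.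
Proof. by rewrite powR_mulrn ?cabs_ge0 // /mul_op cabsM exprMn. Qed.

Lemma measurable_hardy (u : R) h : hardy u h ->
  measurable_fun setT (fun x : R => cabs (h (expi x))).
Proof. by case=> _ _ m1 m2 _; exact: measurable_cabs. Qed.

(** If the mean of [|X|^p] vanished, Hoelder with [u = 1] and a small
    enough bound would contradict the value [d^2] of the mean of [|X|^2]. *)
Lemma mean_absXp_gt0 : 0 < A.
Proof.
have A0 : 0 <= A by apply: mean_ge0 => x; exact: powR_ge0.
rewrite lt_def A0 andbT; apply/eqP => e.
have d2 : 0 < d ^+ 2 / 2 by rewrite divr_gt0 // exprn_gt0.
have B0 : 0 < (d ^+ 2 / 2) `^ (p / 2) by rewrite powR_gt0.
have := holder_mean hp (bmeas_absX M N L d) (bmeas_cst 1) (absX_ge0 M N L d)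
  (fun=> ler01) B0.
rewrite e (ltW B0) mean_cst => /(_ isT (lexx _)).
under eq_mean do rewrite powR1 mulr1.
rewrite mean_sqr_absX // -powRrM.
have -> : p / 2 * (2 / p) = 1 by field.
by rewrite powRr1 ?(ltW d2) //; move: d2; set D := d ^+ 2; lra.
Qed.

Section AdmissibleNorm.
Variables (K : nat) (a : 'I_K -> R[i]) (c : 'I_K -> R).
Hypotheses (a1 : forall i, cabs (a i) < 1) (c0 : forall i, 0 <= c i).

Lemma circle_norm_mul_calA h : hardy t h ->
  {ae haar R, forall x : R, cabs (h (expi x)) `^ t =
     \sum_(nu < K) c nu * poisson (a nu) (expi x)} ->
  circle_norm 2 (mul_op X h) = ((energy p M N L d a c) `^ 2^-1)%:E.
Proof.
move=> hh e; rewrite circle_normE ?pnatr_eq0 // -poweR_EFin; congr (_ `^ _)%E.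
rewrite /energy -integral_mean; last exact: bmeas_energy.
have mh := measurable_hardy hh.
have mX : measurable_fun setT (fun x => absX x ^+ 2) := (bmeas_sqr_absX M N L d).1.
apply: ae_eq_integral => //.
- apply/measurable_EFinP; under eq_fun do rewrite cabs_mul_X.
  by apply: measurable_funM => //; exact: measurable_funX.
- apply/measurable_EFinP.
  have bE : bmeas (fun x => absX x ^+ 2 * psum a c x `^ (1 - 2 / p)) by exact: bmeas_energy.
  exact: bE.1.
- rewrite /ae_eq; near=> x => _.
  have hx : cabs (h (expi x)) `^ t = \sum_(nu < K) c nu * poisson (a nu) (expi x).
    by near: x; exact: e.
  by rewrite cabs_mul_X (sqr_powRt (cabs_ge0 (h (expi x)))) hx.
Unshelve. all: by end_near.
Qed.

End AdmissibleNorm.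

(** Hoelder in the extended reals: only the norm of [h] is known to be finite, so
    [young_sqr] is integrated directly instead of going through bounded means. *)
Lemma circle_norm_mul_le h : hardy t h -> (circle_norm t h <= 1)%E ->
  (circle_norm 2 (mul_op X h) <= circle_norm p X)%E.
Proof.
move=> hh h1; have mh := measurable_hardy hh.
have A0 := mean_absXp_gt0; have s0 := conj_gt0 hp.
have ht : (\int[haar R]_x (cabs (h (expi x)) `^ t)%:E <= 1)%E.
  move: h1; rewrite circle_normE //.
  set I := (\int[haar R]_x _)%E => h1.
  have I0 : (0 <= I)%E by apply: integral_ge0 => x _; rewrite lee_fin powR_ge0.
  have : ((I `^ t^-1) `^ t <= 1 `^ t)%E.
    apply: gt0_ler_poweR => //; first exact: ltW.
      by rewrite in_itv /= poweR_ge0 leey.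
    by rewrite in_itv /= leey andbT.
  by rewrite -poweRrM mulVf // poweRe1 // poweR1r.
pose k1 := A `^ (2 / p) * (2 / p / A); pose k2 := A `^ (2 / p) * (1 - 2 / p).
have k10 : 0 <= k1 by rewrite mulr_ge0 ?powR_ge0 // !divr_ge0 // ltW.
have k20 : 0 <= k2 by rewrite mulr_ge0 ?powR_ge0 // ltW.
have mXp : measurable_fun setT (fun x => absX x `^ p) := (bmeas_absXp M N L d hp).1.
have mht : measurable_fun setT (fun x => cabs (h (expi x)) `^ t).
  exact: (measurableT_comp (measurable_powR t)).
have mX : measurable_fun setT (fun x => absX x ^+ 2) := (bmeas_sqr_absX M N L d).1.
have key : (\int[haar R]_x (cabs (mul_op X h (expi x)) `^ 2)%:E <= (A `^ (2 / p))%:E)%E.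
  apply: (@le_trans _ _ (\int[haar R]_x (k1 * absX x `^ p + k2 * cabs (h (expi x)) `^ t)%:E)%E).
    apply: ge0_le_integral => //.
    - by move=> x _; rewrite lee_fin powR_ge0.
    - apply/measurable_EFinP; under eq_fun do rewrite cabs_mul_X.
      by apply: measurable_funM => //; exact: measurable_funX.
    - apply/measurable_EFinP; apply: measurable_funD; exact: measurable_funM.
    - move=> x _; rewrite lee_fin cabs_mul_X (sqr_powRt (cabs_ge0 (h (expi x)))).
      exact: (young_sqr hp A0 (absX_ge0 M N L d x) (powR_ge0 (cabs (h (expi x))) t)).
  under eq_integral do rewrite EFinD.
  rewrite ge0_integralD //; last 4 first.
  - by move=> x _; rewrite lee_fin mulr_ge0 ?powR_ge0.
  - by apply/measurable_EFinP; apply: measurable_funM.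
  - by move=> x _; rewrite lee_fin mulr_ge0 ?powR_ge0.
  - by apply/measurable_EFinP; apply: measurable_funM.
  under [X in (X + _)%E]eq_integral do rewrite EFinM.
  under [X in (_ + X)%E]eq_integral do rewrite EFinM.
  rewrite ge0_integralZl //; last 2 first.
  - exact/measurable_EFinP.
  - by move=> x _; rewrite lee_fin powR_ge0.
  rewrite ge0_integralZl //; last 2 first.
  - exact/measurable_EFinP.
  - by move=> x _; rewrite lee_fin powR_ge0.
  rewrite (integral_mean (bmeas_absXp M N L d hp)).
  apply: (@le_trans _ _ (k1%:E * A%:E + k2%:E * 1)%E).
    by apply: leeD => //; apply: lee_wpmul2l.
  rewrite mule1 -EFinM -EFinD lee_fin /k1 /k2.
  by rewrite -(mulrA _ (2 / p / A)) (divfK (lt0r_neq0 A0)) -mulrDr addrC subrK mulr1.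
rewrite circle_normE ?pnatr_eq0 // circle_norm_X.
have -> : (A `^ p^-1)%:E = ((A `^ (2 / p))%:E `^ 2^-1)%E.
  rewrite poweR_EFin -powRrM; congr (_ `^ _)%:E.
  by field.
apply: gt0_ler_poweR => //.
- by rewrite in_itv /= leey andbT; apply: integral_ge0 => x _; rewrite lee_fin powR_ge0.
- by rewrite in_itv /= leey andbT lee_fin powR_ge0.
Qed.

(** Equality in Hoelder asks for [|h|^t] proportional to [|X|^p], whose logarithm
    is not Lipschitz at the zeros of [X]; truncating [|X|] from below at [eps]
    costs only the factor [1 + k]. *)
Lemma exists_almost_extremal (k : R) : 0 < k -> exists h : R[i] -> R[i],
  [/\ hardy t h, (circle_norm t h <= 1)%E &
      ((A `^ p^-1 / (1 + k))%:E <= circle_norm 2 (mul_op X h))%E].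
Proof.
move=> k0; have A0 := mean_absXp_gt0; have s0 := conj_gt0 hp.
have k1 : 0 < 1 + k by rewrite addr_gt0.
(* the truncation adds at most [eps^p = k A] to the mean of [|X|^p] *)
pose eps := (k * A) `^ p^-1.
have eps0 : 0 < eps by rewrite powR_gt0 // mulr_gt0.
have epsp : eps `^ p = k * A.
  by rewrite -powRrM mulVf // powRr1 // mulr_ge0 // ltW.
pose D := (1 + k) * A; have D0 : 0 < D by rewrite mulr_gt0.
pose m w := Num.max (cabs (X w)) eps.
have m0 w : 0 < m w by rewrite lt_max eps0 orbT.
have Xlip : lipschitz_on_circle (fun w => cabs (X w)).
  have [LL LL0 hL] := @circle_lip_pow_sum R M (d / Num.sqrt M%:R)%:C (fun k => L + N * k)%N.
  exists LL => // z w z1 w1.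
  have e y : X y = (d / Num.sqrt M%:R)%:C * \sum_(i < M) y ^+ (L + N * i).
    rewrite /Xpoly /dirichlet -mulrA; congr (_ * _); rewrite mulr_sumr.
    by apply: eq_bigr => i _; rewrite exprD exprM.
  by rewrite !e hL.
have glip : lipschitz_on_circle (fun w => p / t * ln (m w) + - (t^-1 * ln D)).
  apply: circle_lipD; last exact: circle_lip_cst.
  apply: circle_lipZ; apply: (circle_lip_ln eps0); first exact: circle_lip_maxr.
  by move=> w _; rewrite /m le_max lexx orbT.
have [h [h1 _ h3]] := exists_outer t0 glip.
have ha x : cabs (h (expi x)) = m (expi x) `^ (p / t) * D `^ (- t^-1).
  by rewrite h3 ?cabs_expi // expRD /powR !gt_eqF ?mulNr.
have mX x : m (expi x) = Num.max (absX x) eps by [].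
have bm : bmeas (fun x => m (expi x)).
  split; first by apply: measurable_maxr => //; exact: (bmeas_absX M N L d).1.
  have [B hB] := (bmeas_absX M N L d).2; exists (Num.max B eps) => x.
  rewrite (gtr0_norm (m0 _)) mX ge_max !le_max (le_trans (ler_norm _) (hB x)) lexx.
  by rewrite orbT.
have ht x : cabs (h (expi x)) `^ t = D^-1 * m (expi x) `^ p.
  rewrite ha powRM ?powR_ge0 // -!powRrM divfK // mulrC mulNr mulVf //.
  by rewrite powR_inv1 // ltW.
have bmp : bmeas (fun x => m (expi x) `^ p) by apply: bmeas_powR => //; exact: ltW.
exists h; split => //.
  rewrite circle_norm_mean //; last first.
    by under eq_fun do rewrite ht; exact: bmeasZ.
  rewrite lee_fin.
  rewrite (eq_mean ht).
  rewrite meanZ //.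
  have mp : mean (fun x => m (expi x) `^ p) <= D.
    have -> : D = A + k * A by rewrite /D mulrDl mul1r.
    rewrite -[X in _ + X](mean_cst (k * A)) -meanD; [|exact: bmeas_absXp|exact: bmeas_cst].
    apply: le_mean => [//||x].
      by apply: bmeasD; [exact: bmeas_absXp|exact: bmeas_cst].
    rewrite -epsp mX maxEle; case: ifP => _.
      by rewrite lerDr powR_ge0.
    by rewrite lerDl powR_ge0.
  have h4 : D^-1 * mean (fun x => m (expi x) `^ p) <= 1.
    by rewrite mulrC ler_pdivrMr // mul1r.
  apply: (powR_le1 _ h4); last by rewrite invr_ge0 ltW.
  apply: mulr_ge0; first by rewrite invr_ge0 ltW.
  by apply: mean_ge0 => x; exact: powR_ge0.
have h2 x : cabs (mul_op X h (expi x)) `^ 2 =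
    D `^ (- (1 - 2 / p)) * (absX x ^+ 2 * m (expi x) `^ (p - 2)).
  rewrite cabs_mul_X (sqr_powRt (cabs_ge0 (h (expi x)))) ht powRM ?powR_ge0 ?invr_ge0 ?(ltW D0) //.
  rewrite -powRrM -[D^-1]powR_inv1 ?(ltW D0) // -powRrM mulN1r.
  have -> : p * (1 - 2 / p) = p - 2 by field.
  by rewrite mulrCA.
have bm2 : bmeas (fun x => absX x ^+ 2 * m (expi x) `^ (p - 2)).
  apply: bmeasM; first exact: bmeas_sqr_absX.
  by apply: bmeas_powR => //; rewrite subr_ge0 ltW.
rewrite circle_norm_mean ?pnatr_eq0 //; last first.
  by under eq_fun do rewrite h2; exact: bmeasZ.
rewrite lee_fin; apply: le_sqrt_powR.
  by rewrite divr_ge0 ?powR_ge0 // ltW.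
rewrite (eq_mean h2).
rewrite meanZ //.
have hA : A <= mean (fun x => absX x ^+ 2 * m (expi x) `^ (p - 2)).
  apply: le_mean => // [|x]; first exact: bmeas_absXp.
  have -> : absX x `^ p = absX x ^+ 2 * absX x `^ (p - 2).
    rewrite -(powR_mulrn 2 (absX_ge0 M N L d x)) -powRD.
      by rewrite addrC subrK.
    by rewrite addrC subrK (negbTE pn).
  rewrite ler_wpM2l ?sqr_ge0 // ge0_ler_powR ?nnegrE ?absX_ge0 ?(ltW (m0 _)) //.
    by rewrite subr_ge0 ltW.
  by rewrite mX le_max lexx.
apply: (@le_trans _ _ (D `^ (- (1 - 2 / p)) * A)); last by rewrite ler_wpM2l ?powR_ge0.
have -> : D `^ (- (1 - 2 / p)) * A = (1 + k) `^ (- (1 - 2 / p)) * A `^ (2 / p).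
  rewrite /D powRM ?(ltW k1) ?(ltW A0) // -mulrA; congr (_ * _).
  rewrite -[X in _ * X]powRr1 ?(ltW A0) // -powRD; last by rewrite (gt_eqF A0) implybT.
  by congr (_ `^ _); ring.
have -> : (A `^ p^-1 / (1 + k)) ^+ 2 = (1 + k) ^- 2 * A `^ (2 / p).
  rewrite exprMn exprVn mulrC; congr (_ * _).
  by rewrite -powR_mulrn ?powR_ge0 // -powRrM; congr (_ `^ _); rewrite mulrC.
rewrite ler_wpM2r ?powR_ge0 // -powR_invn ?(ltW k1) // ler_powR //; first by lra.
by have := conj_le1 hp; lra.
Qed.

Lemma opnorm_mul_X : hardy_opnorm t 2 (mul_op X) = circle_norm p X.
Proof.
apply/eqP; rewrite eq_le; apply/andP; split.
  apply: ge_ereal_sup => _ [h /= [h1 h2] <-].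
  exact: circle_norm_mul_le.
have A0 := mean_absXp_gt0.
rewrite circle_norm_X; set V := A `^ p^-1; have V0 : 0 < V by rewrite powR_gt0.
apply/lee_addgt0Pr => e e0.
(* [V / (1 + e / V) >= V - e] *)
have eV : 0 < e / V by rewrite divr_gt0.
have [h [h1 h2 h3]] := exists_almost_extremal eV.
apply: (@le_trans _ _ ((V / (1 + e / V))%:E + e%:E)%E).
  rewrite -EFinD lee_fin -lerBlDr ler_pdivlMr ?addr_gt0 //.
  have -> : (V - e) * (1 + e / V) = V - e ^+ 2 / V by field; rewrite gt_eqF.
  by rewrite gerBl divr_ge0 ?sqr_ge0 // ltW.
apply: leeD => //; apply: le_trans h3 _.
by apply: ereal_sup_ubound; exists h.
Qed.

End Multiplier.

(** * Products with the symbol stay in the Hardy space *)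

Section HardyProduct.
Context {R : realType}.
Implicit Types (f g h : R[i] -> R[i]).

Let entire f := forall z, derivable (f : R[i]^o -> R[i]^o) z 1.

Let entire_cst (c : R[i]) : entire (fun=> c).
Proof. by move=> z; exact: derivable_cst. Qed.

Let entire_id : entire (fun z => z).
Proof. by move=> z; exact: derivable_id. Qed.

Let entireM f g : entire f -> entire g -> entire (fun z => f z * g z).
Proof. by move=> hf hg z; exact: (@derivableM R[i] R[i]^o f g z 1 (hf z) (hg z)). Qed.

Let entireD f g : entire f -> entire g -> entire (fun z => f z + g z).
Proof. by move=> hf hg z; exact: (@derivableD R[i] R[i]^o R[i]^o f g z 1 (hf z) (hg z)). Qed.

Let entireX f n : entire f -> entire (fun z => f z ^+ n).
Proof.
move=> hf; elim: n => [|n IH].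
  by under eq_fun do rewrite expr0; exact: entire_cst.
by under eq_fun do rewrite exprS; exact: entireM.
Qed.

Lemma derivable_Xpoly M N L (d : R) (z : R[i]) :
  derivable (Xpoly M N L d : R[i]^o -> R[i]^o) z 1.
Proof.
have h : entire (fun z => dirichlet M (z ^+ N)).
  elim: M => [|M IH].
    by under eq_fun do rewrite /dirichlet big_ord0; exact: entire_cst.
  under eq_fun do rewrite dirichletS.
  exact (@entireD _ _ (@entire_cst 1) (@entireM _ _ (@entireX _ N (@entire_id)) IH)).
exact (@entireM _ _ (@entireM _ _ (@entire_cst (d / Num.sqrt M%:R)%:C)
  (@entireX _ L (@entire_id))) h z).
Qed.

Lemma cabs_Xpoly_le M N L (d : R) z : 0 < d -> cabs z <= 1 ->
  cabs (Xpoly M N L d z) <= d / Num.sqrt M%:R * M%:R.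
Proof.
move=> d0 z1; rewrite /Xpoly !cabsM cabsX cabsC ger0_norm; last first.
  by rewrite divr_ge0 ?sqrtr_ge0 // ltW.
have h0 : 0 <= d / Num.sqrt M%:R by rewrite divr_ge0 ?sqrtr_ge0 // ltW.
rewrite -mulrA ler_wpM2l //.
rewrite -[leRHS]mul1r; apply: ler_pM; rewrite ?exprn_ge0 ?cabs_ge0 //.
  by rewrite exprn_ile1 // cabs_ge0.
by rewrite cabs_dirichlet_le // cabsX exprn_ile1 // cabs_ge0.
Qed.

(** [x^2 <= 1 + x^t] for [t >= 2] bounds the square mean by the [t]-mean
    uniformly, which is all that membership in the Hardy space needs. *)
Lemma circle_norm2_mul_le (t B : R) f h (W : \bar R) : 2 <= t -> (0 <= W)%E ->
  measurable_fun setT (fun x : R => cabs (h (expi x))) ->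
  measurable_fun setT (fun x : R => cabs (f (expi x) * h (expi x))) ->
  (forall x, cabs (f (expi x)) <= B) -> (circle_norm t h <= W)%E ->
  (circle_norm 2 (mul_op f h) <= ((B ^+ 2)%:E * (1 + W `^ t)) `^ 2^-1)%E.
Proof.
move=> t2 W0 mh mfh fB hW; have t0 : 0 < t by apply: lt_le_trans t2.
have tn : t != 0 by rewrite gt_eqF.
have I0 : (0 <= \int[haar R]_x (cabs (h (expi x)) `^ t)%:E)%E.
  by apply: integral_ge0 => x _; rewrite lee_fin powR_ge0.
have hI : (\int[haar R]_x (cabs (h (expi x)) `^ t)%:E <= W `^ t)%E.
  move: hW; rewrite circle_normE // => hW.
  have : (((\int[haar R]_x (cabs (h (expi x)) `^ t)%:E) `^ t^-1) `^ t <= W `^ t)%E.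
    apply: gt0_ler_poweR => //; first exact: ltW.
      by rewrite in_itv /= poweR_ge0 leey.
    by rewrite in_itv /= W0 leey.
  by rewrite -poweRrM mulVf // poweRe1.
have mt : measurable_fun setT (fun x => cabs (h (expi x)) `^ t).
  exact: (measurableT_comp (measurable_powR t)).
rewrite circle_normE ?pnatr_eq0 //; apply: gt0_ler_poweR => //.
- by rewrite in_itv /= leey andbT; apply: integral_ge0 => x _; rewrite lee_fin powR_ge0.
- rewrite in_itv /= leey andbT; apply: mule_ge0; first by rewrite lee_fin sqr_ge0.
  by apply: adde_ge0 => //; exact: poweR_ge0.
apply: (@le_trans _ _ (\int[haar R]_x ((B ^+ 2)%:E * (1 + (cabs (h (expi x)) `^ t)%:E)))%E).
  apply: ge0_le_integral => //.
  - by move=> x _; rewrite lee_fin powR_ge0.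
  - apply/measurable_EFinP; exact: (measurableT_comp (measurable_powR 2)).
  - apply: (@eq_measurable_fun _ _ _ _ _ (fun x => ((B ^+ 2) * (1 + cabs (h (expi x)) `^ t))%:E)).
      by move=> x _; rewrite EFinM EFinD.
    apply/measurable_EFinP; apply: measurable_funM => //; exact: measurable_funD.
  - move=> x _; rewrite -EFinD -EFinM lee_fin powR_mulrn ?cabs_ge0 // /mul_op cabsM exprMn.
    have c0 := cabs_ge0 (h (expi x)).
    apply: ler_pM; rewrite ?sqr_ge0 //.
      rewrite ler_pXn2r ?nnegrE ?cabs_ge0 //; exact: le_trans (cabs_ge0 _) (fB x).
    have [h1|h1] := leP 1 (cabs (h (expi x))).
      rewrite -powR_mulrn //; apply: le_trans (ler_powR h1 t2) _.
      by rewrite lerDr.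
    have h2 : cabs (h (expi x)) ^+ 2 <= 1 by rewrite exprn_ile1 // ltW.
    by apply: le_trans h2 _; rewrite lerDl powR_ge0.
rewrite ge0_integralZl //; last 3 first.
- apply: (@eq_measurable_fun _ _ _ _ _ (fun x => (1 + cabs (h (expi x)) `^ t)%:E)).
    by move=> x _; rewrite EFinD.
  by apply/measurable_EFinP; exact: measurable_funD.
- by move=> x _; rewrite -EFinD lee_fin addr_ge0 // powR_ge0.
- by rewrite lee_fin sqr_ge0.
apply: lee_wpmul2l; first by rewrite lee_fin sqr_ge0.
rewrite ge0_integralD //; last 2 first.
- by move=> x _; rewrite lee_fin powR_ge0.
- exact/measurable_EFinP.
apply: leeD => //.
by rewrite integral_cst //= mul1e [X in (X <= _)%E](_ : _ = 1%E) //; exact: haarT.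
Qed.

Lemma hardy_mul_X (t : R) M N L (d : R) h : 2 <= t -> 0 < d -> hardy t h ->
  hardy 2 (mul_op (Xpoly M N L d) h).
Proof.
move=> t2 d0 [hh hS m1 m2 hr]; set X := Xpoly M N L d.
have mX : cbmeas (fun x => X (expi x)) := cbmeas_X M N L d.
have [[mX1 _] [mX2 _]] := mX.
have t0 : 0 < t by apply: lt_le_trans t2.
have Xc z e : 0 < e -> exists2 del : R, 0 < del &
    forall w, cabs (w - z) < del -> cabs (X w - X z) < e.
  exact (@derivable_cont R X z (@derivable_Xpoly M N L d z) e).
split.
- move=> z z1; exact: (@derivableM R[i] R[i]^o X h z 1 (@derivable_Xpoly M N L d z) (hh z z1)).
- set S := ereal_sup _ in hS.
  pose B := d / Num.sqrt M%:R * M%:R.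
  have S0 : (0 <= S)%E.
    apply: le_trans (_ : (circle_norm t (fun z => h (0%:C * z)%R) <= S)%E).
      by rewrite circle_normE ?gt_eqF // poweR_ge0.
    by apply: ereal_sup_ubound; exists 0 => //=; rewrite lexx ltr01.
  apply: (@le_lt_trans _ _ (((B ^+ 2)%:E * (1 + S `^ t)) `^ 2^-1)%E); last first.
    apply: poweR_lty; apply: lte_mul_pinfty => //; first by rewrite lee_fin sqr_ge0.
    by apply: lte_add_pinfty; [exact: ltry|exact: poweR_lty].
  apply: ge_ereal_sup => _ [r /= /andP[r0 r1] <-].
  have r01 : 0 <= r < 1 by rewrite r0.
  have [c1 c2] := holomorphic_slice_continuous hh r01.
  have hX : holomorphic_disc X by move=> z _; exact: derivable_Xpoly.
  have [c3 c4] := holomorphic_slice_continuous hX r01.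
  apply: (@circle_norm2_mul_le t B (fun z => X (r%:C * z)) (fun z => h (r%:C * z)) S) => //.
  + by apply: measurable_cabs; exact: continuous_measurable_fun.
  + under eq_fun do rewrite cabsM.
    by apply: measurable_funM; apply: measurable_cabs; exact: continuous_measurable_fun.
  + move=> x; apply: cabs_Xpoly_le => //.
    by rewrite cabs_mul_expi cabsC ger0_norm // ltW.
  + by apply: ereal_sup_ubound; exists r.
- under eq_fun do rewrite /mul_op ReM.
  by apply: measurable_funB; apply: measurable_funM.
- under eq_fun do rewrite /mul_op ImM.
  by apply: measurable_funD; apply: measurable_funM.
- have FF : Filter (almost_everywhere (haar R)) by exact: ae_filter_ringOfSetsType.
  apply: (@filterS _ _ FF _ _ _ hr) => x hx.
  apply: (@cvgM R[i] _ _ _ (fun r : R => X (r%:C * expi x)) (fun r => h (r%:C * expi x)) _ _ _ hx).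
  apply/cvg_cabsP => e e0; have [del del0 hdel] := Xc (expi x) e e0.
  near=> r.
  rewrite cabsBC; apply: hdel.
  have r1 : r < 1 by near: r; exact: nbhs_left_lt.
  have rd : 1 - r < del by near: r; exact: nbhs_left_ltBl.
  rewrite -[X in _ - X]mul1r -mulrBl cabs_mul_expi -(rmorph1 (real_complex R)) -rmorphB cabsC.
  by rewrite ltr0_norm ?subr_lt0 // opprB.
Unshelve. all: by end_near.
Qed.

End HardyProduct.

(** * The two-sided estimates *)

Section Comparison.
Context {R : realType}.
Variables (p : R) (M N K L : nat) (d : R).
Hypotheses (hp : 2 < p) (hM : (2 <= M)%N) (hN : (2 <= N)%N) (hK : (1 <= K)%N) (hd : 0 < d).

Let t : R := 2 * p / (p - 2).
Let t0 : 0 < t. Proof. exact: conj_exponent_gt0. Qed.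
Let y : R := M%:R `^ t^-1 * Num.min 1 ((K%:R / N%:R) `^ p^-1).

Local Notation X := (Xpoly M N L d).
Local Notation S := (ereal_sup [set circle_norm 2 (mul_op X h) | h in calA t K]).

Let y0 : 0 <= y.
Proof. by rewrite mulr_ge0 ?powR_ge0 // le_min ler01 powR_ge0. Qed.

Lemma energy_ge0 (a : 'I_K -> R[i]) (c : 'I_K -> R) : 0 <= energy p M N L d a c.
Proof. by apply: mean_ge0 => x; rewrite mulr_ge0 ?sqr_ge0 ?powR_ge0. Qed.

Lemma sup_calA_le : (S <= (5 * (d * (1 + y)))%:E)%E.
Proof.
apply: ge_ereal_sup => _ [h [h1 _ [a [c [a1 c0 c1 e]]]] <-].
rewrite (circle_norm_mul_calA M N L d hp a1 h1 e) lee_fin.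
have B0 : 0 <= 5 * (d * (1 + y)) by rewrite !mulr_ge0 ?addr_ge0 ?(ltW hd).
apply: sqrt_powR_le => //; first exact: energy_ge0.
have [h2|h2] := leP 1 ((K%:R / N%:R) `^ p^-1).
  apply: le_trans (energy_le_sizeX _ hp hM hN hd a1 c0 c1) _.
  rewrite ler_pXn2r ?nnegrE ?(ltW (sizeX_gt0 _ hM hd)) // /y (min_idPl h2) mulr1 /sizeX.
  rewrite -/t; have := powR_ge0 (M%:R : R) t^-1; move: (M%:R `^ t^-1) => w w0.
  have : 0 <= d * w by rewrite mulr_ge0 ?(ltW hd).
  by have := hd; lra.
by rewrite /y (min_idPr (ltW h2)); exact: energy_le_poles.
Qed.

Lemma sup_calA_ge (a : 'I_K -> R[i]) (c : 'I_K -> R) (b : R) :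
  (forall i, cabs (a i) < 1) -> (forall i, 0 <= c i) -> \sum_(i < K) c i = 1 ->
  0 <= b -> b ^+ 2 <= energy p M N L d a c -> (b%:E <= S)%E.
Proof.
move=> a1 c0 c1 b0 hb; have [h h1 e] := exists_calA t0 a1 c0 c1.
have [h2 _ _] := h1.
apply: (@le_trans _ _ (circle_norm 2 (mul_op X h))).
  by rewrite (circle_norm_mul_calA M N L d hp a1 h2 e) lee_fin le_sqrt_powR.
by apply: ereal_sup_ubound; exists h.
Qed.

Lemma le_sup_calA : ((8^-1 * (d * (1 + y)))%:E <= S)%E.
Proof.
(* all poles at the origin, i.e. [h] of modulus 1 *)
have h1 : (d%:E <= S)%E.
  have K0 : K%:R != 0 :> R by rewrite pnatr_eq0 -lt0n.
  have s1 : \sum_(i < K) (K%:R^-1 : R) = 1.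
    by rewrite sumr_const card_ord -[LHS]mulr_natr mulVf.
  apply: (@sup_calA_ge (fun=> 0) (fun=> K%:R^-1)) => //; rewrite ?(ltW hd) //.
  - by move=> _; rewrite cabs0.
  - rewrite /energy -(mean_sqr_absX L hM hN hd) le_eqVlt; apply/orP; left; apply/eqP.
    apply: eq_mean => x; rewrite /psum (eq_bigr (fun=> K%:R^-1)).
      by rewrite s1 powR1 mulr1.
    by move=> i _; rewrite poisson0 mulr1.
have h2 : ((d * y / 4)%:E <= S)%E.
  have [a [c [a1 c0 c1 hE]]] := exists_energy_ge L hp hM hN hd hK.
  by apply: (sup_calA_ge a1 c0 c1 _ hE); rewrite divr_ge0 ?mulr_ge0 ?(ltW hd).
have [h|h] := leP 1 y.
  apply: le_trans h2; rewrite lee_fin; move: (y) h => z h.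
  have : d * 1 <= d * z by rewrite ler_pM2l.
  by lra.
apply: le_trans h1; rewrite lee_fin; move: (y) h => z h.
have : d * z <= d * 1 by rewrite ler_pM2l // ltW.
by have := hd; lra.
Qed.

(** With [K = N] this turns the lower bound for the supremum into the lower bound
    for the norm of [X]. *)
Lemma sup_calA_le_norm : (S <= circle_norm p X)%E.
Proof.
apply: ge_ereal_sup => _ [h [h1 _ [a [c [a1 c0 c1 e]]]] <-].
rewrite (circle_norm_mul_calA M N L d hp a1 h1 e) (circle_norm_X M N L d hp) lee_fin.
have A0 := mean_absXp_gt0 L hp hM hN hd.
apply: sqrt_powR_le; first exact: energy_ge0.
  exact: powR_ge0.
rewrite -powR_mulrn ?powR_ge0 // -powRrM (mulrC p^-1).
exact: (energy_le_Lp hp a1 c0 c1 A0 (lexx _)).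
Qed.

End Comparison.

Theorem proposition6p3 (R : realType) (p : R) (hp : 2 < p) :
  let t : R := 2 * p / (p - 2) in
  exists c C : R,
    [/\ 0 < c, 0 < C &
      forall (M N K L : nat) (d : R),
        (2 <= M)%N -> (2 <= N)%N -> (1 <= K)%N -> 0 < d ->
        let X := Xpoly M N L d in
        let S := ereal_sup [set circle_norm 2 (mul_op X h) | h in calA t K] in
        let B := d * (1 + M%:R `^ t^-1
                          * Num.min 1 ((K%:R / N%:R) `^ p^-1)) in
        [/\ ((c * B)%:E <= S /\ S <= (C * B)%:E)%E,
            forall h, hardy t h -> hardy 2 (mul_op X h),
            hardy_opnorm t 2 (mul_op X) = circle_norm p X &
            ((c * (d * M%:R `^ t^-1))%:E <= circle_norm p X /\
             circle_norm p X <= (C * (d * M%:R `^ t^-1))%:E)%E]].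
Proof.
move=> t; exists 8^-1, 5; split; [by rewrite invr_gt0| by []|].
move=> M N K L d hM hN hK hd X S B; split.
- by split; [exact: le_sup_calA|exact: sup_calA_le].
- move=> h hh; apply: hardy_mul_X hh => //.
  rewrite /t ler_pdivlMr ?subr_gt0 //; lra.
- exact: opnorm_mul_X.
have m0 : 0 <= d * M%:R `^ t^-1 by rewrite mulr_ge0 ?powR_ge0 ?(ltW hd).
split.
  have hN1 : (1 <= N)%N by exact: ltnW.
  apply: (le_trans _ (sup_calA_le_norm N L hp hM hN hd)).
  apply: (le_trans _ (le_sup_calA L hp hM hN hN1 hd)).
  rewrite lee_fin divff ?pnatr_eq0 ?gtn_eqF // powR1 minxx mulr1 -/t.
  by rewrite ler_pM2l ?invr_gt0 // mulrDr mulr1 lerDr ltW.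
rewrite circle_norm_X // lee_fin.
have A0 := mean_absXp_gt0 L hp hM hN hd.
apply: (@le_trans _ _ ((sizeX p M d `^ p) `^ p^-1)).
  have p0 : 0 <= p^-1 by rewrite invr_ge0; lra.
  have h := mean_absXp_le L hp hM hN hd.
  apply: ge0_ler_powR => //; rewrite nnegrE ?powR_ge0 //.
  exact: ltW.
have pn : p != 0 by rewrite gt_eqF //; lra.
rewrite -powRrM divff // powRr1; last exact: ltW (sizeX_gt0 _ _ _).
by rewrite /sizeX -/t; lra.
Qed.
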